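(* Let $1\le p<\infty$ and let $A^p_\phi$ be the weighted Bergman space corresponding to the non-radial weight $\phi(z)=|g(z)|^\gamma$ on $\mathbb{D}$, where $0<\gamma<1$ and $g$ is a univalent analytic function on $\mathbb{D}$ having positive real part, with $g(0)=1$. Let $w=(w_n)_{n\ge1}$ be a sequence of non-zero complex numbers and assume that $B_w$ is bounded on $A^p_\phi$. Then the following hold. (i) $B_w$ is hypercyclic on $A^p_\phi$ if $$\sup_{n\ge1}\left(|w_1\cdots w_n|\Big(\int_0^1\int_0^{2\pi}r^{pn+1}|g(re^{i\theta})|^\gamma\,d\theta\,dr\Big)^{-\frac1p}\right)=\infty.$$ (ii) Conversely, if $B_w$ is hypercyclic on $A^p_\phi$, then for every $0<r<1$, $$\sup_{n\ge1}\left(|w_1\cdots w_n|\frac{1}{r^n(1-r)^{\frac2p}}\int_0^{2\pi}\frac{d\theta}{|g(re^{i\theta})|^{\frac\gamma p}}\right)=\infty.$$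
   Context: $\mathbb{D}$ is the open unit disc in $\mathbb{C}$ and $dA=\frac1\pi dx\,dy$. $A^p_\phi$ is the space of analytic $f$ on $\mathbb{D}$ with $\|f\|^p_{A^p_\phi}=\int_{\mathbb{D}}|f|^p\phi\,dA<\infty$. The weighted backward shift is $B_w\big(\sum_{n\ge0}\lambda_nz^n\big)=\sum_{n\ge0}w_{n+1}\lambda_{n+1}z^n$. A bounded operator $T$ on a separable Banach space is hypercyclic if it has a dense orbit $\{x,Tx,T^2x,\dots\}$. Throughout, weight sequences $w$ have non-zero terms. *)

(* Defs.v *)
From HB Require Import structures.
From mathcomp Require Import all_boot all_order all_algebra.
From mathcomp Require Import all_classical all_reals all_analysis.
From mathcomp Require Export complex.

Set Implicit Arguments.
Unset Strict Implicit.
Unset Printing Implicit Defensive.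

Import Order.TTheory GRing.Theory Num.Theory.
Import numFieldTopology.Exports numFieldNormedType.Exports.
Export numFieldTopology.Exports numFieldNormedType.Exports.

Local Open Scope classical_set_scope.
Local Open Scope ring_scope.
Local Open Scope complex_scope.

(* [Normc.normc z] is the modulus with values in [R], whereas the norm [`|z|]
   of [R[i]] takes its values in [R[i]]. *)
Notation modulus := Normc.normc.

Section BergmanSpace.
Variable R : realType.
Implicit Types (f g h : R[i] -> R[i]) (a w : nat -> R[i]) (phi : R[i] -> R).

Definition unit_disc : set R[i] := [set z | modulus z < 1].

(* [R[i]] is a normed module over itself, so this is complex
   differentiability. *)
Definition analytic_on_disc f : Prop :=
  forall z, unit_disc z -> derivable (f : R[i]^o -> R[i]^o) z 1.

Definition univalent_on_disc f : Prop :=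
  analytic_on_disc f /\ {in unit_disc &, injective f}.

Definition disc_integral (F : R[i] -> R) : \bar R :=
  ((pi^-1)%:E *
   \int[(lebesgue_measure \x lebesgue_measure)%E]_(u in
       [set u : R * R | unit_disc (u.1 +i* u.2)])
     (F (u.1 +i* u.2)%C)%:E)%E.

Definition bergman_norm (p : R) phi f : \bar R :=
  (disc_integral (fun z => (modulus (f z) `^ p * phi z)%R) `^ p^-1)%E.

(* Elements are represented by total functions, of which only the restriction
   to the disc matters. *)
Definition bergman (p : R) phi : set (R[i] -> R[i]) :=
  [set f | analytic_on_disc f /\
    (disc_integral (fun z => (modulus (f z) `^ p * phi z)%R) < +oo)%E].

Definition power_series a (z : R[i]) : (R[i]^o)^nat :=
  series (fun n => a n * z ^+ n).

Definition expansion a f : Prop :=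
  forall z, unit_disc z -> power_series a z @ \oo --> (f z : R[i]^o).

Definition taylor f : nat -> R[i] := xget (fun=> 0) [set a | expansion a f].

Definition shift_seq w a : nat -> R[i] := fun n => w n.+1 * a n.+1.

Definition backward_shift w f : R[i] -> R[i] :=
  fun z => limn (power_series (shift_seq w (taylor f)) z).

(* The first conjunct makes [backward_shift w f] the actual sum of the shifted
   series: [limn] has a default value when there is no limit. *)
Definition bounded_backward_shift (p : R) phi w : Prop :=
  (forall f, bergman p phi f ->
     expansion (shift_seq w (taylor f)) (backward_shift w f) /\
     bergman p phi (backward_shift w f)) /\
  exists K : R, forall f, bergman p phi f ->
    (bergman_norm p phi (backward_shift w f) <= K%:E * bergman_norm p phi f)%E.

Definition hypercyclic (p : R) phi (T : (R[i] -> R[i]) -> R[i] -> R[i]) :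
    Prop :=
  exists2 f, bergman p phi f &
    forall h, bergman p phi h -> forall e : R, 0 < e ->
      exists n : nat, (bergman_norm p phi (iter n T f \- h)%R < e%:E)%E.

Definition polar (r t : R) : R[i] := (r * cos t) +i* (r * sin t).

End BergmanSpace.

(* Main.v *)
Require Import Defs.
From mathcomp Require Import all_boot all_order all_algebra.
From mathcomp Require Import all_classical all_reals all_analysis complex.
From mathcomp Require Import measurable_realfun ring lra.

Set Implicit Arguments.
Unset Strict Implicit.
Unset Printing Implicit Defensive.

Import Order.TTheory GRing.Theory Num.Theory numFieldNormedType.Exports.
Local Open Scope classical_set_scope.
Local Open Scope ring_scope.
Local Open Scope complex_scope.

(* Write [E f] for the integral of [|f|^p phi] over the disc and [W_n] for
   [w_1 ... w_n].

   (i) Some term of the supremum is positive, so some moment is finite (an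
   infinite integral has the junk value [0], and [0] to a nonzero power is
   [0]), and [phi] is integrable.  Polynomials are then dense:
   for [Re w > 0] and [gamma < 1 <= p] one has
     [|w / (1 + e w)|^p <= e^-p |w|^gamma] and [|e + w|^-p |w|^gamma <= e^-p],
   so [h g / (1 + e g)] lies in the unweighted Bergman space, where its dilates
   converge to it and are uniform limits of polynomials, while division by
   [e + g] leads back to the weighted space; for [e -> 0] the function
   [h g / ((1 + e g) (e + g))] tends to [h] dominatedly.  Boundedness of [B_w]
   gives [u_(n-1) <= K u_n] for [u_n = E (z^n) / |W_n|^p], so [u] is small on
   arbitrarily long windows, and a hypercyclic vector is obtained as a lacunary
   series of right inverse images of polynomials.  Only
   [|x + y|^p <= 2^p (|x|^p + |y|^p)] is used, never Minkowski's inequality.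

   (ii) For fixed [r] only [|W_n| r^-n] varies.  If it were bounded, then so
   would be [(B_w^(n+1) f)(0) = W_n b_n], where [b] are the coefficients of
   [B_w f]; but evaluation at [0] is continuous, and the multiples of
   [1 / (1 + g)] take arbitrarily large values there. *)

(** * Integrals of closed forms on rectangles *)

(** Membership in the space only asks for complex differentiability, so the function theory starts
    from Goursat's bisection: no derivative is assumed continuous. Contour integrals appear as
    integrals of closed 1-forms over rectangles in the parameters of a homotopy.

    The obstacle to density is that [phi] is not radial and may degenerate or blow up at the
    boundary: the substitution [z -> rho z] does not control the weighted energy of a dilate by that
    of the function. Dilation is therefore used for the constant weight only, and a factor
    [1 / (e + g)], bounded because [Re g > 0], absorbs [phi].

    Coefficients enter only through [expansion]. Boundedness of [B_w] hands over an expansion of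
    [B_w f], so orbits in (ii) are read off from [B_w f], while the vector of (i) is built from its
    coefficients.

    The iterate [B_w^n] may multiply energies by [K^n]; each block of the lacunary series is
    therefore chosen after the previous shift is known, and small compared with the inverse of [K]
    to that power. *)

Section ContinuousOnSegment.
Variable R : realType.
Implicit Types (f g : R -> R) (a b c : R).

(** Only points of the segment are tested, so the endpoints need no special treatment, and the
    estimates below produce such a [d] directly. *)
Definition seg_cont a b f := forall x, a <= x <= b -> forall e, 0 < e ->
  exists2 d, 0 < d &
    forall y, a <= y <= b -> `|y - x| < d -> `|f y - f x| < e.

Definition Rint a b f : R := (\int[lebesgue_measure]_(t in `[a, b]) f t)%R.

Lemma seg_cont_within a b f : seg_cont a b f -> {within `[a, b], continuous f}.
Proof.
move=> fc; apply/subspace_continuousP => x /= xab.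
have xab' : a <= x <= b by move: xab; rewrite in_itv.
apply/cvgrPdist_lt => e e0.
have [d d0 fd] := fc x xab' e e0.
near=> y; rewrite distrC; apply: fd.
- have : `[a, b]%classic y by near: y; apply: withinT; exact: nbhs_filter.
  by rewrite /= in_itv.
- rewrite distrC; near: y; apply: cvg_within.
  by have /cvgrPdist_lt := @cvg_id _ (nbhs x); apply.
Unshelve. all: by end_near. Qed.

Lemma seg_cont_integrable a b f : seg_cont a b f ->
  lebesgue_measure.-integrable `[a, b] (EFin \o f).
Proof.
move=> fc; apply: continuous_compact_integrable; first exact: segment_compact.
exact: seg_cont_within.
Qed.

Lemma seg_contS a b c d f : a <= c -> d <= b -> seg_cont a b f -> seg_cont c d f.
Proof.
move=> ac db fc x /andP[cx xd] e e0.
have [|k k0 fk] := fc x _ e e0; first by apply/andP; split; lra.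
by exists k => // y /andP[cy yd]; apply: fk; apply/andP; split; lra.
Qed.

Lemma Rint_cst a b c : a <= b -> Rint a b (fun=> c) = c * (b - a).
Proof.
move=> ab; rewrite /Rint Rintegral_cst//= lebesgue_measure_itv/= lte_fin.
by case: ltP => //= ba; rewrite (_ : b = a) ?subrr//; lra.
Qed.

Lemma RintD a b f g : seg_cont a b f -> seg_cont a b g ->
  Rint a b (fun t => f t + g t) = Rint a b f + Rint a b g.
Proof. by move=> fc gc; rewrite /Rint RintegralD//; exact: seg_cont_integrable. Qed.

Lemma RintB a b f g : seg_cont a b f -> seg_cont a b g ->
  Rint a b (fun t => f t - g t) = Rint a b f - Rint a b g.
Proof. by move=> fc gc; rewrite /Rint RintegralB//; exact: seg_cont_integrable. Qed.

Lemma RintZ a b k f : seg_cont a b f ->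
  Rint a b (fun t => k * f t) = k * Rint a b f.
Proof. by move=> fc; rewrite /Rint RintegralZl//; exact: seg_cont_integrable. Qed.

Lemma eq_Rint a b f g : (forall t, a <= t <= b -> f t = g t) ->
  Rint a b f = Rint a b g.
Proof.
by move=> fg; apply: eq_Rintegral => t; rewrite inE/= in_itv/= => /fg.
Qed.

Lemma seg_cont_cst a b c : seg_cont a b (fun=> c).
Proof. by move=> x _ e e0; exists 1 => // y _ _; rewrite subrr normr0. Qed.

Lemma seg_contD a b f g : seg_cont a b f -> seg_cont a b g ->
  seg_cont a b (fun t => f t + g t).
Proof.
move=> fc gc x xab e e0; have e20 : 0 < e / 2 by rewrite divr_gt0.
have [d d0 fd] := fc x xab _ e20; have [k k0 gk] := gc x xab _ e20.
exists (Num.min d k); first by rewrite lt_min d0.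
move=> y yab; rewrite lt_min => /andP[/(fd _ yab) h1 /(gk _ yab) h2].
rewrite opprD addrACA; apply: le_lt_trans (ler_normD _ _) _.
by rewrite [ltRHS](splitr e) ltrD.
Qed.

Lemma seg_contZ a b k f : seg_cont a b f -> seg_cont a b (fun t => k * f t).
Proof.
move=> fc x xab e e0; have [|d d0 fd] := fc x xab (e / (`|k| + 1)).
  by rewrite divr_gt0// ltr_wpDl.
exists d => // y yab /(fd _ yab) h; rewrite -mulrBr normrM.
apply: (@le_lt_trans _ _ ((`|k| + 1) * `|f y - f x|)).
  by rewrite ler_wpM2r// lerDl.
by rewrite mulrC -ltr_pdivlMr// ltr_wpDl.
Qed.

Lemma seg_contB a b f g : seg_cont a b f -> seg_cont a b g ->
  seg_cont a b (fun t => f t - g t).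
Proof.
move=> fc gc.
rewrite (_ : (fun t => f t - g t) = fun t => f t + -1 * g t).
  by apply: seg_contD => //; exact: seg_contZ.
by apply/funext => t; rewrite mulN1r.
Qed.

Lemma le_Rint a b f g : seg_cont a b f -> seg_cont a b g ->
  (forall t, a <= t <= b -> f t <= g t) -> Rint a b f <= Rint a b g.
Proof.
move=> fc gc fg; apply: le_Rintegral => //; try exact: seg_cont_integrable.
Qed.

Lemma Rint_split a b c f : a <= c -> c <= b -> seg_cont a b f ->
  Rint a b f = Rint a c f + Rint c b f.
Proof.
move=> ac cb fc.
have fi := seg_cont_integrable fc.
have E := @Rintegral_itvB R f (BLeft a) (BRight b) c fi.
rewrite /Rint -[RHS]addrC; apply/eqP; rewrite -subr_eq; apply/eqP.
rewrite E ?bnd_simp//.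
apply: Rintegral_itv_obnd_cbnd.
apply: integrableS fi => //.
by apply: subset_itv; rewrite bnd_simp.
Qed.

Lemma Rint_approx a b f (m e : R) : a <= b -> seg_cont a b f ->
  (forall t, a <= t <= b -> `|f t - m| <= e) ->
  `|Rint a b f - m * (b - a)| <= e * (b - a).
Proof.
move=> ab fc fme.
rewrite ler_norml -mulNr -!(Rint_cst _ ab) -RintB//; last exact: seg_cont_cst.
have fmc := seg_contB fc (@seg_cont_cst a b m).
by apply/andP; split; apply: le_Rint => //; try exact: seg_cont_cst;
  move=> t /fme; rewrite ler_norml => /andP[].
Qed.

Lemma Rint_norm_le a b f (e : R) : a <= b -> seg_cont a b f ->
  (forall t, a <= t <= b -> `|f t| <= e) -> `|Rint a b f| <= e * (b - a).
Proof.
move=> ab fc fe; have := @Rint_approx a b f 0 e ab fc.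
by rewrite mul0r subr0; apply => t /fe; rewrite subr0.
Qed.

(** Supplies the integrability of a closed form along horizontal and vertical segments from its
    differentiability at each point. *)
Lemma differentiable_seg_cont (u : R -> R) (x y : R) :
  (forall s, x <= s <= y -> exists l, forall e, 0 < e ->
    exists2 k, 0 < k & forall s', x <= s' <= y -> `|s' - s| < k ->
      `|u s' - u s - l * (s' - s)| <= e * `|s' - s|) ->
  seg_cont x y u.
Proof.
move=> ud s sxy e e0.
have [l ul] := ud s sxy.
have [k k0 uk] := ul 1 ltr01.
pose L := `|l| + 1.
have L0 : 0 < L by rewrite /L ltr_wpDl.
exists (Num.min k (e / L)); first by rewrite lt_min k0 divr_gt0.
move=> z zxy; rewrite lt_min => /andP[zk ze].
have := uk z zxy zk; rewrite mul1r => h.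
rewrite (_ : u z - u s = (u z - u s - l * (z - s)) + l * (z - s)); last by ring.
apply: (le_lt_trans (ler_normD _ _)).
rewrite normrM.
apply: (@le_lt_trans _ _ (L * `|z - s|)); first by rewrite /L mulrDl mul1r addrC lerD2l.
by rewrite mulrC -ltr_pdivlMr.
Qed.

Lemma ler_half_steps (x h : R) : 0 < h ->
  [/\ x <= x + h, x + h <= x + 2 * h & x + h + h <= x + 2 * h].
Proof. by move=> h0; split; lra. Qed.

Lemma ler_dist_itv (x h s s' : R) : x <= s <= x + h -> x <= s' <= x + h -> `|s' - s| <= h.
Proof.
by move=> /andP[? ?] /andP[? ?]; rewrite ler_norml; apply/andP; split; lra.
Qed.

End ContinuousOnSegment.

(** * Goursat's theorem for closed forms on a rectangle *)

Section Goursat.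
Variable R : realType.
Variables P Q : R -> R -> R.
Variables a b c d : R.
Hypothesis ab : a < b.
Hypothesis cd : c < d.

(* The 1-form [P ds + Q dt] is closed: [dP/dt = dQ/ds], with no continuity of
   the partial derivatives. *)
Definition closed_form := forall s t, a <= s <= b -> c <= t <= d ->
  exists ps m qt : R, forall e, 0 < e -> exists2 k, 0 < k &
    forall s' t', a <= s' <= b -> c <= t' <= d ->
    `|s' - s| < k -> `|t' - t| < k ->
    `|P s' t' - P s t - ps * (s' - s) - m * (t' - t)|
      <= e * (`|s' - s| + `|t' - t|) /\
    `|Q s' t' - Q s t - m * (s' - s) - qt * (t' - t)|
      <= e * (`|s' - s| + `|t' - t|).

Hypothesis PQ : closed_form.

Let Pcont t : c <= t <= d -> seg_cont a b (fun s => P s t).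
Proof.
move=> tcd; apply: differentiable_seg_cont => s sab.
have [ps [m [qt H]]] := PQ sab tcd.
exists ps => e e0; have [k k0 Hk] := H e e0; exists k => // s' s'ab s's.
have [] := Hk s' t s'ab tcd s's; first by rewrite subrr normr0.
by rewrite subrr mulr0 subr0 normr0 addr0.
Qed.

Let Qcont s : a <= s <= b -> seg_cont c d (fun t => Q s t).
Proof.
move=> sab; apply: differentiable_seg_cont => t tcd.
have [ps [m [qt H]]] := PQ sab tcd.
exists qt => e e0; have [k k0 Hk] := H e e0; exists k => // t' t'cd t't.
have [] := Hk s t' sab t'cd _ t't; first by rewrite subrr normr0.
by rewrite subrr !mulr0 !subr0 normr0 add0r.
Qed.

(** The counterclockwise integral of the form around the rectangle with corners [(x, y)] and
    [(x', y')]. *)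
Let J x x' y y' := Rint x x' (fun s => P s y) - Rint x x' (fun s => P s y')
  + Rint y y' (fun t => Q x' t) - Rint y y' (fun t => Q x t).

(** The inner edges are run through twice in opposite directions and cancel. *)
Let J_quarter x x' y y' (u := (x + x') / 2) (v := (y + y') / 2) :
  a <= x -> x <= x' -> x' <= b -> c <= y -> y <= y' -> y' <= d ->
  J x x' y y' = J x u y v + J u x' y v + J x u v y' + J u x' v y'.
Proof.
move=> ax xx' x'b cy yy' y'd; rewrite /J.
have xu : x <= u by rewrite /u; lra.
have ux : u <= x' by rewrite /u; lra.
have yv : y <= v by rewrite /v; lra.
have vy : v <= y' by rewrite /v; lra.
have splP t : c <= t <= d -> Rint x x' (P^~ t) = Rint x u (P^~ t) + Rint u x' (P^~ t).
  by move=> tcd; apply: Rint_split => //; apply: seg_contS (Pcont tcd).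
have splQ s : a <= s <= b -> Rint y y' (Q s) = Rint y v (Q s) + Rint v y' (Q s).
  by move=> sab; apply: Rint_split => //; apply: seg_contS (Qcont sab).
rewrite (splP y) 1?(splP y') ?(splQ x) ?(splQ x') => [||||]; first ring.
all: by apply/andP; split; lra.
Qed.

(** Chooses a quarter that carries at least a fourth of the boundary integral. The last quarter is
    taken without a test: by [J_quarter] it qualifies when the other three fail. *)
Let half_step (q : R * R) (h k : R) : R * R :=
  let: (x, y) := q in
  let B x y := `|J x (x + h) y (y + k)| in
  let m := `|J x (x + 2 * h) y (y + 2 * k)| / 4 in
  if m <= B x y then (x, y) else
  if m <= B (x + h) y then (x + h, y) else
  if m <= B x (y + k) then (x, y + k) else (x + h, y + k).

Let hh n := (b - a) / 2 ^+ n.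
Let kk n := (d - c) / 2 ^+ n.

Let corner := fix corner n := if n is n'.+1
  then half_step (corner n') (hh n) (kk n) else (a, c).

Let hhS n : hh n = 2 * hh n.+1.
Proof. by rewrite /hh exprS; field; rewrite expf_neq0. Qed.
Let kkS n : kk n = 2 * kk n.+1.
Proof. by rewrite /kk exprS; field; rewrite expf_neq0. Qed.
Let hh_gt0 n : 0 < hh n. Proof. by rewrite divr_gt0 ?subr_gt0 ?exprn_gt0. Qed.
Let kk_gt0 n : 0 < kk n. Proof. by rewrite divr_gt0 ?subr_gt0 ?exprn_gt0. Qed.

Let half_stepP (x y h k : R) (q := half_step (x, y) h k) :
  0 < h -> 0 < k -> a <= x -> x + 2 * h <= b -> c <= y -> y + 2 * k <= d ->
  [/\ x <= q.1, q.1 + h <= x + 2 * h, y <= q.2, q.2 + k <= y + 2 * k &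
   `|J x (x + 2 * h) y (y + 2 * k)| / 4 <= `|J q.1 (q.1 + h) q.2 (q.2 + k)|].
Proof.
move=> h0 k0 ax xb cy yd; rewrite {}/q /half_step.
have E := @J_quarter x (x + 2 * h) y (y + 2 * k).
have Eu : (x + (x + 2 * h)) / 2 = x + h by field.
have Ev : (y + (y + 2 * k)) / 2 = y + k by field.
rewrite Eu Ev in E.
have xhh : x + 2 * h = x + h + h by ring.
have ykk : y + 2 * k = y + k + k by ring.
have {}E : J x (x + 2 * h) y (y + 2 * k) =
  J x (x + h) y (y + k) + J (x + h) (x + h + h) y (y + k) +
  J x (x + h) (y + k) (y + k + k) + J (x + h) (x + h + h) (y + k) (y + k + k).
  by rewrite -xhh -ykk; apply: E; lra.
have [x1 x2 x3] := ler_half_steps x h0; have [y1 y2 y3] := ler_half_steps y k0.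
case: ifPn => [H|/negP/negP H1]; first by split.
case: ifPn => [H|/negP/negP H2]; first by split.
case: ifPn => [H|/negP/negP H3]; first by split.
split => //=.
rewrite leNgt; apply/negP => H4; move: H1 H2 H3; rewrite -!ltNge => H1 H2 H3.
have : `|J x (x + 2 * h) y (y + 2 * k)| < `|J x (x + 2 * h) y (y + 2 * k)|.
  rewrite {1}E; apply: le_lt_trans (ler_normD _ _) _.
  apply: le_lt_trans (lerD (ler_normD _ _) (lexx _)) _.
  apply: le_lt_trans (lerD (lerD (ler_normD _ _) (lexx _)) (lexx _)) _.
  set T := `|J x (x + 2 * h) y (y + 2 * k)| in H1 H2 H3 H4 *.
  by rewrite [ltRHS](_ : T = T / 4 + T / 4 + T / 4 + T / 4) ?ltrD//; field.
by rewrite ltxx.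
Qed.

Let cornerP n : let q := corner n in
  [/\ a <= q.1, q.1 + hh n <= b, c <= q.2, q.2 + kk n <= d &
   `|J a b c d| / 4 ^+ n <= `|J q.1 (q.1 + hh n) q.2 (q.2 + kk n)|].
Proof.
elim: n => [|n /=]; first by rewrite /= /hh /kk expr0 !divr1 !subrKC; split.
case: (corner n) => x y /= [ax xb cy yd Jn].
rewrite hhS kkS in xb yd Jn.
have [h1 h2 h3 h4 h5] := half_stepP (hh_gt0 n.+1) (kk_gt0 n.+1) ax xb cy yd.
split; try lra.
apply: le_trans h5; rewrite exprSr invfM mulrA ler_pM2r ?invr_gt0//.
Qed.

Let corner_mono n m : (n <= m)%N -> let q := corner n in let q' := corner m in
  [/\ q.1 <= q'.1, q'.1 + hh m <= q.1 + hh n, q.2 <= q'.2 & q'.2 + kk m <= q.2 + kk n].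
Proof.
elim: m => [|m IH]; first by rewrite leqn0 => /eqP ->.
rewrite leq_eqVlt => /predU1P[<-//|]; rewrite ltnS => /IH /=.
have [] := cornerP m.
case: (corner m) => x y /= ax xb cy yd _ [k1 k2 k3 k4].
rewrite [hh m]hhS [kk m]kkS in xb yd k2 k4.
have [h1 h2 h3 h4 h5] := half_stepP (hh_gt0 m.+1) (kk_gt0 m.+1) ax xb cy yd.
by split; lra.
Qed.

Let nested (u h : nat -> R) : (forall n, 0 < h n) ->
  (forall n m, (n <= m)%N -> u n <= u m /\ u m + h m <= u n + h n) ->
  exists x, forall n, u n <= x <= u n + h n.
Proof.
move=> h0 H; pose x := sup (range u).
have ub n : ubound (range u) (u n + h n).
  move=> _ [m _ <-]; case: (leqP n m) => nm.
    by have [_] := H _ _ nm; have := h0 m; lra.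
  by have [+ _] := H _ _ (ltnW nm); have := h0 n; lra.
exists x => n; apply/andP; split.
  apply: ub_le_sup; last by exists n.
  by exists (u 0%N + h 0%N); exact: ub.
by apply: ge_sup; [exists (u 0%N); exists 0%N | exact: ub].
Qed.

(** The chosen rectangles shrink to a point [(s, t)]. Near it the form is linear up to [e] times the
    distance; the boundary integral of the linear part vanishes by closedness, and the rest is of
    the order [e] times the squared diameter, which decays like [4 ^- n], as fast as the lower bound
    in [cornerP]. *)
Lemma goursat :
  Rint a b (fun s => P s c) - Rint a b (fun s => P s d)
  + Rint c d (fun t => Q b t) - Rint c d (fun t => Q a t) = 0.
Proof.
rewrite -[LHS]/(J a b c d); apply/eqP/negPn/negP => J0.
have [s Hs] := nested (u := fun n => (corner n).1) hh_gt0
   (fun n m nm => let: And4 h1 h2 _ _ := corner_mono nm in conj h1 h2).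
have [t Ht] := nested (u := fun n => (corner n).2) kk_gt0
   (fun n m nm => let: And4 _ _ h1 h2 := corner_mono nm in conj h1 h2).
have sab : a <= s <= b.
  by have := Hs 0%N; rewrite /= /hh expr0 divr1 addrC subrK.
have tcd : c <= t <= d.
  by have := Ht 0%N; rewrite /= /kk expr0 divr1 addrC subrK.
have [ps [m [qt H]]] := PQ sab tcd.
pose L := b - a + (d - c).
have L0 : 0 < L by move: ab cd; rewrite /L; lra.
(* The rectangle at stage [n] has half-perimeter [L / 2 ^+ n], so the upper bound
   [2 * e * (h + g) ^+ 2] becomes half of the lower bound [|J a b c d| / 4 ^+ n]. *)
pose e := `|J a b c d| / (4 * L ^+ 2).
have e0 : 0 < e by rewrite divr_gt0 ?normr_gt0// mulr_gt0// exprn_gt0.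
have [k k0 Hk] := H e e0.
have [n Ln] : exists n, L / 2 ^+ n < k.
  exists (Num.bound (L / k)); rewrite ltr_pdivrMr ?exprn_gt0// mulrC -ltr_pdivrMr//.
  apply: lt_le_trans (archi_boundP (ltW (divr_gt0 L0 k0))) _.
  by rewrite -natrX ler_nat ltnW// ltn_expl.
have hkL : hh n + kk n = L / 2 ^+ n by rewrite /hh /kk -mulrDl.
have [] := cornerP n; have := Hs n; have := Ht n.
case: (corner n) => x y /= /andP[yt ty] /andP[xs sx] ax xb cy yd Jn.
have h0 := hh_gt0 n; have k0' := kk_gt0 n.
set h := hh n in Jn h0 sx xb hkL *; set g := kk n in Jn k0' ty yd hkL *.
have est s' t' : x <= s' <= x + h -> y <= t' <= y + g ->
    `|P s' t' - P s t - ps * (s' - s) - m * (t' - t)| <= e * (h + g) /\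
    `|Q s' t' - Q s t - m * (s' - s) - qt * (t' - t)| <= e * (h + g).
  move=> /andP[xs' s'x] /andP[yt' t'y].
  have d1 : `|s' - s| <= h by apply: (@ler_dist_itv _ x); rewrite ?xs ?xs'.
  have d2 : `|t' - t| <= g by apply: (@ler_dist_itv _ y); rewrite ?yt ?yt'.
  have s'ab : a <= s' <= b by rewrite (le_trans ax xs') (le_trans s'x xb).
  have t'cd : c <= t' <= d by rewrite (le_trans cy yt') (le_trans t'y yd).
  have hgk : h + g < k by rewrite hkL.
  have d1k : `|s' - s| < k by apply: le_lt_trans d1 (le_lt_trans _ hgk); rewrite lerDl ltW.
  have d2k : `|t' - t| < k by apply: le_lt_trans d2 (le_lt_trans _ hgk); rewrite lerDr ltW.
  have [E1 E2] := Hk s' t' s'ab t'cd d1k d2k.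
  by split; [apply: le_trans E1 _|apply: le_trans E2 _]; rewrite ler_pM2l// lerD.
have x1 : x <= x + h by rewrite lerDl ltW.
have y1 : y <= y + g by rewrite lerDl ltW.
have twice E : 2 * e * E = e * E + e * E by ring.
have Py : seg_cont a b (P^~ y) by apply: Pcont; rewrite cy (le_trans y1 yd).
have Pyg : seg_cont a b (P^~ (y + g)) by apply: Pcont; rewrite (le_trans cy y1).
have Qx : seg_cont c d (Q x) by apply: Qcont; rewrite ax (le_trans x1 xb).
have Qxh : seg_cont c d (Q (x + h)) by apply: Qcont; rewrite (le_trans ax x1).
have dP : `|Rint x (x + h) (fun s' => P s' y - P s' (y + g)) - (- m * g) * (x + h - x)|
    <= (2 * e * (h + g)) * (x + h - x).
  apply: Rint_approx => //; first by apply: (@seg_contS _ a b) => //; exact: seg_contB.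
  move=> s' s'x.
  have [|E1 _] := est s' y s'x; first by rewrite lexx.
  have [|E2 _] := est s' (y + g) s'x; first by rewrite lexx y1.
  rewrite twice; apply: le_trans (lerD E1 E2); apply: le_trans (ler_normB _ _).
  by rewrite le_eqVlt; apply/predU1P; left; congr (`|_|); ring.
have dQ : `|Rint y (y + g) (fun t' => Q (x + h) t' - Q x t') - (m * h) * (y + g - y)|
    <= (2 * e * (h + g)) * (y + g - y).
  apply: Rint_approx => //; first by apply: (@seg_contS _ c d) => //; exact: seg_contB.
  move=> t' t'x.
  have [|_ E1] := est (x + h) t' _ t'x; first by rewrite lexx x1.
  have [|_ E2] := est x t' _ t'x; first by rewrite lexx.
  rewrite twice; apply: le_trans (lerD E1 E2); apply: le_trans (ler_normB _ _).
  by rewrite le_eqVlt; apply/predU1P; left; congr (`|_|); ring.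
rewrite (RintB (seg_contS ax xb Py) (seg_contS ax xb Pyg)) in dP.
rewrite (RintB (seg_contS cy yd Qxh) (seg_contS cy yd Qx)) in dQ.
(* The main terms [- m * g * h] and [m * h * g] cancel: here the coefficient [m] common to [P] and
   [Q] is used. *)
have Jle : `|J x (x + h) y (y + g)| <= 2 * e * (h + g) ^+ 2.
  apply: (@le_trans _ _ (2 * e * (h + g) * (x + h - x) + 2 * e * (h + g) * (y + g - y))).
    apply: le_trans (lerD dP dQ); apply: le_trans (ler_normD _ _).
    by rewrite /J le_eqVlt; apply/predU1P; left; congr (`|_|); ring.
  by rewrite le_eqVlt; apply/predU1P; left; ring.
have : `|J a b c d| / 4 ^+ n < `|J a b c d| / 4 ^+ n.
  apply: le_lt_trans Jn _; apply: le_lt_trans Jle _.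
  rewrite hkL /e expr_div_n -exprM mulnC exprM (_ : 2 ^+ 2 = 4 :> R); last by rewrite expr2 -natrM.
  have J1 : 0 < `|J a b c d| / 4 ^+ n by rewrite divr_gt0 ?normr_gt0 ?exprn_gt0.
  rewrite [ltLHS](_ : _ = `|J a b c d| / 4 ^+ n / 2); first by rewrite ltr_pdivrMr// ltr_pMr// ltr1n.
  by field; rewrite expf_neq0 ?gt_eqF.
by rewrite ltxx.
Qed.

End Goursat.

(** * Complex differentiability and Cauchy's formula *)

Section Modulus.
Variable R : realType.
Implicit Types (z u : R[i]) (r : R).

Lemma modE z : `|z| = (modulus z)%:C.
Proof. by case: z => a b; rewrite normc_def. Qed.

Lemma modM z u : modulus (z * u) = modulus z * modulus u.
Proof. exact: Normc.normcM. Qed.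

Lemma modV z : modulus z^-1 = (modulus z)^-1.
Proof. exact: Normc.normcV. Qed.

Lemma modN z : modulus (- z) = modulus z.
Proof. exact: normcN. Qed.

Lemma modD z u : modulus (z + u) <= modulus z + modulus u.
Proof. exact: le_normcD. Qed.

Lemma mod0 : modulus (0 : R[i]) = 0.
Proof. exact: Normc.normc0. Qed.

Lemma mod1 : modulus (1 : R[i]) = 1.
Proof. exact: Normc.normc1. Qed.

Lemma mod_ge0 z : 0 <= modulus z.
Proof. by case: z => a b /=; exact: sqrtr_ge0. Qed.

Lemma mod_eq0 z : (modulus z == 0) = (z == 0).
Proof.
by apply/eqP/eqP => [/Normc.eq0_normc//|->]; exact: mod0.
Qed.

Lemma mod_gt0 z : (0 < modulus z) = (z != 0).
Proof. by rewrite lt_def mod_ge0 andbT mod_eq0. Qed.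

Lemma modB z u : modulus (z - u) = modulus (u - z).
Proof. by rewrite -modN opprB. Qed.

Lemma modX z n : modulus (z ^+ n) = modulus z ^+ n.
Proof.
by elim: n => [|n IH]; rewrite ?expr0 ?mod1// !exprS modM IH.
Qed.

Lemma mod_real r : modulus r%:C = `|r|.
Proof. by rewrite /= expr0n /= addr0 sqrtr_sqr. Qed.

Lemma Re_le z : `|complex.Re z| <= modulus z.
Proof.
case: z => a b /=; rewrite -sqrtr_sqr ler_wsqrtr// lerDl sqr_ge0//.
Qed.

Lemma Im_le z : `|complex.Im z| <= modulus z.
Proof.
case: z => a b /=; rewrite -sqrtr_sqr ler_wsqrtr// lerDr sqr_ge0//.
Qed.

Lemma mod_le z : modulus z <= `|complex.Re z| + `|complex.Im z|.
Proof.
case: z => a b /=; rewrite -[leRHS]ger0_norm ?addr_ge0// -sqrtr_sqr.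
rewrite ler_wsqrtr// sqrrD !real_normK ?num_real//.
have : 0 <= `|a| * `|b| by rewrite mulr_ge0.
lra.
Qed.

Lemma modDB z u : modulus z - modulus u <= modulus (z + u).
Proof. have := modD (z + u) (- u); rewrite addrK modN; lra. Qed.

Lemma modB_ge z u : modulus z - modulus u <= modulus (z - u).
Proof. by have := modDB z (- u); rewrite modN. Qed.

Lemma gt0_real (e : R[i]) : 0 < e -> 0 < complex.Re e /\ e = (complex.Re e)%:C.
Proof. by case: e => a b; rewrite ltcE /= => /andP[/eqP -> ?]. Qed.

Lemma mod_ltE z (e : R) : (`|z| < e%:C) = (modulus z < e).
Proof. by rewrite modE ltcR. Qed.

Lemma cvg_modP (u : nat -> R[i]) (l : R[i]) :
  ((u : (R[i]^o)^nat) @ \oo --> (l : R[i]^o)) <->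
  (forall e : R, 0 < e -> exists N, forall n, (N <= n)%N -> modulus (u n - l) < e).
Proof.
split=> [/cvgrPdist_lt ul e e0|H].
  have /ul [N _ HN] : 0 < e%:C by rewrite ltcR.
  exists N => n /HN /=; rewrite distrC; by rewrite mod_ltE.
apply/cvgrPdist_lt => e /gt0_real[e0 ->].
have [N HN] := H _ e0; exists N => // n /= /HN; by rewrite distrC mod_ltE.
Qed.

(** The complex derivative without division: the case [h = 0] is included, and all bounds are
    between real moduli. *)
Definition cdiff (f : R[i] -> R[i]) z l := forall e : R, 0 < e ->
  exists2 d : R, 0 < d & forall h, modulus h < d ->
    modulus (f (z + h) - f z - l * h) <= e * modulus h.

Lemma derivable_cdiff (f : R[i] -> R[i]) z :
  derivable (f : R[i]^o -> R[i]^o) z 1 <-> exists l, cdiff f z l.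
Proof.
split.
  move=> /cvg_ex[l /= /cvgrPdist_lt fl]; exists l => e e0.
  have /fl : 0 < e%:C by rewrite ltcR.
  move=> [d /= /gt0_real[d0 dE] H]; exists (complex.Re d) => // h hd.
  have [->|h0] := eqVneq h 0.
    by rewrite addr0 subrr mulr0 subrr mod0 mulr0.
  have := H h; rewrite /= sub0r normrN {1}dE mod_ltE => /(_ hd h0).
  rewrite /= distrC mod_ltE /GRing.scale /= mulr1 [h + z]addrC.
  move=> /ltW H'.
  have -> : f (z + h) - f z - l * h = h * (h^-1 * (f (z + h) - f z) - l).
    by field.
  by rewrite modM mulrC ler_wpM2r// mod_ge0.
move=> [l H]; apply/cvg_ex; exists l; apply/cvgrPdist_lt => e /gt0_real[e0 ->].
have [d d0 Hd] := H (complex.Re e / 2) (divr_gt0 e0 (ltr0n _ 2)).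
exists d%:C; first by rewrite /= ltcR.
move=> h /=; rewrite sub0r normrN mod_ltE => /Hd H' h0.
rewrite distrC mod_ltE /GRing.scale /= mulr1 [h + z]addrC.
have E : f (z + h) - f z - l * h = h * (h^-1 * (f (z + h) - f z) - l).
  by field.
move: H'; rewrite E modM mulrC ler_pM2r ?mod_gt0// => H'.
apply: le_lt_trans H' _; lra.
Qed.

Lemma cdiff_cont f z l : cdiff f z l -> forall e : R, 0 < e ->
  exists2 d : R, 0 < d & forall h, modulus h < d -> modulus (f (z + h) - f z) < e.
Proof.
move=> fd e e0; have [d d0 Hd] := fd 1 ltr01.
pose L := modulus l + 1; have L0 : 0 < L by rewrite /L ltr_wpDl ?mod_ge0.
exists (Num.min d (e / L)); first by rewrite lt_min d0 divr_gt0.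
move=> h; rewrite lt_min => /andP[/Hd hd he].
rewrite -(subrK (l * h) (_ - _)); apply: le_lt_trans (modD _ _) _.
rewrite modM; apply: (@le_lt_trans _ _ (L * modulus h)).
  by rewrite /L mulrDl addrC lerD2l.
by rewrite mulrC -ltr_pdivlMr.
Qed.

Definition analytic := @analytic_on_disc R.

Lemma cdiff_cst c z : cdiff (fun=> c) z 0.
Proof.
move=> e e0; exists 1 => // h _.
by rewrite subrr mul0r subrr mod0 mulr_ge0 ?mod_ge0// ltW.
Qed.

Lemma cdiff_id z : cdiff id z 1.
Proof.
move=> e e0; exists 1 => // h _.
by rewrite [X in modulus X](_ : _ = 0) ?mod0 ?mulr_ge0 ?mod_ge0 ?(ltW e0)// /=; ring.
Qed.

Lemma cdiffD f g z l m : cdiff f z l -> cdiff g z m ->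
  cdiff (fun x => f x + g x) z (l + m).
Proof.
move=> fd gd e e0; have e20 : 0 < e / 2 by rewrite divr_gt0.
have [d d0 Hd] := fd _ e20; have [k k0 Hk] := gd _ e20.
exists (Num.min d k); first by rewrite lt_min d0.
move=> h; rewrite lt_min => /andP[/Hd hd /Hk hk].
rewrite (_ : _ - _ - _ = (f (z + h) - f z - l * h) + (g (z + h) - g z - m * h));
  last by ring.
by apply: le_trans (modD _ _) _; rewrite [e in leRHS]splitr mulrDl lerD.
Qed.

Lemma cdiff_comp f g z l m : cdiff g z m -> cdiff f (g z) l ->
  cdiff (fun x => f (g x)) z (l * m).
Proof.
move=> gd fd e e0.
(* [A] is a local Lipschitz constant of [g] and [B] dominates the modulus of [l]; each of the two
   error terms then receives [e / 2]. The bound [1] in the next minimum is what makes [A] a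
   Lipschitz constant. *)
pose A := modulus m + 1; have A0 : 0 < A by rewrite ltr_wpDl ?mod_ge0.
pose B := modulus l + 1; have B0 : 0 < B by rewrite ltr_wpDl ?mod_ge0.
have b0 : 0 < e / (2 * A) by rewrite divr_gt0// mulr_gt0.
have c0 : 0 < Num.min 1 (e / (2 * B)) by rewrite lt_min ltr01 divr_gt0// mulr_gt0.
have [d d0 Hd] := fd _ b0.
have [k k0 Hk] := gd _ c0.
have [k' k'0 Hk'] := cdiff_cont gd d0.
exists (Num.min k k'); first by rewrite lt_min k0.
move=> h; rewrite !lt_min => /andP[/Hk hk /Hk' hk'].
have := Hd _ hk'; rewrite subrKC => hd.
rewrite (_ : _ - _ - _ = (f (g (z + h)) - f (g z) - l * (g (z + h) - g z))
   + l * (g (z + h) - g z - m * h)); last by ring.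
apply: le_trans (modD _ _) _; rewrite !modM.
have h0 := mod_ge0 h; have L0 := mod_ge0 l.
have s1 : modulus (g (z + h) - g z - m * h) <= modulus h.
  by apply: le_trans hk _; rewrite ler_piMl// ge_min lexx.
have s2 : modulus (g (z + h) - g z - m * h) <= e / (2 * B) * modulus h.
  by apply: le_trans hk _; rewrite ler_wpM2r// ge_min lexx orbT.
have s3 : modulus (g (z + h) - g z) <= A * modulus h.
  rewrite -(subrK (m * h) (_ - _)); apply: le_trans (modD _ _) _.
  by rewrite modM /A mulrDl mul1r addrC lerD2l.
have s4 : modulus (f (g (z + h)) - f (g z) - l * (g (z + h) - g z)) <= e / 2 * modulus h.
  apply: le_trans hd _.
  apply: le_trans (ler_wpM2l (ltW b0) s3) _.
  by rewrite mulrA le_eqVlt; apply/predU1P; left; congr (_ * _); field; rewrite gt_eqF.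
have s5 : modulus l * modulus (g (z + h) - g z - m * h) <= e / 2 * modulus h.
  apply: (@le_trans _ _ (B * (e / (2 * B) * modulus h))).
    by rewrite ler_pM ?mod_ge0// /B lerDl.
  by rewrite mulrA le_eqVlt; apply/predU1P; left; congr (_ * _); field; rewrite gt_eqF.
by rewrite [e in leRHS]splitr mulrDl lerD.
Qed.

Lemma cdiff_mull c z : cdiff (fun x => c * x) z c.
Proof.
move=> e e0; exists 1 => // h _; rewrite (_ : _ - _ - _ = 0); last by ring.
by rewrite mod0 mulr_ge0 ?mod_ge0// ltW.
Qed.

Lemma cdiff_sqr z : cdiff (fun x => x * x) z (z + z).
Proof.
move=> e e0; exists e => // h he; rewrite (_ : _ - _ - _ = h * h); last by ring.
by rewrite modM ler_wpM2r ?mod_ge0// ltW.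
Qed.

(* Polarization: [x * y = ((x + y)^2 - (x - y)^2) / 4]. *)
Lemma cdiffM f g z l m : cdiff f z l -> cdiff g z m ->
  cdiff (fun x => f x * g x) z (l * g z + f z * m).
Proof.
move=> fd gd; have md := cdiff_comp gd (cdiff_mull (-1) (g z)).
have h1 := cdiff_comp (cdiffD fd gd) (cdiff_sqr _).
have h2 := cdiff_comp (cdiffD fd md) (cdiff_sqr _).
have := cdiffD (cdiff_comp h1 (cdiff_mull 4^-1 _)) (cdiff_comp h2 (cdiff_mull (- 4^-1) _)).
rewrite (_ : (fun x => 4^-1 * _ + _) = fun x => f x * g x); last first.
  by apply/funext => x; field.
by congr cdiff; field.
Qed.

Lemma cdiffV z : z != 0 -> cdiff (fun x => x^-1) z (- z^-2).
Proof.
move=> z0 e e0; have m0 : 0 < modulus z by rewrite mod_gt0.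
set M := modulus z in m0.
(* The first radius keeps [z + h] at modulus at least [M / 2]; the remainder is exactly
   [h ^ 2 / (z ^ 2 (z + h))], at most [2 |h|^2 / M ^ 3], which explains the second. *)
exists (Num.min (M / 2) (e * M ^+ 3 / 2)).
  by rewrite lt_min !divr_gt0// mulr_gt0// exprn_gt0.
move=> h; rewrite lt_min => /andP[h1 h2].
have zh : M / 2 <= modulus (z + h).
  have := modDB z h; rewrite -/M; lra.
have zh0 : z + h != 0.
  by rewrite -mod_gt0; apply: lt_le_trans zh; rewrite divr_gt0.
rewrite (_ : _ - _ - _ = h * h / (z ^+ 2 * (z + h))); last first.
  by field; rewrite zh0 z0.
rewrite [modulus (h * h / _)]modM modM modV [modulus (_ * (z + h))]modM modX -/M.
have hp := mod_ge0 h.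
rewrite ler_pdivrMr; last by rewrite mulr_gt0 ?exprn_gt0// mod_gt0.
rewrite mulrAC ler_wpM2r//.
apply: le_trans (ltW h2) _.
rewrite -mulrA ler_wpM2l ?(ltW e0)//.
rewrite exprSr -mulrA ler_wpM2l ?exprn_ge0 ?(ltW m0)//.
Qed.

End Modulus.

(** * Functions of two real parameters and integrals of complex functions *)

Section Cauchy.
Variable R : realType.
Implicit Types (z u : R[i]) (r s t : R).

Definition cis t : R[i] := cos t +i* sin t.

Lemma polarE r t : polar r t = r%:C * cis t.
Proof. by rewrite /polar /cis; simpc. Qed.

Lemma mod_cis t : modulus (cis t) = 1.
Proof. by rewrite /= cos2Dsin2 sqrtr1. Qed.

Lemma mod_polar r t : 0 <= r -> modulus (polar r t) = r.
Proof. by move=> r0; rewrite polarE modM mod_cis mulr1 mod_real ger0_norm. Qed.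

Lemma cis_2pi : cis (2 * pi) = cis 0.
Proof. by rewrite /cis mulr_natl cos2pi sin2pi cos0 sin0. Qed.

Lemma is_derive_approx (f : R -> R) t df : is_derive t 1 f df ->
  forall e, 0 < e -> exists2 k, 0 < k & forall h, `|h| < k ->
    `|f (t + h) - f t - df * h| <= e * `|h|.
Proof.
move=> [fd <-] e e0; have /cvgrPdist_lt/(_ e e0)[k /= k0 H] := fd.
exists k => // h hk; have [->|h0] := eqVneq h 0.
  by rewrite addr0 subrr mulr0 subrr normr0 mulr0.
have := H h; rewrite /= sub0r normrN => /(_ hk h0).
rewrite /GRing.scale /= mulr1 [h + t]addrC distrC => /ltW H'.
rewrite [X in `|X|](_ : _ = h * (h^-1 * (f (t + h) - f t) - 'D_1 f t)).
  by rewrite normrM mulrC ler_wpM2r.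
by field.
Qed.

Lemma cis_approx t e : 0 < e -> exists2 k, 0 < k & forall h, `|h| < k ->
  modulus (cis (t + h) - cis t - 'i * cis t * h%:C) <= e * `|h|.
Proof.
move=> e0; have e20 : 0 < e / 2 by rewrite divr_gt0.
have [k k0 Hk] := is_derive_approx (is_derive_cos t) e20.
have [l l0 Hl] := is_derive_approx (is_derive_sin t) e20.
exists (Num.min k l) => [|h]; first by rewrite lt_min k0.
rewrite lt_min => /andP[/Hk hk /Hl hl].
apply: le_trans (mod_le _) _.
rewrite [e in leRHS]splitr mulrDl; apply: lerD.
  rewrite [X in `|X|](_ : _ = cos (t + h) - cos t - - sin t * h)//.
  by rewrite /=; ring.
rewrite [X in `|X|](_ : _ = sin (t + h) - sin t - cos t * h)//.
by rewrite /=; ring.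
Qed.

(** Real differentiability with complex partial derivatives [A] and [B]. Its calculus rules compute
    the partial derivatives of pulled-back forms, so that closedness reduces to an algebraic
    identity. *)
Definition diff2 (G : R -> R -> R[i]) s t (A B : R[i]) :=
  forall e, 0 < e -> exists2 k, 0 < k & forall s' t',
    `|s' - s| < k -> `|t' - t| < k ->
    modulus (G s' t' - G s t - A * (s' - s)%:C - B * (t' - t)%:C)
      <= e * (`|s' - s| + `|t' - t|).

Lemma diff2_eqd G s t A B A' B' :
  diff2 G s t A B -> A = A' -> B = B' -> diff2 G s t A' B'.
Proof. by move=> ? <- <-. Qed.

Lemma diff2_cst c s t : diff2 (fun _ _ => c) s t 0 0.
Proof.
move=> e e0; exists 1 => // s' t' _ _.
by rewrite !mul0r !subr0 subrr mod0 mulr_ge0 ?(ltW e0)// addr_ge0.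
Qed.

Lemma diff2_fst s t : diff2 (fun s _ => s%:C) s t 1 0.
Proof.
move=> e e0; exists 1 => // s' t' _ _.
rewrite [X in modulus X](_ : _ = 0); last by rewrite rmorphB/=; ring.
by rewrite mod0 mulr_ge0 ?(ltW e0)// addr_ge0.
Qed.

Lemma diff2_cis s t : diff2 (fun _ t => cis t) s t 0 ('i * cis t).
Proof.
move=> e e0; have [k k0 Hk] := cis_approx t e0.
exists k => // s' t' _ /Hk; rewrite subrKC mul0r subr0 => /le_trans; apply.
by rewrite ler_wpM2l ?(ltW e0)// lerDr.
Qed.

Lemma diff2D F G s t A B A' B' : diff2 F s t A B -> diff2 G s t A' B' ->
  diff2 (fun s t => F s t + G s t) s t (A + A') (B + B').
Proof.
move=> fd gd e e0; have e20 : 0 < e / 2 by rewrite divr_gt0.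
have [d d0 Hd] := fd _ e20; have [k k0 Hk] := gd _ e20.
exists (Num.min d k); first by rewrite lt_min d0.
move=> s' t'; rewrite !lt_min => /andP[sd sk] /andP[td tk].
have hd := Hd _ _ sd td; have hk := Hk _ _ sk tk.
rewrite [X in modulus X](_ : _ =
  (F s' t' - F s t - A * (s' - s)%:C - B * (t' - t)%:C) +
  (G s' t' - G s t - A' * (s' - s)%:C - B' * (t' - t)%:C)); last by ring.
by apply: le_trans (modD _ _) _; rewrite [e in leRHS]splitr mulrDl lerD.
Qed.

Lemma diff2_lip G s t A B : diff2 G s t A B ->
  exists2 L, 0 < L & exists2 k, 0 < k & forall s' t',
    `|s' - s| < k -> `|t' - t| < k ->
    modulus (G s' t' - G s t) <= L * (`|s' - s| + `|t' - t|).
Proof.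
move=> gd; have [k k0 Hk] := gd 1 ltr01.
have A0 := mod_ge0 A; have B0 := mod_ge0 B.
exists (modulus A + modulus B + 1); first lra.
exists k => // s' t' sk tk; have := Hk _ _ sk tk.
set X := _ - B * _ => hX.
rewrite [Y in modulus Y](_ : _ = X + A * (s' - s)%:C + B * (t' - t)%:C); last first.
  by rewrite /X; ring.
apply: le_trans (modD _ _) _; rewrite modM mod_real.
apply: le_trans (lerD (modD _ _) (lexx _)) _; rewrite modM mod_real.
have : 0 <= modulus A * `|t' - t| by rewrite mulr_ge0.
have : 0 <= modulus B * `|s' - s| by rewrite mulr_ge0.
lra.
Qed.

Lemma diff2_comp f l G s t A B : diff2 G s t A B -> cdiff f (G s t) l ->
  diff2 (fun s t => f (G s t)) s t (l * A) (l * B).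
Proof.
move=> gd fd e e0.
have [L L0 [k k0 HL]] := diff2_lip gd.
have b0 : 0 < e / (2 * L) by rewrite divr_gt0// mulr_gt0.
have [d d0 Hd] := fd _ b0.
have M0 : 0 < modulus l + 1 by rewrite ltr_wpDl ?mod_ge0.
have c0 : 0 < e / (2 * (modulus l + 1)) by rewrite divr_gt0// mulr_gt0.
have [k' k'0 Hk'] := gd _ c0.
exists (Num.min k (Num.min k' (d / (2 * L)))).
  by rewrite !lt_min k0 k'0 divr_gt0// mulr_gt0.
move=> s' t'; rewrite !lt_min => /and3P[sk sk' sd] /and3P[tk tk' td].
have h1 := HL _ _ sk tk; have h2 := Hk' _ _ sk' tk'.
have h3 : modulus (G s' t' - G s t) < d.
  apply: le_lt_trans h1 _; rewrite mulrC -ltr_pdivlMr//.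
  rewrite (_ : d / L = d / (2 * L) + d / (2 * L)); last by field; rewrite gt_eqF.
  exact: ltrD.
have := Hd _ h3; rewrite subrKC => h4.
rewrite [X in modulus X](_ : _ =
  (f (G s' t') - f (G s t) - l * (G s' t' - G s t)) +
  l * (G s' t' - G s t - A * (s' - s)%:C - B * (t' - t)%:C)); last by ring.
apply: le_trans (modD _ _) _; rewrite modM [e in leRHS]splitr mulrDl; apply: lerD.
  apply: le_trans h4 _; apply: le_trans (ler_wpM2l (ltW b0) h1) _.
  by rewrite mulrA le_eqVlt; apply/predU1P; left; congr (_ * _); field; rewrite gt_eqF.
apply: le_trans (ler_wpM2l (mod_ge0 _) h2) _.
rewrite mulrA ler_wpM2r ?addr_ge0//.
apply: (@le_trans _ _ ((modulus l + 1) * (e / (2 * (modulus l + 1))))).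
  by rewrite ler_wpM2r ?(ltW c0)// lerDl.
by rewrite le_eqVlt; apply/predU1P; left; field; rewrite gt_eqF.
Qed.

Lemma diff2Z c G s t A B : diff2 G s t A B ->
  diff2 (fun s t => c * G s t) s t (c * A) (c * B).
Proof. by move=> gd; exact: (diff2_comp gd (cdiff_mull c (G s t))). Qed.

Lemma diff2M F G s t A B A' B' : diff2 F s t A B -> diff2 G s t A' B' ->
  diff2 (fun s t => F s t * G s t) s t
    (A * G s t + F s t * A') (B * G s t + F s t * B').
Proof.
move=> fd gd; have h1 := diff2_comp (diff2D fd gd) (cdiff_sqr _).
have h2 := diff2_comp (diff2D fd (diff2Z (-1) gd)) (cdiff_sqr _).
have := diff2D (diff2Z 4^-1 h1) (diff2Z (- 4^-1) h2).
rewrite (_ : (fun s t => 4^-1 * _ + _) = (fun s t => F s t * G s t)); last first.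
  by apply/funext => x; apply/funext => y; field.
by move=> /diff2_eqd; apply; field.
Qed.

Definition ccont (a b : R) (F : R -> R[i]) := forall x, a <= x <= b ->
  forall e, 0 < e -> exists2 d, 0 < d &
    forall y, a <= y <= b -> `|y - x| < d -> modulus (F y - F x) < e.

Lemma ccont_Re a b F : ccont a b F -> seg_cont a b (fun t => complex.Re (F t)).
Proof.
move=> Fc x xab e e0; have [d d0 H] := Fc x xab e e0; exists d => // y yab yx.
have := H y yab yx; apply: le_lt_trans; apply: le_trans (Re_le _).
by rewrite raddfB.
Qed.

Lemma ccont_Im a b F : ccont a b F -> seg_cont a b (fun t => complex.Im (F t)).
Proof.
move=> Fc x xab e e0; have [d d0 H] := Fc x xab e e0; exists d => // y yab yx.
have := H y yab yx; apply: le_lt_trans; apply: le_trans (Im_le _).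
by rewrite raddfB.
Qed.

Lemma ccontD a b F G : ccont a b F -> ccont a b G ->
  ccont a b (fun t => F t + G t).
Proof.
move=> fc gc x xab e e0; have e20 : 0 < e / 2 by rewrite divr_gt0.
have [d d0 fd] := fc x xab _ e20; have [k k0 gk] := gc x xab _ e20.
exists (Num.min d k); first by rewrite lt_min d0.
move=> y yab; rewrite lt_min => /andP[/(fd _ yab) h1 /(gk _ yab) h2].
rewrite opprD addrACA; apply: le_lt_trans (modD _ _) _.
by rewrite [ltRHS](splitr e) ltrD.
Qed.

Lemma ccontZ a b c F : ccont a b F -> ccont a b (fun t => c * F t).
Proof.
move=> fc x xab e e0; have [|d d0 fd] := fc x xab (e / (modulus c + 1)).
  by rewrite divr_gt0// ltr_wpDl// mod_ge0.
exists d => // y yab /(fd _ yab) h; rewrite -mulrBr modM.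
apply: (@le_lt_trans _ _ ((modulus c + 1) * modulus (F y - F x))).
  by rewrite ler_wpM2r ?mod_ge0// lerDl.
by rewrite mulrC -ltr_pdivlMr// ltr_wpDl// mod_ge0.
Qed.

Lemma ccont_mod a b F : ccont a b F -> seg_cont a b (fun t => modulus (F t)).
Proof.
move=> Fc x xab e e0; have [d d0 H] := Fc x xab e e0; exists d => // y yab yx.
have := H y yab yx; apply: le_lt_trans; rewrite ler_norml modB_ge andbT lerNl opprB.
by rewrite [leRHS]modB modB_ge.
Qed.

Lemma ccont_bounded (a b : R) F : a <= b -> ccont a b F -> exists2 M, 0 < M &
  forall t, a <= t <= b -> modulus (F t) <= M.
Proof.
move=> ab Fc; have [c _ Hc] := EVT_max ab (seg_cont_within (ccont_mod Fc)).
exists (modulus (F c) + 1); first by rewrite ltr_wpDl ?mod_ge0.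
by move=> t tab; rewrite ler_wpDr// Hc// in_itv.
Qed.

Lemma diff2_ccont G s a b :
  (forall t, a <= t <= b -> exists A B, diff2 G s t A B) -> ccont a b (G s).
Proof.
move=> gd t tab e e0; have [A [B /diff2_lip[L L0 [k k0 H]]]] := gd t tab.
exists (Num.min k (e / L)); first by rewrite lt_min k0 divr_gt0.
move=> y _; rewrite lt_min => /andP[yk ye].
have := H s y; rewrite subrr normr0 => /(_ k0 yk) /le_lt_trans; apply.
by rewrite add0r mulrC -ltr_pdivlMr.
Qed.

Definition cint a b F : R[i] :=
  Rint a b (fun t => complex.Re (F t)) +i* Rint a b (fun t => complex.Im (F t)).

Lemma cintD a b F G : ccont a b F -> ccont a b G ->
  cint a b (fun t => F t + G t) = cint a b F + cint a b G.
Proof.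
move=> Fc Gc; rewrite /cint; simpc; congr (_ +i* _).
  rewrite -RintD; try exact: ccont_Re.
  by apply: eq_Rint => t _; rewrite raddfD.
rewrite -RintD; try exact: ccont_Im.
by apply: eq_Rint => t _; rewrite raddfD.
Qed.

Lemma cintZ a b c F : ccont a b F -> cint a b (fun t => c * F t) = c * cint a b F.
Proof.
move=> Fc; rewrite /cint; case: c => x y; simpc.
have FR := ccont_Re Fc; have FI := ccont_Im Fc.
congr (_ +i* _).
  rewrite -!RintZ// -RintB; try exact: seg_contZ.
  by apply: eq_Rint => t _; case: (F t).
rewrite -!RintZ// -RintD; try exact: seg_contZ.
by apply: eq_Rint => t _; case: (F t).
Qed.

Lemma cintB a b F G : ccont a b F -> ccont a b G ->
  cint a b (fun t => F t - G t) = cint a b F - cint a b G.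
Proof.
move=> Fc Gc; rewrite -[X in _ = _ + X]mulN1r -cintZ// -cintD//; last exact: ccontZ.
by congr cint; apply/funext => t; rewrite mulN1r.
Qed.

Lemma eq_cint a b F G : (forall t, a <= t <= b -> F t = G t) ->
  cint a b F = cint a b G.
Proof. by move=> FG; congr (_ +i* _); apply: eq_Rint => t /FG ->. Qed.

Lemma cint_cst a b c : a <= b -> cint a b (fun=> c) = c * (b - a)%:C.
Proof. by move=> ab; rewrite /cint !Rint_cst//; case: c => x y; simpc. Qed.

(** The factor 2 comes from estimating real and imaginary parts separately; it is harmless in the
    later estimates. *)
Lemma cint_norm_le a b F (e : R) : a <= b -> ccont a b F ->
  (forall t, a <= t <= b -> modulus (F t) <= e) ->
  modulus (cint a b F) <= 2 * e * (b - a).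
Proof.
move=> ab Fc Fe; apply: le_trans (mod_le _) _.
rewrite -mulrA mulr_natl mulr2n; apply: lerD; apply: Rint_norm_le => //.
- exact: ccont_Re.
- by move=> t /Fe; apply: le_trans; exact: Re_le.
- exact: ccont_Im.
- by move=> t /Fe; apply: le_trans; exact: Im_le.
Qed.

(** Goursat's theorem for the real and imaginary parts. The edges [t = c] and [t = d] cancel; in the
    applications [t] is an angle and the equality of [P] on them is periodicity. *)
Lemma goursatC (P Q : R -> R -> R[i]) a b c d : a < b -> c < d ->
  (forall s t, a <= s <= b -> c <= t <= d ->
    exists ps m qt, diff2 P s t ps m /\ diff2 Q s t m qt) ->
  (forall s, P s c = P s d) ->
  cint c d (Q b) = cint c d (Q a).
Proof.
move=> ab cd PQ Pcd.
have part (u : {additive R[i] -> R}) : (forall z (x : R), u (z * x%:C) = u z * x) ->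
    (forall z, `|u z| <= modulus z) ->
    Rint c d (fun t => u (Q b t)) = Rint c d (fun t => u (Q a t)).
  move=> uZ ule.
  have cf : closed_form (fun s t => u (P s t)) (fun s t => u (Q s t)) a b c d.
    move=> s t sab tcd; have [ps [m [qt [Pd Qd]]]] := PQ s t sab tcd.
    exists (u ps), (u m), (u qt) => e e0.
    have [k k0 Hk] := Pd e e0; have [l l0 Hl] := Qd e e0.
    exists (Num.min k l) => [|s' t' _ _]; first by rewrite lt_min k0.
    rewrite !lt_min => /andP[sk sl] /andP[tk tl]; rewrite -!uZ -!raddfB.
    by split; apply: le_trans (ule _) _; [exact: Hk|exact: Hl].
  have := goursat ab cd cf.
  have -> : (fun s => u (P s c)) = (fun s => u (P s d)).
    by apply/funext => s; rewrite Pcd.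
  by rewrite subrr add0r => /eqP; rewrite subr_eq0 => /eqP.
rewrite /cint (part (@complex.Re R)) ?(part (@complex.Im R))//.
- by case=> u v x /=; rewrite mulr0 add0r.
- exact: Im_le.
- by case=> u v x /=; rewrite mulr0 subr0.
- exact: Re_le.
Qed.

End Cauchy.

(** * Cauchy's formula on circles and polynomial approximation *)

Section CauchyFormula.
Variable R : realType.
Implicit Types (z u : R[i]) (r s t : R) (f : R[i] -> R[i]).

Let pi2 : 0 < 2 * pi :> R. Proof. by rewrite mulr_gt0// pi_gt0. Qed.

(** On the circle [u = polar r t] one has [du / (u - z) = 'i * kernel r z t dt]: this is the Cauchy
    kernel with the factor ['i] removed. *)
Definition kernel r z t : R[i] := polar r t / (polar r t - z).

Lemma polar_sub_neq0 r z t : 0 <= r -> modulus z < r -> polar r t - z != 0.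
Proof.
move=> r0 zr; rewrite -mod_gt0; apply: lt_le_trans (modB_ge _ _).
by rewrite mod_polar// subr_gt0.
Qed.

Lemma mod_kernel r z t : modulus z < r -> modulus (kernel r z t) <= r / (r - modulus z).
Proof.
move=> zr; have r0 : 0 <= r by apply: le_trans (ltW zr); exact: mod_ge0.
rewrite /kernel modM modV mod_polar// ler_wpM2l// lef_pV2 ?posrE ?subr_gt0//.
  by apply: le_trans (modB_ge _ _); rewrite mod_polar.
by rewrite mod_gt0 polar_sub_neq0.
Qed.

Lemma diff2_polar r s t :
  diff2 (fun _ t => polar r t) s t 0 ('i * polar r t).
Proof.
rewrite (_ : (fun _ t => polar r t) = (fun _ t => r%:C * cis t)); last first.
  by apply/funext => x; apply/funext => y; rewrite polarE.
by apply: diff2_eqd (diff2Z r%:C (diff2_cis s t)) _ _; rewrite ?mulr0// polarE; ring.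
Qed.

Lemma diff2_kernel r z s t : modulus z < r -> exists B,
  diff2 (fun _ t => kernel r z t) s t 0 B.
Proof.
move=> zr; have r0 : 0 <= r by apply: le_trans (ltW zr); exact: mod_ge0.
have d1 := diff2D (diff2_polar r s t) (diff2_cst (- z) s t).
have d2 := diff2_comp d1 (cdiffV (polar_sub_neq0 t r0 zr)).
have d3 := diff2M (diff2_polar r s t) d2.
eexists; apply: diff2_eqd d3 _ erefl; ring.
Qed.

Lemma kernel_ccont r z a b : modulus z < r -> ccont a b (kernel r z).
Proof.
move=> zr; apply: (diff2_ccont (s := 0) (G := fun _ t => kernel r z t)) => t _.
by have [B HB] := diff2_kernel 0 t zr; exists 0, B.
Qed.

Lemma analytic_cdiff f z : analytic f -> modulus z < 1 -> exists l, cdiff f z l.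
Proof. by move=> fa z1; apply/derivable_cdiff; exact: fa. Qed.

Lemma analyticP f : (forall z, modulus z < 1 -> exists l, cdiff f z l) -> analytic f.
Proof. by move=> H z z1; apply/derivable_cdiff; exact: H. Qed.

(* The homotopy [s |-> z + s (r e^{it} - z)] contracts the circle to [z]; the
   pullback of [f(u) du / (u - z)] is the closed form [P ds + Q dt] below. *)
Lemma cauchy_formula f z r : analytic f -> modulus z < r -> r < 1 ->
  cint 0 (2 * pi) (fun t => f (polar r t) * kernel r z t) =
  f z * cint 0 (2 * pi) (kernel r z).
Proof.
move=> fa zr r1; have r0 : 0 <= r by apply: le_trans (ltW zr); exact: mod_ge0.
pose u s t := z + s%:C * (polar r t - z).
(* Since [du = (polar r t - z) ds + s 'i polar r t dt], these are the coefficients of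
   [- 'i f(u) du / (u - z)]. *)
pose P s t := - 'i * (f (u s t) / s%:C).
pose Q s t := f (u s t) * kernel r z t.
have u1 s t : 0 <= s <= 1 -> modulus (u s t) <= r.
  move=> /andP[s0 s1]; rewrite (_ : u s t = (1 - s)%:C * z + s%:C * polar r t); last first.
    by rewrite /u rmorphB/=; ring.
  apply: le_trans (modD _ _) _; rewrite !modM !mod_real mod_polar// !ger0_norm ?subr_ge0//.
  have : 0 <= (1 - s) * (r - modulus z) by rewrite mulr_ge0 ?subr_ge0// ltW.
  lra.
have du s t : diff2 u s t (polar r t - z) (s%:C * ('i * polar r t)).
  have d1 := diff2D (diff2_polar r s t) (diff2_cst (- z) s t).
  have d2 := diff2D (diff2_cst z s t) (diff2M (diff2_fst s t) d1).
  by apply: diff2_eqd d2 _ _; ring.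
have dfu s t : 0 <= s <= 1 -> exists l, diff2 (fun s t => f (u s t)) s t
    (l * (polar r t - z)) (l * (s%:C * ('i * polar r t))).
  move=> s01; have [l Hl] := analytic_cdiff fa (le_lt_trans (u1 s t s01) r1).
  by exists l; exact: diff2_comp (du s t) Hl.
have Qc s : 0 <= s <= 1 -> ccont 0 (2 * pi) (Q s).
  move=> s01; apply: diff2_ccont => t _; have [l /diff2M Hl] := dfu s t s01.
  have [B /Hl HB] := diff2_kernel s t zr.
  by eexists; eexists; exact: HB.
(* [P] is singular at [s = 0], so the homotopy stops at a small positive [s]; continuity of [f] at
   [z] covers the remaining gap. *)
have Qconst s : 0 < s -> s < 1 -> cint 0 (2 * pi) (Q 1) = cint 0 (2 * pi) (Q s).
  move=> s0 s1; apply: (goursatC (P := P)) => //.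
    move=> x t /andP[sx x1] _.
    have x0 : 0 < x by exact: lt_le_trans sx.
    have x01 : 0 <= x <= 1 by rewrite ltW.
    have [l dl] := dfu x t x01.
    have [B dB] := diff2_kernel x t zr.
    have xC0 : (x%:C : R[i]) != 0 by rewrite -mod_gt0 mod_real normr_gt0 gt_eqF.
    have dP := diff2Z (- 'i) (diff2M dl (diff2_comp (diff2_fst x t) (cdiffV xC0))).
    have dQ := diff2M dl dB.
    eexists; exists (l * polar r t); eexists; split.
      apply: diff2_eqd dP erefl _.
      have ii : - 'i * 'i = 1 :> R[i] by rewrite mulNr -expr2 sqr_i opprK.
      rewrite !mulr0 addr0 -[RHS]mul1r -ii; field; exact: xC0.
    apply: diff2_eqd dQ _ erefl.
    rewrite mulr0 addr0 /kernel -mulrA; congr (l * _); field.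
    exact: polar_sub_neq0.
  move=> x; rewrite /P /u; congr (- 'i * (f (z + _ * (_ - z)) / _)).
  by rewrite !polarE cis_2pi.
have KC := kernel_ccont (a := 0) (b := 2 * pi) zr.
pose K := r / (r - modulus z).
have K0 : 0 <= K by rewrite divr_ge0// subr_ge0 ltW.
have [l /cdiff_cont fc] := analytic_cdiff fa (lt_trans zr r1).
have Q1 : Q 1 = fun t => f (polar r t) * kernel r z t.
  by apply/funext => t; rewrite /Q /u mul1r subrKC.
rewrite -Q1; apply/eqP; rewrite -subr_eq0 -mod_eq0; apply/negPn/negP => D0.
set D := modulus _ in D0.
have Dp : 0 < D by rewrite lt_def D0 mod_ge0.
(* Chosen so that the final estimate reads [D <= D / 2]; [K] bounds the kernel. *)
pose e := D / (2 * (2 * (K + 1) * (2 * pi))).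
have B0 : 0 < 2 * (K + 1) * (2 * pi).
  by rewrite mulr_gt0// mulr_gt0// ltr_wpDl.
have e0 : 0 < e by rewrite divr_gt0// mulr_gt0.
have [d d0 Hd] := fc e e0.
(* The points [polar r t - z] have modulus less than 2, so the contracted circle lies within [d] of
   [z]. *)
pose s := Num.min 2^-1 (d / (2 * 2)).
have s0 : 0 < s by rewrite lt_min invr_gt0 ltr0n divr_gt0.
have s1 : s < 1 by rewrite gt_min invf_lt1// ltr1n.
have s01 : 0 <= s <= 1 by rewrite !ltW.
have : D <= 2 * (e * (K + 1)) * (2 * pi - 0).
  rewrite /D (Qconst s)// -cintZ//.
  have fKC := ccontZ (f z) KC.
  rewrite -cintB//; last exact: Qc.
  apply: cint_norm_le; [exact: ltW| |].
    have := ccontD (Qc s s01) (ccontZ (-1) fKC).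
    by congr ccont; apply/funext => t; rewrite mulN1r.
  move=> t _; rewrite /Q -mulrBl modM; apply: ler_pM; rewrite ?mod_ge0//; last first.
    by apply: le_trans (mod_kernel _ zr) _; rewrite lerDl.
  apply/ltW/Hd; rewrite modM mod_real ger0_norm ?(ltW s0)//.
  have pz : modulus (polar r t - z) < 2.
    by apply: le_lt_trans (modD _ _) _; rewrite modN mod_polar//; lra.
  apply: (@le_lt_trans _ _ (d / (2 * 2) * modulus (polar r t - z))).
    by rewrite ler_wpM2r ?mod_ge0// ge_min lexx orbT.
  apply: (@le_lt_trans _ _ (d / (2 * 2) * 2)).
    by rewrite ler_wpM2l ?ltW// divr_gt0.
  lra.
rewrite subr0.
have -> : 2 * (e * (K + 1)) * (2 * pi) = D / 2.
  have T0 : 2 * pi != 0 :> R by rewrite gt_eqF.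
  rewrite /e; set T := 2 * pi in T0 *; field.
  by rewrite T0 gt_eqF// ltr_wpDl.
lra.
Qed.

Lemma mean_value f r : analytic f -> 0 < r -> r < 1 ->
  cint 0 (2 * pi) (fun t => f (polar r t)) = f 0 * (2 * pi)%:C.
Proof.
move=> fa r0 r1.
have z0 : modulus (0 : R[i]) < r by rewrite mod0.
have k1 : kernel r 0 = fun=> 1.
  apply/funext => t; rewrite /kernel subr0 divff//.
  by have := polar_sub_neq0 t (ltW r0) z0; rewrite subr0.
have := cauchy_formula fa z0 r1.
rewrite k1 cint_cst ?(ltW pi2)// subr0 mul1r => <-.
by apply: eq_cint => t _; rewrite mulr1.
Qed.

Lemma analytic_circle_ccont f r a b : analytic f -> 0 < r -> r < 1 ->
  ccont a b (fun t => f (polar r t)).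
Proof.
move=> fa r0 r1; apply: (diff2_ccont (s := 0) (G := fun _ t => f (polar r t))) => t _.
have [|l Hl] := @analytic_cdiff f (polar r t) fa.
  by rewrite mod_polar// ltW.
have := diff2_comp (diff2_polar r 0 t) Hl.
by move=> H; eexists; eexists; exact: H.
Qed.

(** The mean value property; half of the constant [2 * pi] is lost by bounding the real and
    imaginary parts of the mean separately. *)
Lemma mod_center_le f r : analytic f -> 0 < r -> r < 1 ->
  modulus (f 0) * pi <= Rint 0 (2 * pi) (fun t => modulus (f (polar r t))).
Proof.
move=> fa r0 r1; have fc := analytic_circle_ccont (a := 0) (b := 2 * pi) fa r0 r1.
have := congr1 (@Normc.normc R) (mean_value fa r0 r1).
rewrite modM mod_real ger0_norm ?(ltW pi2)//.
have := mod_le (cint 0 (2 * pi) (fun t => f (polar r t))).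
set I := Rint _ _ _.
have h (u : R[i] -> R) : (forall z, `|u z| <= modulus z) ->
    seg_cont 0 (2 * pi) (fun t => u (f (polar r t))) ->
    `|Rint 0 (2 * pi) (fun t => u (f (polar r t)))| <= I.
  move=> ul uc; rewrite /Rint.
  apply: le_trans (le_normr_Rintegral _ _) _ => //; first exact: seg_cont_integrable.
  apply: le_Rint => //.
    move=> x xab e e0; have [d d0 H] := uc x xab e e0; exists d => // y yab yx.
    by apply: le_lt_trans (H y yab yx); exact: ler_dist_dist.
  exact: ccont_mod.
have := h _ (@Re_le R) (ccont_Re fc); have := h _ (@Im_le R) (ccont_Im fc).
rewrite /cint /=; lra.
Qed.

Lemma diff2_polarVn r s t n : 0 < r ->
  diff2 (fun _ t => (polar r t)^-1 ^+ n) s t 0 (- n%:R * 'i * (polar r t)^-1 ^+ n).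
Proof.
move=> r0.
have p0 : polar r t != 0 by rewrite -mod_gt0 mod_polar// ltW.
elim: n => [|n IH].
  by apply: diff2_eqd (diff2_cst 1 s t) _ _ => //; rewrite oppr0 !mul0r.
have d1 := diff2_comp (diff2_polar r s t) (cdiffV p0).
have := diff2M d1 IH.
rewrite (_ : (fun s t => (polar r t)^-1 * (polar r t)^-1 ^+ n) =
  (fun=> fun t => (polar r t)^-1 ^+ n.+1)); last first.
  by apply/funext => x; apply/funext => y; rewrite exprS.
move=> /diff2_eqd; apply; first by ring.
rewrite [in RHS]exprS -natr1; set X := _ ^+ n; set p := polar r t in p0 *; field; exact: p0.
Qed.

Lemma kernel_geometric r z t n : 0 <= r -> modulus z < r -> kernel r z t =
  \sum_(k < n) z ^+ k * (polar r t)^-1 ^+ k + z ^+ n * (polar r t)^-1 ^+ n * kernel r z t.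
Proof.
move=> r0 zr; have pz := polar_sub_neq0 t r0 zr.
have p0 : polar r t != 0.
  by rewrite -mod_gt0 mod_polar//; apply: le_lt_trans zr; exact: mod_ge0.
elim: n => [|n IH]; first by rewrite big_ord0 !expr0 !mul1r add0r.
rewrite {1}IH big_ord_recr -addrA; congr (_ + _).
rewrite /kernel !exprS; field; by rewrite p0 pz.
Qed.

Lemma cint_sum a b n (c : nat -> R[i]) (F : nat -> R -> R[i]) : a <= b ->
  (forall k, ccont a b (F k)) ->
  ccont a b (fun t => \sum_(k < n) c k * F k t) /\
  cint a b (fun t => \sum_(k < n) c k * F k t) = \sum_(k < n) c k * cint a b (F k).
Proof.
move=> ab Fc; elim: n => [|n [IH1 IH2]].
  have E : (fun t => \sum_(k < 0) c k * F k t) = fun=> 0.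
    by apply/funext => t; rewrite big_ord0.
  rewrite E big_ord0 cint_cst// mul0r; split=> // x _ e e0.
  by exists 1 => // y _ _; rewrite subrr mod0.
have E : (fun t => \sum_(k < n.+1) c k * F k t) =
    fun t => \sum_(k < n) c k * F k t + c n * F n t.
  by apply/funext => t; rewrite big_ord_recr.
rewrite E big_ord_recr/= -IH2; split; first by apply: ccontD => //; exact: ccontZ.
by rewrite cintD//; [rewrite cintZ|exact: ccontZ].
Qed.

Lemma pow_small (q e : R) : 0 <= q -> q < 1 -> 0 < e -> exists n, q ^+ n < e.
Proof.
move=> q0 q1 e0; have /cvgrPdist_lt/(_ e e0) : @GRing.exp R q @ \oo --> 0.
  by apply: cvg_expr; rewrite ger0_norm.
move=> [n _ /(_ n (leqnn n))] /=; rewrite sub0r normrN ger0_norm ?exprn_ge0//.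
by exists n.
Qed.

(** The finite geometric sum with its exact remainder is integrated, so no limit is exchanged with
    the integral; the right side bounds the remainder. *)
Lemma circle_expansion f r z n (M : R) : analytic f -> 0 < r -> r < 1 ->
  modulus z < r -> (forall t, 0 <= t <= 2 * pi -> modulus (f (polar r t)) <= M) ->
  modulus (cint 0 (2 * pi) (fun t => f (polar r t) * kernel r z t) -
    \sum_(k < n) z ^+ k * cint 0 (2 * pi) (fun t => f (polar r t) * (polar r t)^-1 ^+ k))
  <= 2 * (M * ((modulus z / r) ^+ n * (r / (r - modulus z)))) * (2 * pi).
Proof.
move=> fa r0 r1 zr fM.
have Vd t k : exists B, diff2 (fun _ t => (polar r t)^-1 ^+ k) 0 t 0 B.
  by eexists; exact: diff2_polarVn.
have fd t : exists A B, diff2 (fun _ t => f (polar r t)) 0 t A B.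
  have [|l Hl] := @analytic_cdiff f (polar r t) fa; first by rewrite mod_polar// ltW.
  by eexists; eexists; exact: (diff2_comp (diff2_polar r 0 t) Hl).
have fVc k : ccont 0 (2 * pi) (fun t => f (polar r t) * (polar r t)^-1 ^+ k).
  apply: (diff2_ccont (s := 0) (G := fun _ t => f (polar r t) * (polar r t)^-1 ^+ k)) => t _.
  have [A [B dA]] := fd t; have [B' dV] := Vd t k.
  by eexists; eexists; exact: (diff2M dA dV).
have fKc : ccont 0 (2 * pi) (fun t => f (polar r t) * kernel r z t).
  apply: (diff2_ccont (s := 0) (G := fun _ t => f (polar r t) * kernel r z t)) => t _.
  have [A [B dA]] := fd t; have [B' dV] := diff2_kernel 0 t zr.
  by eexists; eexists; exact: (diff2M dA dV).
have [Sc <-] := cint_sum n (fun k => z ^+ k) (ltW pi2) fVc.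
rewrite -cintB// -[2 * pi in leRHS]subr0; apply: cint_norm_le; first exact: ltW.
  rewrite (_ : (fun t => _ - _) = fun t => f (polar r t) * kernel r z t +
     (-1) * \sum_(k < n) z ^+ k * (f (polar r t) * (polar r t)^-1 ^+ k)).
    by apply: ccontD => //; exact: ccontZ.
  by apply/funext => t; rewrite mulN1r.
move=> t tI; rewrite (kernel_geometric t n (ltW r0) zr).
rewrite (_ : _ - _ = f (polar r t) * (z ^+ n * (polar r t)^-1 ^+ n * kernel r z t)); last first.
  rewrite mulrDr mulr_sumr addrAC -[RHS]add0r; congr (_ + _).
  apply/eqP; rewrite subr_eq0; apply/eqP; apply: eq_bigr => k _; by rewrite mulrCA.
rewrite modM; apply: ler_pM; rewrite ?mod_ge0//; first exact: fM.
rewrite modM; apply: ler_pM; rewrite ?mod_ge0//; last exact: mod_kernel.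
by rewrite modM !modX modV mod_polar ?(ltW r0)// expr_div_n exprVn.
Qed.

(* The homotopy [s |-> s z] moves [z] to the centre of the circle. *)
Lemma cint_kernel r z : modulus z < r -> cint 0 (2 * pi) (kernel r z) = (2 * pi)%:C.
Proof.
move=> zr; have r0 : 0 <= r by apply: le_trans (ltW zr); exact: mod_ge0.
pose u (s t : R) := (polar r t - s%:C * z)^-1.
(* [P ds + Q dt] is [- 'i] times the logarithmic differential of [polar r t - s%:C * z]. *)
pose P s t := 'i * z * u s t.
pose Q s t := polar r t * u s t.
have := @goursatC R P Q 0 1 0 (2 * pi) ltr01 pi2.
have -> : Q 1 = kernel r z by apply/funext => t; rewrite /Q /u mul1r.
have u0 s t : 0 <= s <= 1 -> polar r t - s%:C * z != 0.
  move=> /andP[s0 s1]; apply: polar_sub_neq0 => //; apply: le_lt_trans zr.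
  by rewrite modM mod_real ger0_norm// ler_piMl ?mod_ge0.
have -> : Q 0 = fun=> 1.
  apply/funext => t; rewrite /Q /u mul0r subr0 divff//.
  by have := u0 0 t; rewrite lexx ler01 mul0r subr0; exact.
rewrite cint_cst ?(ltW pi2)// mul1r subr0; apply; last first.
  by move=> s; rewrite /P /u !polarE cis_2pi.
move=> s t s01 _; have p0 := u0 s t s01.
have d1 := diff2D (diff2_polar r s t) (diff2Z (-1) (diff2M (diff2_fst s t) (diff2_cst z s t))).
have d2 := diff2_comp d1 (cdiffV (z := polar r t + -1 * (s%:C * z)) ltac:(by rewrite mulN1r)).
have uE : (fun s t => (polar r t + -1 * (s%:C * z))^-1) = u.
  by apply/funext => x; apply/funext => y; rewrite mulN1r.
rewrite uE in d2.
eexists; exists (z * polar r t * (polar r t - s%:C * z)^-2); eexists; split.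
  apply: diff2_eqd (diff2Z ('i * z) d2) erefl _.
  have ii : 'i * 'i = -1 :> R[i] by rewrite -expr2 sqr_i.
  rewrite mulN1r; set v := (_ - _)^-2.
  by rewrite (_ : _ * _ = - ('i * 'i) * (z * polar r t * v)); [rewrite ii opprK mul1r|ring].
apply: diff2_eqd (diff2M (diff2_polar r s t) d2) _ erefl.
by rewrite mulN1r; ring.
Qed.

(** The coefficients are Cauchy integrals over a circle of radius [r] halfway between [rho] and 1;
    the error is geometric with ratio [rho / r], uniformly on the smaller disc. *)
Lemma analytic_poly_approx f rho e : analytic f -> 0 <= rho -> rho < 1 -> 0 < e ->
  exists p : {poly R[i]}, forall z, modulus z <= rho -> modulus (f z - p.[z]) < e.
Proof.
move=> fa rho0 rho1 e0.
pose r := (1 + rho) / 2.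
have r0 : 0 < r by rewrite /r; lra.
have r1 : r < 1 by rewrite /r; lra.
have rr : rho < r by rewrite /r; lra.
have [M M0 fM] := ccont_bounded (ltW pi2) (analytic_circle_ccont (a := 0) (b := 2 * pi) fa r0 r1).
pose K := r / (r - rho).
have K0 : 0 < K by rewrite divr_gt0// subr_gt0.
have B0 : 0 < 2 * (M * K) by rewrite mulr_gt0// mulr_gt0.
have [||n qn] := @pow_small (rho / r) (e / (2 * (M * K))) _ _ (divr_gt0 e0 B0).
- by rewrite divr_ge0// ltW.
- by rewrite ltr_pdivrMr// mul1r.
pose a k := cint 0 (2 * pi) (fun t => f (polar r t) * (polar r t)^-1 ^+ k).
have piC : ((2 * pi)%:C : R[i]) != 0 by rewrite -mod_gt0 mod_real normr_gt0 gt_eqF.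
exists (\poly_(k < n) (a k / (2 * pi)%:C)) => z zrho.
have zr : modulus z < r by exact: le_lt_trans rr.
have := circle_expansion n fa r0 r1 zr fM.
rewrite cauchy_formula// cint_kernel//.
rewrite horner_poly (_ : \sum_(k < n) (a k / _ * _) = (\sum_(k < n) z ^+ k * a k) / (2 * pi)%:C); last first.
  by rewrite mulr_suml; apply: eq_bigr => k _; rewrite mulrAC [a k * _]mulrC.
rewrite (_ : f z - _ = (f z * (2 * pi)%:C - \sum_(k < n) z ^+ k * a k) / (2 * pi)%:C); last first.
  by rewrite mulrBl mulfK.
rewrite modM modV mod_real ger0_norm ?(ltW pi2)// ltr_pdivrMr//.
move=> /le_lt_trans; apply; rewrite ltr_pM2r//.
apply: (@le_lt_trans _ _ ((rho / r) ^+ n * (2 * (M * K)))); last by rewrite -ltr_pdivlMr.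
rewrite [leRHS]mulrCA ler_pM2l// [leRHS]mulrCA ler_pM2l//.
have q0 : 0 <= modulus z / r by rewrite divr_ge0 ?mod_ge0// ltW.
have q1 : 0 <= rho / r by rewrite divr_ge0// ltW.
have q2 : 0 <= r / (r - modulus z) by rewrite divr_ge0 ?subr_ge0 ?ltW.
apply: ler_pM => //; first exact: exprn_ge0.
  by rewrite lerXn2r ?nnegrE// ler_pM2r ?invr_gt0.
by rewrite /K ler_pM2l// lef_pV2 ?posrE ?subr_gt0// lerD2l lerN2.
Qed.

End CauchyFormula.

(** * Integration over the disc in polar coordinates *)

Section Polar.
Variable R : realType.
Local Notation lam := (@lebesgue_measure R).

Lemma measurable_affine (c d : R) : measurable_fun setT (fun x : R => c * x + d).
Proof. by apply: measurable_funD => //; exact: measurable_funM. Qed.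

(** The image of Lebesgue measure under the affine map, multiplied by [|c|], agrees with Lebesgue
    measure on half-open intervals, and uniqueness extends this. For [c < 0] preimages are half-open
    at the other end, with the same length. *)
Lemma ge0_integral_affine (c d : R) (f : R -> \bar R) : c != 0 ->
  measurable_fun setT f -> (forall x, 0 <= f x)%E ->
  (\int[lam]_x f x = `|c|%:E * \int[lam]_x f (c * x + d)%R)%E.
Proof.
move=> c0 mf f0.
have mphi : measurable_fun [set: measurableTypeR R]
  ((fun x => c * x + d) : measurableTypeR R -> measurableTypeR R) by exact: measurable_affine.
pose m : {measure set (measurableTypeR R) -> \bar R} :=
  pushforward lam ((fun x => c * x + d) : measurableTypeR R -> measurableTypeR R).
pose k : {nonneg R} := NngNum (normr_ge0 c).
have E A : measurable A -> lam A = mscale k (m mphi) A.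
  move: A; apply: lebesgue_measure_unique => _ [[a b] _ <-].
  have pre : (fun x => c * x + d) @^-1` `]a, b]%classic =
      if 0 < c then `](a - d) / c, (b - d) / c]%classic
      else `[(b - d) / c, (a - d) / c[%classic.
    apply/seteqP; case: ltrgt0P c0 => // c0 _; split=> x /=; rewrite !in_itv/=.
    - by rewrite ltr_pdivrMr// ler_pdivlMr// [x * c]mulrC ltrBlDr lerBrDr.
    - by rewrite ltr_pdivrMr// ler_pdivlMr// [x * c]mulrC ltrBlDr lerBrDr.
    - by rewrite ler_ndivrMr// ltr_ndivlMr// [x * c]mulrC ltrBlDr lerBrDr andbC.
    - by rewrite ler_ndivrMr// ltr_ndivlMr// [x * c]mulrC ltrBlDr lerBrDr andbC.
  change (lam `]a, b]%classic = (`|c|%:E * lam ((fun x => c * x + d)%R @^-1` `]a, b]%classic))%E).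
  rewrite pre.
  case: ltrgt0P c0 => // c0 _.
    rewrite !lebesgue_measure_itv/= !lte_fin ltr_pM2r ?invr_gt0// ltrD2r.
    case: ifPn => _; last by rewrite mule0.
    rewrite -!EFinB -EFinM; congr EFin; field; exact: lt0r_neq0.
  rewrite !lebesgue_measure_itv/= !lte_fin ltr_nM2r ?invr_lt0// ltrD2r.
  case: ifPn => _; last by rewrite mule0.
  rewrite -!EFinB -EFinM; congr EFin; field; exact: ltr0_neq0.
rewrite (eq_measure_integral (mscale k (m mphi))); last by move=> A mA _; exact: E.
rewrite ge0_integral_mscale//; congr (_ * _)%E.
by rewrite /m ge0_integral_pushforward.
Qed.

Lemma ge0_fubini (K : R * R -> R) : measurable_fun setT K -> (forall u, 0 <= K u) ->
  (\int[lam \x lam]_u (K u)%:E = \int[lam]_x \int[lam]_y (K (x, y))%:E)%E.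
Proof.
move=> mK K0; apply: (@fubini_tonelli1 _ _ (measurableTypeR R) (measurableTypeR R) R
  lam lam (fun u => (K u)%:E)); first exact/measurable_EFinP.
by move=> u; rewrite lee_fin; exact: K0.
Qed.

Lemma measurable_inner_integral (K : R * R -> R) :
  measurable_fun setT K -> (forall u, 0 <= K u) ->
  measurable_fun setT (fun x : R => \int[lam]_y (K (x, y))%:E)%E.
Proof.
move=> mK K0; apply: (@measurable_fun_fubini_tonelli_F _ _ (measurableTypeR R)
  (measurableTypeR R) R lam (fun u => (K u)%:E)); first exact/measurable_EFinP.
by move=> u; rewrite lee_fin; exact: K0.
Qed.

Lemma continuous_atan_all : continuous (@atan R).
Proof. by move=> x; exact: continuous_atan. Qed.

Lemma derive1_atan_fun : (@atan R)^`()%classic = fun x => (1 + x ^+ 2)^-1.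
Proof. by apply/funext => x; exact: derive1_atan. Qed.

(** Substitution is done on the compact intervals from [-n] to [n], followed by monotone convergence
    on both sides. *)
Lemma ge0_integral_atan (G : R -> R) : continuous G -> (forall x, 0 <= G x) ->
  (\int[lam]_(t in `](- (pi / 2))%R, (pi / 2)%R[) (G t)%:E =
   \int[lam]_s (G (atan s) / (1 + s ^+ 2))%:E)%E.
Proof.
move=> Gc G0.
have d1 (x : R) : 0 < 1 + x ^+ 2 by rewrite ltr_pwDl// sqr_ge0.
have cinv : continuous (fun x : R => (1 + x ^+ 2)^-1).
  by move=> x; exact: continuous_oneDsqrV.
have step n : (\int[lam]_(t in `[(atan (- n%:R))%R, (atan n%:R)%R]) (G t)%:E =
    \int[lam]_(s in `[(- n%:R)%R, n%:R%R]) (G (atan s) / (1 + s ^+ 2))%:E)%E.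
  rewrite integration_by_substitution_increasing.
  - by apply: eq_integral => x _ /=; rewrite fctE derive1_atan.
  - by rewrite ge0_cp// lerNl oppr0.
  - by move=> x y _ _; exact: lt_atan.
  - by rewrite derive1_atan_fun => x _; exact: cinv.
  - by rewrite derive1_atan_fun; apply/cvg_ex; eexists; apply: cvg_at_right_filter; exact: cinv.
  - by rewrite derive1_atan_fun; apply/cvg_ex; eexists; apply: cvg_at_left_filter; exact: cinv.
  - split; first by move=> x _; exact: derivable_atan.
    + by apply: cvg_at_right_filter; exact: continuous_atan_all.
    + by apply: cvg_at_left_filter; exact: continuous_atan_all.
  - exact: continuous_subspaceT.
have mG : measurable_fun setT (EFin \o G).
  by apply/measurable_EFinP; exact: continuous_measurable_fun.
have mGa : measurable_fun setT (fun s => (G (atan s) / (1 + s ^+ 2))%:E).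
  apply/measurable_EFinP; apply: continuous_measurable_fun => x.
  apply: cvgM; last exact: cinv.
  by apply: continuous_comp; [exact: continuous_atan_all|exact: Gc].
have U1 : \bigcup_n `[(atan (- n%:R)), (atan (n%:R : R))]%classic = `](- (pi / 2)), (pi / 2)[%classic.
  apply/seteqP; split=> [t [n _ /=]|t /=]; rewrite !in_itv/=.
    move=> /andP[h1 h2]; apply/andP; split.
      exact: lt_le_trans (atan_gtNpi2 _) h1.
    exact: le_lt_trans h2 (atan_ltpi2 _).
  move=> tI; exists (Num.bound `|tan t|) => //=.
  have := ltW (archi_boundP (normr_ge0 (tan t))).
  rewrite in_itv/= ler_norml => /andP[/le_atan + /le_atan].
  by rewrite tanK ?in_itv// => -> ->.
have U2 : \bigcup_n `[(- n%:R), (n%:R : R)]%classic = setT.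
  rewrite -subTset => x _; exists (Num.bound `|x|) => //=.
  by rewrite in_itv/= -ler_norml ltW// archi_boundP.
have c1 := @ge0_nondecreasing_set_cvg_integral _ (measurableTypeR R) _
  (fun n => `[(atan (- n%:R)), (atan (n%:R : R))]%classic) (EFin \o G) lam.
have c2 := @ge0_nondecreasing_set_cvg_integral _ (measurableTypeR R) _
  (fun n => `[(- n%:R), (n%:R : R)]%classic) (fun s => (G (atan s) / (1 + s ^+ 2))%:E) lam.
rewrite U1 in c1; rewrite U2 in c2.
apply: (cvg_unique _ (c1 _ _ _ _)) => //=.
- by move=> m n mn; rewrite subsetEset; apply: subset_itv; rewrite bnd_simp;
   apply: le_atan; rewrite ?lerN2 ler_nat.
- by move=> n; exact: measurable_funTS.
- by move=> n x _; rewrite lee_fin.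
under eq_cvg do rewrite step.
apply: c2 => //.
- by move=> m n mn; rewrite subsetEset; apply: subset_itv; rewrite bnd_simp ?lerN2 ler_nat.
- by move=> n; exact: measurable_funTS.
- by move=> n x _; rewrite lee_fin divr_ge0// ltW.
Qed.

(* Substitute [y = x s], [x = r cos (atan s)] and [s = tan t] one after the
   other, so that only one-dimensional changes of variables occur. *)
Lemma half_polar (F : R * R -> R) : measurable_fun setT F -> (forall u, 0 <= F u) ->
  (forall r, 0 < r -> continuous (fun t => F (r * cos t, r * sin t))) ->
  (\int[lam]_(x in `]0%R, +oo[) \int[lam]_y (F (x, y))%:E =
   \int[lam]_(r in `]0%R, +oo[) (r%:E * \int[lam]_(t in `](- (pi / 2))%R, (pi / 2)%R[)
      (F (r * cos t, r * sin t)%R)%:E))%E.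
Proof.
move=> mF F0 Fc.
have mem_pos (x : R) : (x \in `]0%R, +oo[%classic) = (0 < x).
  by rewrite mem_setE in_itv/= andbT.
(* Cutting [F] off outside the half-plane allows Tonelli on the whole plane. *)
pose H (u : R * R) : \bar R := if 0 < u.1 then (F u)%:E else 0%E.
have mH : measurable_fun setT H.
  apply: measurable_fun_ifT => //.
    by apply: measurable_fun_ltr => //; exact: measurable_fst.
  exact/measurable_EFinP.
have H0 u : (0 <= H u)%E by rewrite /H; case: ifPn => // _; rewrite lee_fin.
pose c s : R := cos (atan s).
have c_gt0 s : 0 < c s.
  by rewrite /c cos_atan invr_gt0 sqrtr_gt0 ltr_pwDl// sqr_ge0.
have csin s : c s * s = sin (atan s).
  rewrite -[X in c s * X]atanK /tan mulrC divfK//.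
  by rewrite gt_eqF// -/(c s).
(* The two linear substitutions contribute [|x|], with [x = c s * r], and [c s]; their product is
   [r] times this square, which is the density of [atan]. *)
have cc s : c s * c s = (1 + s ^+ 2)^-1.
  by rewrite /c cos_atan -invfM -expr2 sqr_sqrtr ?addr_ge0 ?sqr_ge0.
have mHH d (X : measurableType d) (k f g : X -> R) : measurable_fun setT k ->
    measurable_fun setT f -> measurable_fun setT g ->
    measurable_fun setT (fun x => (k x)%:E * H (f x, g x))%E.
  move=> mk mf mg; apply: emeasurable_funM; first exact/measurable_EFinP.
  exact: measurableT_comp mH (measurable_fun_pair mf mg).
have mc : measurable_fun setT c.
  apply: continuous_measurable_fun => x.
  by apply: continuous_comp; [exact: continuous_atan|exact: continuous_cos].
transitivity (\int[lam]_x \int[lam]_y H (x, y))%E.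
  rewrite integral_mkcond; apply: eq_integral => x _.
  by rewrite patchE mem_pos /H /=; case: ifPn => // x0; rewrite integral0.
transitivity (\int[lam]_x \int[lam]_s (`|x|%:E * H (x, x * s)%R))%E.
  apply: eq_integral => x _.
  have [x0|x0] := ltP 0 x; last first.
    rewrite {1}/H /= ltNge x0 /= integral0// (eq_integral (cst 0%E)) ?integral0//.
    by move=> s _; rewrite /H /= ltNge x0 mule0.
  rewrite (@ge0_integral_affine x 0) ?gt_eqF//; last exact: measurableT_comp mH (pair1_measurable _).
  rewrite -ge0_integralZl//; last first.
    by apply: measurableT_comp mH (measurable_fun_pair _ _) => //; exact: measurable_affine.
  by apply: eq_integral => s _; rewrite addr0.
rewrite (@fubini_tonelli _ _ (measurableTypeR R) (measurableTypeR R) R lam lam (fun u : R * R => `|u.1|%:E * H (u.1, (u.1 * u.2)%R))%E)/=; last 2 first.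
- apply: mHH => //; [|exact: measurable_funM].
  by apply: measurableT_comp => //; exact: measurable_fst.
- by move=> u; rewrite mule_ge0.
transitivity (\int[lam]_s \int[lam]_r ((c s * c s * `|r|)%:E * H (c s * r, sin (atan s) * r)%R))%E.
  apply: eq_integral => s _.
  rewrite (@ge0_integral_affine (c s) 0 (fun x => `|x|%:E * H (x, (x * s)%R))%E) ?gt_eqF//; last 2 first.
  - apply: mHH => //; last exact: measurable_funM.
  - by move=> r; rewrite mule_ge0.
  rewrite -ge0_integralZl//; last 2 first.
  - apply: (mHH _ _ (fun r => `|c s * r + 0|) (fun r => c s * r + 0) (fun r => (c s * r + 0) * s)).
    + by apply: measurableT_comp => //; exact: measurable_affine.
    + exact: measurable_affine.
    + by apply: measurable_funM => //; exact: measurable_affine.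
  - by move=> r _; rewrite mule_ge0.
  apply: eq_integral => r _; rewrite addr0 muleA -EFinM normrM gtr0_norm ?c_gt0//.
  by rewrite mulrA -csin [c s * r * s]mulrAC.
rewrite (@fubini_tonelli _ _ (measurableTypeR R) (measurableTypeR R) R lam lam (fun u : R * R => (c u.1 * c u.1 * `|u.2|)%:E * H (c u.1 * u.2, sin (atan u.1) * u.2)%R)%E)/=; last 2 first.
- have mc1 : measurable_fun [set: R * R] (fun u => c u.1).
    by apply: measurableT_comp mc _; exact: measurable_fst.
  apply: mHH.
  + apply: measurable_funM; first exact: measurable_funM.
    by apply: measurableT_comp => //; exact: measurable_snd.
  + by apply: measurable_funM => //; exact: measurable_snd.
  + apply: measurable_funM; last exact: measurable_snd.
    apply: measurableT_comp; last first.
      apply: measurableT_comp; last exact: measurable_fst.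
      exact: continuous_measurable_fun continuous_atan_all.
    exact: continuous_measurable_fun (@continuous_sin R).
- by move=> u; rewrite mule_ge0// lee_fin mulr_ge0// mulr_ge0// ltW.
rewrite [RHS]integral_mkcond; apply: eq_integral => r _.
rewrite patchE mem_pos; case: ifPn => r0; last first.
  rewrite (eq_integral (cst 0%E)) ?integral0// => s _.
  by rewrite /H /= pmulr_rgt0// (negbTE r0) mule0.
rewrite ge0_integral_atan//; last exact: Fc.
rewrite -ge0_integralZl//; last 3 first.
- apply/measurable_EFinP; apply: continuous_measurable_fun => x.
  apply: cvgM; last exact: continuous_oneDsqrV.
  apply: (@continuous_comp _ _ _ (@atan R) (fun t => F (r * cos t, r * sin t))).
    exact: continuous_atan.
  exact: Fc.
- by move=> s _; rewrite lee_fin divr_ge0// addr_ge0 ?sqr_ge0.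
- by rewrite lee_fin ltW.
apply: eq_integral => s _; rewrite /H /= pmulr_rgt0// r0 -!EFinM gtr0_norm//; congr EFin.
by rewrite cc [c s * r]mulrC [sin _ * r]mulrC -/(c s); ring.
Qed.

Lemma ge0_integral_itv_split (a b c : R) (G : R -> R) : a <= b -> b <= c ->
  measurable_fun setT G -> (forall x, 0 <= G x) ->
  (\int[lam]_(t in `[a, c[) (G t)%:E =
   \int[lam]_(t in `[a, b[) (G t)%:E + \int[lam]_(t in `[b, c[) (G t)%:E)%E.
Proof.
move=> ab bc mG G0.
have E : `[a, c[%classic = `[a, b[%classic `|` `[b, c[%classic.
  by apply: itv_bndbnd_setU; rewrite bnd_simp.
rewrite E ge0_integral_setU//.
- by apply/measurable_EFinP; apply: measurable_funTS.
- by move=> x _; rewrite lee_fin.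
- apply/disj_setPS => x [] /=; rewrite !in_itv/= => /andP[_ xb] /andP[bx _].
  by move: (lt_le_trans xb bx); rewrite ltxx.
Qed.

Lemma ge0_integral_itv_shift (a b c : R) (G : R -> R) :
  measurable_fun setT G -> (forall x, 0 <= G x) ->
  (\int[lam]_(t in `[a, b[) (G (t + c)%R)%:E =
   \int[lam]_(t in `[(a + c)%R, (b + c)%R[) (G t)%:E)%E.
Proof.
move=> mG G0; rewrite [RHS]integral_mkcond (@ge0_integral_affine 1 c)//; last 2 first.
- by apply/(measurable_restrictT (fun x => (G x)%:E)) => //; apply/measurable_EFinP; exact: measurable_funTS.
- by move=> x; apply: erestrict_ge0 => y _; rewrite lee_fin.
rewrite normr1 mul1e [LHS]integral_mkcond; apply: eq_integral => t _.
by rewrite !patchE mul1r !mem_setE !in_itv/= lerD2r ltrD2r.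
Qed.

(** A half-turn carries the left half-plane to the right one, where [half_polar] applies. The angles
    obtained run from [- pi / 2] to [3 pi / 2], and periodicity moves the part below 0 to the end of
    the period. *)
Lemma polar_integral (F : R * R -> R) : measurable_fun setT F -> (forall u, 0 <= F u) ->
  (forall r, 0 < r -> continuous (fun t => F (r * cos t, r * sin t))) ->
  (\int[lam \x lam]_u (F u)%:E =
   \int[lam]_(r in `]0%R, +oo[) (r%:E * \int[lam]_(t in `[0%R, (2 * pi)%R])
      (F (r * cos t, r * sin t)%R)%:E))%E.
Proof.
move=> mF F0 Fc.
rewrite (ge0_fubini mF F0).
pose Phi x := (\int[lam]_y (F (x, y))%:E)%E.
have mPhi : measurable_fun setT Phi := measurable_inner_integral mF F0.
have FE0 u : (0 <= (F u)%:E)%E by rewrite lee_fin.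
have Phi0 x : (0 <= Phi x)%E by apply: integral_ge0 => y _.
transitivity (\int[lam]_(x in `]0%R, +oo[) Phi x + \int[lam]_(x in `]-oo, 0%R]) Phi x)%E.
  rewrite -ge0_integral_setU//; last 2 first.
  - exact: measurable_funTS.
  - apply/disj_setPS => x [] /=; rewrite !in_itv/= andbT => x0.
    by rewrite leNgt x0.
  congr integral; apply/esym; rewrite -subTset => x _ /=; rewrite !in_itv/= andbT.
  by case: (ltP 0 x); [left|right].
pose F' (u : R * R) := F (- u.1, - u.2).
have mF' : measurable_fun setT F'.
  apply: measurableT_comp mF (measurable_fun_pair _ _).
    by apply: measurableT_comp => //; exact: measurable_fst.
  by apply: measurableT_comp => //; exact: measurable_snd.
have Phi' : (\int[lam]_(x in `]-oo, 0%R]) Phi x =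
    \int[lam]_(x in `]0%R, +oo[) \int[lam]_y (F' (x, y))%:E)%E.
  rewrite integral_mkcond (@ge0_integral_affine (-1) 0)//; last 2 first.
  - by apply/(measurable_restrictT Phi) => //; exact: measurable_funTS.
  - by move=> x; apply: erestrict_ge0.
  rewrite normrN1 mul1e.
  have -> : (\int[lam]_(x in `]0%R, +oo[) \int[lam]_y (F' (x, y))%:E =
     \int[lam]_(x in `[0%R, +oo[) \int[lam]_y (F' (x, y))%:E)%E.
    apply: integral_itv_obnd_cbnd; apply: measurable_funTS.
    by apply: measurable_inner_integral => // u; exact: F0.
  rewrite [RHS]integral_mkcond; apply: eq_integral => x _.
  rewrite !patchE !mem_setE !in_itv/= addr0 mulN1r oppr_le0 andbT.
  case: ifPn => // _; rewrite /Phi (@ge0_integral_affine (-1) 0)//; last first.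
    by apply/measurable_EFinP; exact: measurableT_comp mF (pair1_measurable _).
  rewrite normrN1 mul1e; apply: eq_integral => y _.
  by rewrite /F' /= addr0 mulN1r.
have F'0 u : 0 <= F' u by exact: F0.
have F'c r : 0 < r -> continuous (fun t => F' (r * cos t, r * sin t)).
  move=> r0 x.
  rewrite (_ : (fun t => F' _) = (fun t => F (r * cos t, r * sin t)) \o (fun t => t + pi)).
    apply: continuous_comp; last exact: Fc.
    by apply: cvgD; [exact: cvg_id|exact: cvg_cst].
  by apply/funext => t /=; rewrite /F' /= cosDpi sinDpi !mulrN.
rewrite Phi' /Phi (half_polar mF F0 Fc) (half_polar mF' F'0 F'c).
have PE0 : 0 < pi :> R := pi_gt0 R.
have mAB (K : R * R -> R) : measurable_fun setT K -> (forall u, 0 <= K u) ->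
    measurable_fun setT (fun r : R => \int[lam]_(t in `](- (pi / 2))%R, (pi / 2)%R[) (K (r * cos t, r * sin t)%R)%:E)%E.
  move=> mK K0.
  pose L (u : R * R) : \bar R := if (- (pi / 2) < u.2) && (u.2 < pi / 2)
    then (K (u.1 * cos u.2, u.1 * sin u.2))%:E else 0%E.
  have mL : measurable_fun setT L.
    apply: measurable_fun_ifT => //.
      by apply: measurable_and; apply: measurable_fun_ltr => //; exact: measurable_snd.
    apply/measurable_EFinP; apply: measurableT_comp mK (measurable_fun_pair _ _).
      apply: measurable_funM; first exact: measurable_fst.
      by apply: measurableT_comp; [exact: continuous_measurable_fun (@continuous_cos R)|exact: measurable_snd].
    apply: measurable_funM; first exact: measurable_fst.
    by apply: measurableT_comp; [exact: continuous_measurable_fun (@continuous_sin R)|exact: measurable_snd].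
  rewrite (_ : (fun r : R => _) = fun r : R => (\int[lam]_t L (r, t))%E).
    apply: (@measurable_fun_fubini_tonelli_F _ _ (measurableTypeR R) (measurableTypeR R) R lam L) => //.
    by move=> u; rewrite /L; case: ifPn => // _; rewrite lee_fin.
  apply/funext => r; rewrite integral_mkcond; apply: eq_integral => t _.
  by rewrite patchE mem_setE in_itv.
rewrite -ge0_integralD//; last 4 first.
- by move=> r /=; rewrite in_itv/= andbT => r0; rewrite mule_ge0 ?lee_fin ?(ltW r0)// integral_ge0// => t _; rewrite lee_fin.
- by apply: measurable_funTS; apply: emeasurable_funM; [exact/measurable_EFinP|exact: mAB].
- by move=> r /=; rewrite in_itv/= andbT => r0; rewrite mule_ge0 ?lee_fin ?(ltW r0)// integral_ge0// => t _; rewrite lee_fin.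
- by apply: measurable_funTS; apply: emeasurable_funM; [exact/measurable_EFinP|exact: mAB].
apply: eq_integral => r; rewrite inE/= in_itv/= andbT => r0.
rewrite -ge0_muleDr; last 2 first.
- by apply: integral_ge0 => t _; rewrite lee_fin.
- by apply: integral_ge0 => t _; rewrite lee_fin.
congr (_ * _)%E.
pose G t := F (r * cos t, r * sin t).
have mG : measurable_fun setT G by apply: continuous_measurable_fun; exact: Fc.
have G0 t : 0 <= G t by exact: F0.
have mGE D : measurable_fun D (EFin \o G) by apply/measurable_EFinP; exact: measurable_funTS.
transitivity (\int[lam]_(t in `[(- (pi / 2))%R, (pi / 2)%R[) (G t)%:E +
   \int[lam]_(t in `[(- (pi / 2))%R, (pi / 2)%R[) (G (t + pi)%R)%:E)%E.
  congr (_ + _)%E; rewrite (@integral_itv_bndoo _ _ _ _ true true)//.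
    by apply: eq_integral => t _; rewrite /F' /G /= cosDpi sinDpi !mulrN.
  apply/measurable_EFinP; apply: measurable_funTS.
  by apply: measurableT_comp => //; exact: measurable_funD.
transitivity (\int[lam]_(t in `[0%R, (2 * pi)%R[) (G t)%:E)%E; last first.
  exact: integral_itv_bndo_bndc.
rewrite ge0_integral_itv_shift//.
rewrite (_ : - (pi / 2) + pi = pi / 2); last by field.
rewrite (@ge0_integral_itv_split (- (pi / 2)) 0 (pi / 2))//; [|lra|lra].
rewrite (@ge0_integral_itv_split 0 (pi / 2) (2 * pi))//; [|lra|lra].
rewrite (@ge0_integral_itv_split (pi / 2) (pi / 2 + pi) (2 * pi))//; [|lra|lra].
have -> : (\int[lam]_(t in `[(- (pi / 2))%R, 0%R[) (G t)%:E =
   \int[lam]_(t in `[(pi / 2 + pi)%R, (2 * pi)%R[) (G t)%:E)%E.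
  transitivity (\int[lam]_(t in `[(- (pi / 2))%R, 0%R[) (G (t + 2 * pi)%R)%:E)%E.
    apply: eq_integral => t _; rewrite /G mulr_natl mulr2n addrA !cosDpi !sinDpi.
    by rewrite !opprK.
  rewrite ge0_integral_itv_shift// add0r.
  by rewrite (_ : - (pi / 2) + 2 * pi = pi / 2 + pi)//; field.
by rewrite -addeA addeC -addeA.
Qed.

End Polar.

(** A nonnegative integral is the supremum over simple functions below the zero extension, so
    comparing the two extensions pointwise is enough. *)
Lemma ge0_le_integral_subset d (T : measurableType d) (R : realType)
    (mu : {measure set T -> \bar R}) (A B : set T) (f1 f2 : T -> \bar R) :
  A `<=` B -> (forall x, A x -> (0 <= f1 x)%E) -> (forall x, B x -> (0 <= f2 x)%E) ->
  (forall x, A x -> (f1 x <= f2 x)%E) ->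
  (\int[mu]_(x in A) f1 x <= \int[mu]_(x in B) f2 x)%E.
Proof.
move=> AB f10 f20 f12; rewrite !ge0_integralE//; apply: le_ereal_sup => _ [h Hh <-].
exists h => // x; apply: le_trans (Hh x) _; rewrite !patchE.
case: ifPn => xA; last by case: ifPn => // /set_mem/f20.
by rewrite mem_set ?f12//; [exact: set_mem|exact/AB/set_mem].
Qed.

(** * Measurability, polar coordinates and dilation on the disc *)

Section DiscIntegral.
Variable R : realType.
Local Notation lam := (@lebesgue_measure R).

Definition box_open (U : set (R * R)) := forall u, U u -> exists2 d, 0 < d &
  forall v : R * R, `|v.1 - u.1| < d -> `|v.2 - u.2| < d -> U v.

(** The set is the union of the boxes with rational centre and radius [1 / (n + 1)] that it
    contains. The boxes are coded by natural numbers, and each is a measurable rectangle. *)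
Lemma box_open_measurable (U : set (R * R)) : box_open U -> measurable U.
Proof.
move=> oU.
pose box (k : rat * rat * nat) : set (R * R) :=
  `](ratr k.1.1 - k.2.+1%:R^-1), (ratr k.1.1 + k.2.+1%:R^-1)[%classic `*`
  `](ratr k.1.2 - k.2.+1%:R^-1), (ratr k.1.2 + k.2.+1%:R^-1)[%classic.
have inbox k (v : R * R) : box k v <->
    `|v.1 - ratr k.1.1| < k.2.+1%:R^-1 /\ `|v.2 - ratr k.1.2| < k.2.+1%:R^-1.
  by rewrite /box /= !in_itv/= !ltr_distl.
pose A n := if @unpickle (rat * rat * nat)%type n is Some k then
  (if `[< box k `<=` U >] then box k else set0) else set0.
have near1 (a b c : R) : a - c < b -> b < a + c -> `|a - b| < c.
  by move=> h1 h2; rewrite ltr_norml; apply/andP; split; lra.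
have near2 (a b c x : R) : b - c < x -> x < b + c -> `|a - x| < c -> `|a - b| <= 2 * c.
  move=> h1 h2; rewrite ltr_norml => /andP[? ?].
  by rewrite ler_norml; apply/andP; split; lra.
have -> : U = \bigcup_n A n.
  apply/seteqP; split=> [u Uu|u [n _]]; last first.
    rewrite /A; case: unpickle => // k; case: ifPn => // /asboolP + kb; exact.
  have [d d0 Ud] := oU u Uu.
  pose n := Num.bound (2 / d).
  (* A point of the box and [u] are both within one radius of the rational centre in each
     coordinate, so they differ by at most two radii. *)
  have nd : 2 / n.+1%:R < d.
    rewrite ltr_pdivrMr// mulrC -ltr_pdivrMr//.
    apply: lt_trans (archi_boundP _) _; first by rewrite divr_ge0// ltW.
    by rewrite ltr_nat.
  have n0 : 0 < n.+1%:R^-1 :> R by rewrite invr_gt0.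
  have [|q1] := @rat_in_itvoo R (u.1 - n.+1%:R^-1) (u.1 + n.+1%:R^-1).
    by rewrite ltrBlDr -addrA ltrDl addr_gt0.
  rewrite in_itv/= => /andP[q1a q1b].
  have [|q2] := @rat_in_itvoo R (u.2 - n.+1%:R^-1) (u.2 + n.+1%:R^-1).
    by rewrite ltrBlDr -addrA ltrDl addr_gt0.
  rewrite in_itv/= => /andP[q2a q2b].
  exists (pickle (q1, q2, n)); [exact: I|rewrite /A pickleK].
  case: ifPn => [_|/asboolP[]].
    by apply/inbox; split; exact: near1.
  move=> v /inbox /= [v1 v2]; apply: Ud; apply: le_lt_trans nd.
    exact: near2 q1a q1b v1.
  exact: near2 q2a q2b v2.
apply: bigcupT_measurable => n; rewrite /A; case: unpickle => [k|]; last exact: measurable0.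
case: ifPn => _; last exact: measurable0.
exact: measurableX.
Qed.

Lemma box_cont_measurable (D : set (R * R)) (f : R * R -> R) : box_open D ->
  (forall u, D u -> forall e, 0 < e -> exists2 d, 0 < d &
    forall v : R * R, `|v.1 - u.1| < d -> `|v.2 - u.2| < d -> `|f v - f u| < e) ->
  measurable_fun D f.
Proof.
move=> oD fc mD; apply: (measurability _ (RGenOInfty.measurableE R)) => //.
move=> _ [_ [a ->] <-]; apply: box_open_measurable => u [Du /=].
rewrite in_itv/= andbT => au.
have [d d0 Hd] := oD u Du.
have [|k k0 Hk] := fc u Du (f u - a); first by rewrite subr_gt0.
exists (Num.min d k) => [|v]; first by rewrite lt_min d0.
rewrite !lt_min => /andP[vd vk] /andP[wd wk]; split; first exact: Hd.
rewrite /= in_itv/= andbT; have := Hk v vk wk; rewrite ltr_norml => /andP[+ _].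
lra.
Qed.

Definition disc2 : set (R * R) := [set u | unit_disc (u.1 +i* u.2)].

Lemma mod_diff_lt (u v : R * R) d : `|v.1 - u.1| < d -> `|v.2 - u.2| < d ->
  modulus ((v.1 +i* v.2) - (u.1 +i* u.2)) < 2 * d.
Proof.
move=> h1 h2; apply: le_lt_trans (mod_le _) _ => /=.
by rewrite mulr_natl mulr2n ltrD.
Qed.

Lemma disc2E (u : R * R) : disc2 u = (modulus (u.1 +i* u.2) < 1) :> Prop.
Proof. by []. Qed.

Lemma box_open_disc2 : box_open disc2.
Proof.
move=> u; rewrite disc2E => u1.
exists ((1 - modulus (u.1 +i* u.2)) / 2); first by rewrite divr_gt0// subr_gt0.
move=> v h1 h2; have := mod_diff_lt h1 h2; rewrite mulrC divfK// => h.
rewrite disc2E.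
rewrite -(subrK (u.1 +i* u.2) (v.1 +i* v.2)); apply: le_lt_trans (modD _ _) _.
by move: h; lra.
Qed.

Lemma measurable_disc2 : measurable disc2.
Proof. exact: box_open_measurable box_open_disc2. Qed.

Definition rcont (F : R[i] -> R) z := forall e, 0 < e -> exists2 d : R, 0 < d &
  forall h, modulus h < d -> `|F (z + h) - F z| < e.

Lemma rcont_measurable (F : R[i] -> R) : (forall z, modulus z < 1 -> rcont F z) ->
  measurable_fun disc2 (fun u => F (u.1 +i* u.2)).
Proof.
move=> Fc; apply: (box_cont_measurable box_open_disc2) => u Du e e0.
have [d d0 Hd] := Fc _ Du _ e0.
exists (d / 2) => [|v h1 h2]; first by rewrite divr_gt0.
have := mod_diff_lt h1 h2; rewrite mulrC divfK// => /Hd.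
by rewrite subrKC.
Qed.

Lemma analytic_mod_rcont f z : analytic f -> modulus z < 1 ->
  rcont (fun z => modulus (f z)) z.
Proof.
move=> fa z1 e e0; have [l Hl] := analytic_cdiff fa z1.
have [d d0 Hd] := cdiff_cont Hl e0; exists d => // h hd.
apply: le_lt_trans (Hd h hd); rewrite ler_norml modB_ge andbT lerNl opprB.
by rewrite [leRHS]modB modB_ge.
Qed.

Lemma rcont_comp F k z : rcont F z -> {for F z, continuous k} ->
  rcont (fun z => k (F z)) z.
Proof.
move=> Fc /cvgrPdist_lt kc e e0; have [d /= d0 Hd] := kc e e0.
have [c c0 Hc] := Fc d d0; exists c => // h /Hc h1.
by rewrite distrC; apply: Hd => /=; rewrite distrC.
Qed.

Lemma powR_continuous_at (a x : R) : 0 < x -> {for x, continuous (fun x => x `^ a)}.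
Proof.
move=> x0.
have E : \forall y \near x, expR (a * ln y) = y `^ a.
  by near=> y; rewrite /powR gt_eqF//; near: y; exact: lt_nbhsr.
have H : {for x, continuous (expR \o (fun y => a * ln y))}.
  apply: continuous_comp; last exact: continuous_expR.
  by apply: cvgMl_tmp; exact: continuous_ln.
rewrite /prop_for /continuous_at /= in H *.
have -> : x `^ a = expR (a * ln x) by rewrite /powR gt_eqF.
exact: cvg_trans (near_eq_cvg E) H.
Unshelve. all: by end_near. Qed.

Lemma circle_continuous (F : R[i] -> R) r : 0 <= r ->
  (forall z, modulus z = r -> rcont F z) -> continuous (fun t => F (polar r t)).
Proof.
move=> r0 Fc t; apply/cvgrPdist_lt => e e0.
have [d d0 Hd] := Fc _ (mod_polar t r0) e e0.
have [L L0 [k k0 Hk]] := diff2_lip (diff2_polar r 0 t).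
exists (Num.min k (d / L)); first by rewrite /= lt_min k0 divr_gt0.
move=> s /=; rewrite lt_min => /andP[sk sd].
rewrite distrC -[polar r s](subrKC (polar r t)); apply: Hd.
have := Hk 0 s; rewrite subrr normr0 add0r distrC => /(_ k0 sk) /le_lt_trans; apply.
by rewrite mulrC -ltr_pdivlMr.
Qed.

(** The zero extension may jump at the unit circle, yet each circle about the origin lies entirely
    inside or outside the disc; along circles the extension is therefore continuous, as
    [polar_integral] demands. *)
Lemma disc_polar (F : R[i] -> R) : 
  measurable_fun disc2 (fun u => F (u.1 +i* u.2)) -> (forall z, 0 <= F z) ->
  (forall r, 0 < r -> r < 1 -> continuous (fun t => F (polar r t))) ->
  (\int[lam \x lam]_(u in disc2) (F (u.1 +i* u.2)%C)%:E =
   \int[lam]_(r in `]0%R, 1%R[)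
     (r%:E * \int[lam]_(t in `[0%R, (2 * pi)%R]) (F (polar r t))%:E))%E.
Proof.
move=> mF F0 Fc.
pose H (u : R * R) : R := (fun u => F (u.1 +i* u.2)) \_ disc2 u.
have mH : measurable_fun setT H by apply/(measurable_restrictT _ measurable_disc2).
have H0 u : 0 <= H u by rewrite /H patchE; case: ifPn.
have HE (u : R * R) : H u = if modulus (u.1 +i* u.2) < 1 then F (u.1 +i* u.2) else 0.
  rewrite /H patchE; congr (if _ then _ else _).
  by apply/idP/idP; rewrite inE.
have Hp r t : 0 < r -> H (r * cos t, r * sin t) = if r < 1 then F (polar r t) else 0.
  move=> r0; rewrite HE.
  change ((if modulus (polar r t) < 1 then F (polar r t) else 0) =
    if r < 1 then F (polar r t) else 0).
  by rewrite mod_polar// ltW.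
have Hc r : 0 < r -> continuous (fun t => H (r * cos t, r * sin t)).
  move=> r0; rewrite (_ : (fun t => _) = if r < 1 then fun t => F (polar r t) else cst 0).
    by case: ifPn => r1; [exact: Fc|exact: cst_continuous].
  by apply/funext => t; rewrite Hp//; case: ifPn.
transitivity (\int[lam \x lam]_u (H u)%:E)%E.
  rewrite integral_mkcond; apply: eq_integral => u _.
  by rewrite /H !patchE; case: ifPn.
rewrite (polar_integral mH H0 Hc) integral_mkcond [RHS]integral_mkcond.
apply: eq_integral => r _; rewrite !patchE !mem_setE !in_itv/= andbT.
have [r0|//] := ltP 0 r; case: ifPn => /= r1.
  by congr (_ * _)%E; apply: eq_integral => t _; rewrite Hp// r1.
rewrite (eq_integral (cst 0%E)) ?integral0 ?mule0// => t _.
by rewrite Hp// (negbTE r1).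
Qed.

(** [rho ^- 2] is the Jacobian, obtained by scaling each coordinate; there is only an inequality
    because the scaled disc fills only a part of the disc. *)
Lemma disc_dilation (F : R[i] -> R) (rho : R) : 0 < rho -> rho <= 1 ->
  measurable_fun disc2 (fun u => F (u.1 +i* u.2)) -> (forall z, 0 <= F z) ->
  (\int[lam \x lam]_(u in disc2) (F (rho%:C * (u.1 +i* u.2)))%:E <=
   (rho ^- 2)%:E * \int[lam \x lam]_(u in disc2) (F (u.1 +i* u.2)%C)%:E)%E.
Proof.
move=> rho0 rho1 mF F0.
pose H (u : R * R) : R := (fun u => F (u.1 +i* u.2)) \_ disc2 u.
have mH : measurable_fun setT H by apply/(measurable_restrictT _ measurable_disc2).
have H0 u : 0 <= H u by rewrite /H patchE; case: ifPn.
have scal u : rho%:C * (u.1 +i* u.2) = (rho * u.1) +i* (rho * u.2) by simpc.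
have disc_scal u : disc2 u -> disc2 (rho * u.1, rho * u.2).
  rewrite !disc2E -scal modM mod_real ger0_norm ?(ltW rho0)// => u1.
  apply: le_lt_trans u1; rewrite ler_piMl ?mod_ge0//.
have mHs : measurable_fun setT (fun u : R * R => H (rho * u.1, rho * u.2)).
  apply: measurableT_comp mH (measurable_fun_pair _ _).
    by apply: measurable_funM => //; exact: measurable_fst.
  by apply: measurable_funM => //; exact: measurable_snd.
have -> : (\int[lam \x lam]_(u in disc2) (F (u.1 +i* u.2)%C)%:E = \int[lam \x lam]_u (H u)%:E)%E.
  rewrite integral_mkcond; apply: eq_integral => u _.
  by rewrite /H !patchE; case: ifPn.
have scale2 : (\int[lam \x lam]_u (H u)%:E = (rho ^+ 2)%:E * \int[lam \x lam]_u (H (rho * u.1, rho * u.2)%R)%:E)%E.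
  rewrite (ge0_fubini mH H0) (ge0_fubini mHs (fun u => H0 _)).
  have rhoN0 : rho != 0 by rewrite gt_eqF.
  rewrite (@ge0_integral_affine R rho 0 _ rhoN0); last 2 first.
  - exact: measurable_inner_integral.
  - by move=> x; apply: integral_ge0 => y _; rewrite lee_fin.
  rewrite (gtr0_norm rho0) expr2 EFinM -muleA; congr (_ * _)%E.
  rewrite -ge0_integralZl//; last 3 first.
  - exact: (measurable_inner_integral mHs).
  - by move=> x _; apply: integral_ge0 => y _; rewrite lee_fin.
  - by rewrite lee_fin ltW.
  apply: eq_integral => x _; rewrite addr0 (@ge0_integral_affine R rho 0) ?gt_eqF//; last 2 first.
  - by apply/measurable_EFinP; exact: measurableT_comp mH (pair1_measurable _).
  - by move=> y; rewrite lee_fin.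
  by rewrite gtr0_norm//; congr (_ * _)%E; apply: eq_integral => y _; rewrite addr0.
rewrite scale2 muleA -EFinM mulVf ?mul1e ?expf_neq0 ?gt_eqF//.
have -> : (\int[lam \x lam]_(u in disc2) (F (rho%:C * (u.1 +i* u.2)))%:E =
    \int[lam \x lam]_(u in disc2) (H (rho * u.1, rho * u.2)%R)%:E)%E.
  apply: eq_integral => u; rewrite inE => Du; rewrite /H patchE mem_set; last exact: disc_scal.
  by rewrite scal.
by apply: ge0_le_integral_subset => // u _; rewrite lee_fin.
Qed.

End DiscIntegral.

(** * Weighted Bergman spaces and density of polynomials *)

Section AnalyticClosure.
Variable R : realType.
Implicit Types f h : R[i] -> R[i].

Lemma analytic_cst c : @analytic R (fun=> c).
Proof. by apply: analyticP => z _; exists 0; exact: cdiff_cst. Qed.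

Lemma analytic_id : @analytic R id.
Proof. by apply: analyticP => z _; exists 1; exact: cdiff_id. Qed.

Lemma analyticD f h : analytic f -> analytic h -> analytic (fun z => f z + h z).
Proof.
move=> fa ha; apply: analyticP => z z1.
have [l Hl] := analytic_cdiff fa z1; have [m Hm] := analytic_cdiff ha z1.
by eexists; exact: cdiffD Hl Hm.
Qed.

Lemma analyticM f h : analytic f -> analytic h -> analytic (fun z => f z * h z).
Proof.
move=> fa ha; apply: analyticP => z z1.
have [l Hl] := analytic_cdiff fa z1; have [m Hm] := analytic_cdiff ha z1.
by eexists; exact: cdiffM Hl Hm.
Qed.

Lemma analyticB f h : analytic f -> analytic h -> analytic (fun z => f z - h z).
Proof.
move=> fa ha.
have -> : (fun z => f z - h z) = fun z => f z + (-1) * h z.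
  by apply/funext => z; rewrite mulN1r.
exact (analyticD fa (analyticM (@analytic_cst (-1)) ha)).
Qed.

Lemma analyticV f : analytic f -> (forall z, modulus z < 1 -> f z != 0) ->
  analytic (fun z => (f z)^-1).
Proof.
move=> fa f0; apply: analyticP => z z1; have [l Hl] := analytic_cdiff fa z1.
by eexists; exact: cdiff_comp Hl (cdiffV (f0 z z1)).
Qed.

Lemma analytic_horner (q : {poly R[i]}) : analytic (fun z => q.[z]).
Proof.
elim/poly_ind: q => [|q c IH].
  have -> : (fun z => (0 : {poly R[i]}).[z]) = fun=> 0.
    by apply/funext => z; rewrite horner0.
  exact: analytic_cst.
have -> : (fun z => (q * 'X + c%:P).[z]) = fun z => q.[z] * z + c.
  by apply/funext => z; rewrite hornerD hornerM hornerX hornerC.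
exact (analyticD (analyticM IH (@analytic_id)) (@analytic_cst c)).
Qed.

Lemma mod_scale_lt1 (rho : R) z : 0 <= rho -> rho <= 1 -> modulus z < 1 ->
  modulus (rho%:C * z) < 1.
Proof.
move=> rho0 rho1 z1; rewrite modM mod_real ger0_norm//.
by apply: le_lt_trans z1; rewrite ler_piMl ?mod_ge0.
Qed.

Lemma analytic_scale f (rho : R) : 0 <= rho -> rho <= 1 -> analytic f ->
  analytic (fun z => f (rho%:C * z)).
Proof.
move=> rho0 rho1 fa; apply: analyticP => z z1.
have [l Hl] := analytic_cdiff fa (mod_scale_lt1 rho0 rho1 z1).
have := cdiffM (cdiff_cst rho%:C z) (cdiff_id z); rewrite mul0r add0r mulr1 => Hs.
by eexists; exact: cdiff_comp Hs Hl.
Qed.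

Lemma analytic_dilation_poly_approx f (rho e : R) : analytic f -> 0 <= rho -> rho < 1 ->
  0 < e -> exists q : {poly R[i]}, forall z, modulus z < 1 ->
    modulus (f (rho%:C * z) - q.[z]) < e.
Proof.
move=> fa rho0 rho1 e0; have [q Hq] := analytic_poly_approx fa rho0 rho1 e0.
exists (q \Po (rho%:C *: 'X)) => z z1.
rewrite horner_comp hornerZ hornerX; apply: Hq.
rewrite modM mod_real ger0_norm// -[leRHS]mulr1.
by apply: ler_wpM2l => //; exact: ltW.
Qed.

Lemma mod_sum n (F : nat -> R[i]) :
  modulus (\sum_(k < n) F k) <= \sum_(k < n) modulus (F k).
Proof.
elim: n => [|n IH]; first by rewrite !big_ord0 mod0.
by rewrite !big_ord_recr; apply: le_trans (modD _ _) _; rewrite lerD2r.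
Qed.

Lemma horner_disc_bounded (q : {poly R[i]}) : exists2 M : R, 0 < M &
  forall z, modulus z < 1 -> modulus q.[z] <= M.
Proof.
exists (\sum_(k < size q) modulus q`_k + 1).
  by rewrite ltr_wpDl// sumr_ge0// => k _; exact: mod_ge0.
move=> z z1; rewrite horner_coef ler_wpDr//.
apply: le_trans (mod_sum _ (fun k => q`_k * z ^+ k)) _; apply: ler_sum => k _.
by rewrite modM modX ler_piMr ?mod_ge0// exprn_ile1 ?mod_ge0// ltW.
Qed.

End AnalyticClosure.

(** * Calculus of integrals over the disc *)

Section DiscInt.
Variable R : realType.
Local Notation lam := (@lebesgue_measure R).

Definition dint (F : R[i] -> R) : \bar R :=
  (\int[lam \x lam]_(u in @disc2 R) (F (u.1 +i* u.2)%C)%:E)%E.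

Definition mdisc (F : R[i] -> R) := measurable_fun (@disc2 R) (fun u => F (u.1 +i* u.2)).

Lemma mdisc_EFin F : mdisc F ->
  measurable_fun (@disc2 R) (fun u => (F (u.1 +i* u.2))%:E).
Proof. by move=> mF; exact/measurable_EFinP. Qed.

Lemma mdiscM F G : mdisc F -> mdisc G -> mdisc (fun z => F z * G z).
Proof. by move=> mF mG; exact: measurable_funM. Qed.

Lemma mdiscD F G : mdisc F -> mdisc G -> mdisc (fun z => F z + G z).
Proof. by move=> mF mG; exact: measurable_funD. Qed.

Lemma mdiscB F G : mdisc F -> mdisc G -> mdisc (fun z => F z - G z).
Proof. by move=> mF mG; exact: measurable_funB. Qed.

Lemma mdisc_cst c : mdisc (fun=> c).
Proof. exact: measurable_cst. Qed.

Lemma mdisc_powR F a : mdisc F -> mdisc (fun z => F z `^ a).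
Proof. by move=> mF; exact: (measurableT_comp (measurable_powR a) mF). Qed.

Lemma mdisc_mod f : analytic f -> mdisc (fun z => modulus (f z)).
Proof. by move=> fa; apply: rcont_measurable => z; exact: analytic_mod_rcont. Qed.

Lemma dint_ge0 F : (forall z, modulus z < 1 -> 0 <= F z) -> (0 <= dint F)%E.
Proof. by move=> F0; apply: integral_ge0 => u Du; rewrite lee_fin; exact: F0. Qed.

Lemma le_dint F G : (forall z, modulus z < 1 -> 0 <= F z) ->
  (forall z, modulus z < 1 -> F z <= G z) -> (dint F <= dint G)%E.
Proof.
move=> F0 FG; apply: ge0_le_integral_subset => // u Du; rewrite lee_fin.
- exact: F0.
- exact: le_trans (F0 _ Du) (FG _ Du).
- exact: FG.
Qed.

Lemma eq_dint F G : (forall z, modulus z < 1 -> F z = G z) -> dint F = dint G.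
Proof. by move=> FG; apply: eq_integral => u; rewrite inE => Du; rewrite FG. Qed.

Lemma dintD F G : mdisc F -> mdisc G ->
  (forall z, modulus z < 1 -> 0 <= F z) -> (forall z, modulus z < 1 -> 0 <= G z) ->
  (dint (fun z => F z + G z)%R = dint F + dint G)%E.
Proof.
move=> mF mG F0 G0; rewrite /dint -ge0_integralD; try exact: mdisc_EFin.
- by apply: eq_integral => u _; rewrite EFinD.
- exact: measurable_disc2.
- by move=> u Du; rewrite lee_fin; exact: F0.
- by move=> u Du; rewrite lee_fin; exact: G0.
Qed.

Lemma dintZ (c : R) F : mdisc F -> 0 <= c -> (forall z, modulus z < 1 -> 0 <= F z) ->
  (dint (fun z => c * F z)%R = c%:E * dint F)%E.
Proof.
move=> mF c0 F0; rewrite /dint -ge0_integralZl//.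
- exact: measurable_disc2.
- exact: mdisc_EFin.
- by move=> u Du; rewrite lee_fin; exact: F0.
Qed.

Lemma le_dintZ (c : R) F G : mdisc G -> 0 <= c ->
  (forall z, modulus z < 1 -> 0 <= F z) -> (forall z, modulus z < 1 -> 0 <= G z) ->
  (forall z, modulus z < 1 -> F z <= c * G z) -> (dint F <= c%:E * dint G)%E.
Proof. by move=> mG c0 F0 G0 FG; rewrite -dintZ//; exact: le_dint. Qed.

Lemma dint_dominated_cvg0 (F : nat -> R[i] -> R) (G : R[i] -> R) :
  (forall n, mdisc (F n)) -> mdisc G ->
  (forall n z, modulus z < 1 -> 0 <= F n z <= G z) -> (dint G < +oo)%E ->
  (forall z, modulus z < 1 -> F ^~ z @ \oo --> (0 : R)) ->
  forall e : R, 0 < e -> exists n, (dint (F n) < e%:E)%E.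
Proof.
move=> mF mG FG Goo Fcvg e e0.
have iG : (lam \x lam)%E.-integrable (@disc2 R) (fun u => (G (u.1 +i* u.2))%:E).
  apply/integrableP; split; first exact: mdisc_EFin.
  apply: le_lt_trans Goo; apply: ge0_le_integral_subset => // u Du;
    have /andP[h1 h2] := FG 0%N _ Du; have G0 := le_trans h1 h2.
    by rewrite lee_fin.
  by rewrite /= lee_fin ger0_norm.
have [] := @dominated_convergence _ _ R (lam \x lam)%E (@disc2 R) (@measurable_disc2 R)
  (fun n u => (F n (u.1 +i* u.2))%:E) (cst 0%E) (fun u => (G (u.1 +i* u.2))%:E).
- by move=> n; exact: mdisc_EFin.
- exact: measurable_cst.
- by apply: aeW => /= u Du; apply: cvg_EFin; [exact: nearW|exact: Fcvg].
- exact: iG.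
- apply: aeW => /= u n Du; have /andP[h1 h2] := FG n _ Du.
  by rewrite lee_fin ger0_norm.
move=> _ _; rewrite integral0 => /fine_cvgP[Ffin /cvgrPdist_lt/(_ e e0) Fe].
have [n [h1 h2]] : exists n, (dint (F n) \is a fin_num) /\ `|0 - fine (dint (F n))| < e.
  near \oo => n; exists n; split; near: n; [exact: Ffin|exact: Fe].
exists n; rewrite -(fineK h1) lte_fin.
by apply: le_lt_trans h2; rewrite sub0r normrN ler_norm.
Unshelve. all: by end_near. Qed.

End DiscInt.

Section PowR.
Variable R : realType.
Variable p : R.
Hypothesis p1 : 1 <= p.
Let p0 : 0 < p. Proof. exact: lt_le_trans p1. Qed.

Lemma le_powR (x y : R) : 0 <= x -> x <= y -> x `^ p <= y `^ p.
Proof.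
by move=> x0 xy; apply: ge0_ler_powR; rewrite ?nnegrE ?(ltW p0)//; exact: le_trans xy.
Qed.

Lemma powR_le_self (x : R) : 0 <= x -> x <= 1 -> x `^ p <= x.
Proof.
rewrite le_eqVlt => /predU1P[<- _|x0 x1]; first by rewrite powR0// gt_eqF.
by apply: ge1r_powR => //; rewrite x0.
Qed.

(** The sum is at most twice the larger term. *)
Lemma powRD_le (x y : R) : 0 <= x -> 0 <= y ->
  (x + y) `^ p <= 2 `^ p * (x `^ p + y `^ p).
Proof.
move=> x0 y0; wlog xy : x y x0 y0 / x <= y.
  by move=> H; case: (leP x y) => [|/ltW] h; [exact: H|rewrite addrC [X in _ * X]addrC; exact: H].
apply: (@le_trans _ _ ((2 * y) `^ p)).
  by apply: le_powR; rewrite ?addr_ge0// mulr_natl mulr2n lerD2r.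
by rewrite powRM// ler_wpM2l ?powR_ge0// lerDr powR_ge0.
Qed.

Lemma powR_cvg (u : nat -> R) (l : R) : (forall n, 0 <= u n) ->
  u @ \oo --> l -> (fun n => u n `^ p) @ \oo --> l `^ p.
Proof.
move=> u0 ul; have l0 : 0 <= l.
  by apply: (cvgr_to_ge ul); exact: nearW.
move: l0; rewrite le_eqVlt => /predU1P[l0|l0].
  rewrite -l0 powR0 ?gt_eqF//; apply/cvgrPdist_lt => e e0.
  have /cvgrPdist_lt := ul; rewrite -l0.
  have m0 : 0 < Num.min 1 e by rewrite lt_min ltr01.
  move=> /(_ _ m0); apply: filterS => n.
  rewrite !sub0r !normrN !ger0_norm ?powR_ge0// lt_min => /andP[u1 ue].
  by apply: le_lt_trans ue; apply: powR_le_self => //; exact: ltW.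
apply: (cvg_comp _ (fun x => x `^ p) ul).
exact: powR_continuous_at.
Qed.

End PowR.

(** * The energy functional and its elementary inequalities *)

Section Energy.
Variable R : realType.
Local Notation lam := (@lebesgue_measure R).

Lemma dint_fatou (F : nat -> R[i] -> R) (G : R[i] -> R) (c : \bar R) :
  (forall n, mdisc (F n)) -> (forall n z, modulus z < 1 -> 0 <= F n z) ->
  (forall z, modulus z < 1 -> F ^~ z @ \oo --> G z) ->
  (forall n, (dint (F n) <= c)%E) -> (dint G <= c)%E.
Proof.
move=> mF F0 FG Fc.
have := @fatou _ _ R (lam \x lam)%E (@disc2 R) (@measurable_disc2 R)
  (fun n u => (F n (u.1 +i* u.2))%:E) (fun n => mdisc_EFin (mF n)) _.
move=> H; apply: (@le_trans _ _ (limn_einf (fun n => dint (F n)))).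
  apply: le_trans (H _); last by move=> n u Du; rewrite lee_fin; exact: F0.
  rewrite le_eqVlt; apply/predU1P; left; apply: eq_integral => u.
  rewrite inE => Du.
  have cv : (fun n => (F n (u.1 +i* u.2))%:E) @ \oo --> (G (u.1 +i* u.2))%:E.
    by apply: cvg_EFin; [exact: nearW|exact: FG].
  by rewrite (cvg_limn_einf_sup cv).
rewrite limn_einf_lim; apply: lime_le; first exact: is_cvg_einfs.
apply: nearW => n; apply: le_trans (Fc n).
by apply: ereal_inf_lbound; exists n => /=.
Qed.

Variable p : R.
Hypothesis p1 : 1 <= p.
Let p0 : 0 < p. Proof. exact: lt_le_trans p1. Qed.

(** This is [pi] times the [p]-th power of the Bergman norm; roots are taken only when the criterion
    is translated back to norms. *)
Definition energy (phi : R[i] -> R) f := dint (fun z => modulus (f z) `^ p * phi z).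

Variable phi : R[i] -> R.
Hypothesis mphi : mdisc phi.
Hypothesis phi0 : forall z, 0 <= phi z.

Lemma mdisc_energy f : analytic f -> mdisc (fun z => modulus (f z) `^ p * phi z).
Proof. by move=> fa; apply: mdiscM => //; apply: mdisc_powR; exact: mdisc_mod. Qed.

Lemma energy_ge0 f : (0 <= energy phi f)%E.
Proof. by apply: dint_ge0 => z _; rewrite mulr_ge0 ?powR_ge0. Qed.

Lemma eq_energy f h : (forall z, modulus z < 1 -> f z = h z) ->
  energy phi f = energy phi h.
Proof. by move=> fh; apply: eq_dint => z /fh ->. Qed.

Lemma energy_le f h (C : R) : analytic h -> 0 <= C ->
  (forall z, modulus z < 1 -> modulus (f z) <= C * modulus (h z)) ->
  (energy phi f <= (C `^ p)%:E * energy phi h)%E.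
Proof.
move=> ha C0 fh; apply: le_dintZ; rewrite ?powR_ge0//; first exact: mdisc_energy.
- by move=> z _; rewrite mulr_ge0 ?powR_ge0.
- by move=> z _; rewrite mulr_ge0 ?powR_ge0.
move=> z z1; rewrite mulrA ler_wpM2r// -powRM ?mod_ge0//.
by apply: le_powR => //; [exact: mod_ge0|exact: fh].
Qed.

Lemma energyD f h : analytic f -> analytic h ->
  (energy phi (fun z => f z + h z)%R <= (2 `^ p)%:E * (energy phi f + energy phi h))%E.
Proof.
move=> fa ha.
have nn k : forall z, modulus z < 1 -> 0 <= modulus (k z) `^ p * phi z.
  by move=> z _; rewrite mulr_ge0 ?powR_ge0.
have mf := mdisc_energy fa; have mh := mdisc_energy ha.
rewrite /energy -(dintD mf mh (nn f) (nn h)).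
rewrite -(dintZ (mdiscD mf mh) (powR_ge0 2 p)); last first.
  by move=> z z1; rewrite addr_ge0 ?nn.
apply: le_dint => [|z z1]; [exact: nn|rewrite -mulrDl mulrA ler_wpM2r//].
apply: le_trans (powRD_le p1 (mod_ge0 _) (mod_ge0 _)).
by apply: le_powR; [exact: p1|exact: mod_ge0|exact: modD].
Qed.

Lemma energy_dominated (f : nat -> R[i] -> R[i]) h (C : R) :
  (forall n, analytic (f n)) -> analytic h -> 0 <= C -> (energy phi h < +oo)%E ->
  (forall n z, modulus z < 1 -> modulus (f n z) <= C * modulus (h z)) ->
  (forall z, modulus z < 1 -> forall e : R, 0 < e -> exists N, forall n, (N <= n)%N ->
     modulus (f n z) < e) ->
  forall e : R, 0 < e -> exists n, (energy phi (f n) < e%:E)%E.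
Proof.
move=> fa ha C0 hoo fh f0 e e0.
have mG : mdisc (fun z => C `^ p * (modulus (h z) `^ p * phi z)).
  by apply: mdiscM; [exact: mdisc_cst|exact: mdisc_energy].
have H1 n z : modulus z < 1 -> 0 <= modulus (f n z) `^ p * phi z <=
    C `^ p * (modulus (h z) `^ p * phi z).
  move=> z1; rewrite mulr_ge0 ?powR_ge0//= mulrA ler_wpM2r// -powRM ?mod_ge0//.
  by apply: le_powR => //; [exact: mod_ge0|exact: fh].
have H2 : (dint (fun z => C `^ p * (modulus (h z) `^ p * phi z))%R < +oo)%E.
  rewrite dintZ ?powR_ge0//; last 2 first.
  - exact: mdisc_energy.
  - by move=> z _; rewrite mulr_ge0 ?powR_ge0.
  by apply: lte_mul_pinfty; rewrite ?lee_fin ?powR_ge0.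
have H3 z : modulus z < 1 -> (fun n => modulus (f n z) `^ p * phi z) @ \oo --> (0 : R).
  move=> z1; have E : 0 `^ p * phi z = 0 by rewrite powR0 ?gt_eqF// mul0r.
  rewrite -E; apply: cvgM; last exact: cvg_cst.
  apply: powR_cvg => [|n|]; [exact: p1|exact: mod_ge0|].
  apply/cvgrPdist_lt => k k0; have [N HN] := f0 z z1 k k0.
  exists N => // n /= /HN; by rewrite sub0r normrN ger0_norm ?mod_ge0.
exact: (dint_dominated_cvg0 (fun n => mdisc_energy (fa n)) mG H1 H2 H3 e0).
Qed.

End Energy.

(** * Convergence of dilates in the unweighted space *)

Section Dilation.
Variable R : realType.
Variable p : R.
Hypothesis p1 : 1 <= p.
Let p0 : 0 < p. Proof. exact: lt_le_trans p1. Qed.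

Let one : R[i] -> R := fun=> 1.

Lemma dilation_cvg f z : analytic f -> modulus z < 1 ->
  forall s : R, 0 <= s -> s <= 1 -> forall e : R, 0 < e ->
  exists N, forall n, (N <= n)%N ->
    modulus (f z - f ((1 - s / n.+1%:R)%:C * z)) < e.
Proof.
move=> fa z1 s s0 s1 e e0; have [l Hl] := analytic_cdiff fa z1.
have [d d0 Hd] := cdiff_cont Hl e0.
exists (Num.bound d^-1) => n nN; rewrite modB.
rewrite (_ : _ * z = z + - ((s / n.+1%:R)%:C * z)); last by rewrite rmorphB/=; ring.
apply: Hd; rewrite modN modM mod_real ger0_norm ?divr_ge0//.
apply: (@le_lt_trans _ _ (n.+1%:R^-1)).
  by rewrite -[leRHS]mulr1; apply: ler_pM; rewrite ?mod_ge0 ?divr_ge0 ?(ltW z1)// ler_piMl.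
rewrite -[ltRHS]invrK ltf_pV2 ?posrE ?invr_gt0//.
apply: lt_le_trans (archi_boundP _) _; first by rewrite invr_ge0 ltW.
by rewrite ler_nat (leq_trans nN).
Qed.

(** Radii tending to 1 whose Jacobian exceeds 1 by at most [4 * s] for all [n] at once. With
    [t = s / n.+1%:R] the excess reduces to [2 - 7 * t >= 0], which [s <= 4^-1] ensures. *)
Lemma dilation_radius (s : R) n : 0 < s -> s <= 4^-1 ->
  [/\ 0 < 1 - s / n.+1%:R, 1 - s / n.+1%:R < 1 & (1 - s / n.+1%:R) ^- 2 <= 1 + 4 * s].
Proof.
move=> s0 s4; have : 0 < s / n.+1%:R <= s.
  by rewrite divr_gt0//= ler_pdivrMr// ler_peMr ?(ltW s0)// ler1n.
move: (s / _) => t /andP[t0 ts]; split; try lra.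
rewrite -[leLHS]mul1r ler_pdivrMr; last by rewrite exprn_gt0//; lra.
have : 1 <= (1 + 4 * t) * (1 - t) ^+ 2.
  rewrite (_ : _ * _ = 1 + t * ((2 - 7 * t) + 4 * t ^+ 2)); last by ring.
  rewrite lerDl mulr_ge0 ?(ltW t0)// addr_ge0 ?mulr_ge0 ?sqr_ge0//; lra.
move=> /le_trans; apply; rewrite ler_wpM2r ?sqr_ge0//; lra.
Qed.

(** The excess [4 s P X] due to the Jacobian uses up at most half of [e]. *)
Lemma dilation_constants (P X s e : R) : 0 < P -> 0 <= X -> 0 < s ->
  s * (8 * P * (X + 1)) <= e -> P * ((1 + 4 * s) * X + X) - e <= P * (2 * X) - e / 2.
Proof.
move=> P0 X0 s0 se; have : 0 < s * P by rewrite mulr_gt0.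
have : 0 <= s * P * X by apply: mulr_ge0 => //; apply: ltW; exact: mulr_gt0.
lra.
Qed.

(* Fatou's lemma applied to [2^p (|f_rho|^p + |f|^p) - |f - f_rho|^p]. *)
Lemma energy_dilation f (e : R) : analytic f -> (energy p one f < +oo)%E -> 0 < e ->
  exists2 rho : R, 0 <= rho /\ rho < 1 &
    (energy p one (fun z => f z - f (rho%:C * z))%R < e%:E)%E.
Proof.
(* If every dilate stays at energy at least [e] from [f], the integrals in Fatou's lemma stay below
   [2 P X - e / 2], whereas the integral of their pointwise limit is [2 P X]. *)
move=> fa foo e0; apply: contrapT => H.
have {}H (rho : R) : 0 <= rho -> rho < 1 ->
    (e%:E <= energy p one (fun z => f z - f (rho%:C * z))%R)%E.
  by move=> h1 h2; rewrite leNgt; apply/negP => h3; apply: H; exists rho.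
have m1 : mdisc one by exact: mdisc_cst.
have one0 z : 0 <= one z by [].
have E0 := @energy_ge0 R p one one0 f.
have [X XE] : exists X : R, energy p one f = X%:E.
  by exists (fine (energy p one f)); rewrite fineK// ge0_fin_numE.
have X0 : 0 <= X by rewrite -lee_fin -XE.
pose P := 2 `^ p : R.
have P0 : 0 < P by rewrite powR_gt0.
have [s [s0 s4 se]] : exists s : R, [/\ 0 < s, s <= 4^-1 & s * (8 * P * (X + 1)) <= e].
  have D0 : 0 < 8 * P * (X + 1) by rewrite !mulr_gt0// ltr_wpDl.
  exists (Num.min 4^-1 (e / (8 * P * (X + 1)))); split.
  - by rewrite lt_min invr_gt0 ltr0n divr_gt0.
  - by rewrite ge_min lexx.
  - by rewrite -ler_pdivlMr// ge_min lexx orbT.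
have s1 : s <= 1 by apply: le_trans s4 _; rewrite invf_le1// ler1n.
pose rho n : R := 1 - s / n.+1%:R.
have rhoP n : [/\ 0 < rho n, rho n < 1 & rho n ^- 2 <= 1 + 4 * s] by exact: dilation_radius.
have rho0 n : 0 < rho n by have [] := rhoP n.
have rho1 n : rho n < 1 by have [] := rhoP n.
have rho2 n : rho n ^- 2 <= 1 + 4 * s by have [] := rhoP n.
pose fn n z := f ((rho n)%:C * z).
have fna n : analytic (fn n) by apply: analytic_scale => //; exact: ltW.
pose A n z := modulus (fn n z) `^ p + modulus (f z) `^ p.
pose B n z := modulus (f z - fn n z) `^ p.
pose G z := P * (2 * modulus (f z) `^ p).
have mf : mdisc (fun z => modulus (f z) `^ p) by apply: mdisc_powR; exact: mdisc_mod.
have mfn n : mdisc (fun z => modulus (fn n z) `^ p) := mdisc_powR p (mdisc_mod (fna n)).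
have mA n : mdisc (fun z => P * A n z) := mdiscM (mdisc_cst P) (mdiscD (mfn n) mf).
have mB n : mdisc (B n) := mdisc_powR p (mdisc_mod (analyticB fa (fna n))).
have A_ge0 n z : 0 <= P * A n z.
  by rewrite mulr_ge0 ?(ltW P0)// addr_ge0 ?powR_ge0.
have BA n z : B n z <= P * A n z.
  apply: le_trans (powRD_le p1 (mod_ge0 _) (mod_ge0 _)); apply: le_powR => //.
    exact: mod_ge0.
  by apply: le_trans (modD _ _) _; rewrite modN addrC.
have energyE h : energy p one h = dint (fun z => modulus (h z) `^ p).
  by apply: eq_dint => z _; rewrite /one mulr1.
have dfn n : (dint (fun z => modulus (fn n z) `^ p)%R <= ((1 + 4 * s) * X)%:E)%E.
  have := disc_dilation (F := fun z => modulus (f z) `^ p) (rho0 n) (ltW (rho1 n)) mf (fun z => powR_ge0 _ _).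
  rewrite -/(dint _) -/(dint (fun z => modulus (f z) `^ p)) -energyE XE => /le_trans; apply.
  by rewrite -EFinM lee_fin ler_wpM2r.
have dB n : (e%:E <= dint (B n))%E.
  by have := H _ (ltW (rho0 n)) (rho1 n); rewrite energyE.
have sumAB n : (dint (fun z => P * A n z - B n z)%R + dint (B n) = P%:E * dint (A n))%E.
  rewrite -dintD//; last 3 first.
  - exact: mdiscB.
  - by move=> z _; rewrite subr_ge0.
  - by move=> z _; rewrite powR_ge0.
  rewrite -dintZ ?(ltW P0)//; last 2 first.
  - exact: mdiscD.
  - by move=> z _; rewrite addr_ge0 ?powR_ge0.
  by apply: eq_dint => z _; rewrite subrK.
have dA n : (dint (A n) <= ((1 + 4 * s) * X + X)%:E)%E.
  rewrite dintD//; try (by move=> z _; rewrite powR_ge0).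
  by rewrite EFinD leeD// -energyE XE.
pose c := P * (2 * X) - e / 2.
have key n : (dint (fun z => P * A n z - B n z)%R <= c%:E)%E.
  have : (dint (fun z => P * A n z - B n z)%R + e%:E <= (P * ((1 + 4 * s) * X + X))%:E)%E.
    apply: (@le_trans _ _ (dint (fun z => P * A n z - B n z)%R + dint (B n))%E).
      by apply: leeD2l.
    by rewrite sumAB EFinM lee_wpmul2l// lee_fin ltW.
  rewrite -leeBrDr// => /le_trans; apply; rewrite -EFinB lee_fin /c.
  exact: dilation_constants.
have : (dint G <= c%:E)%E.
  apply: (dint_fatou (F := fun n z => P * A n z - B n z)) => //.
  - by move=> n; exact: mdiscB.
  - by move=> n z _; rewrite subr_ge0.
  move=> z z1; rewrite -[G z]subr0; apply: cvgB.
    apply: cvgMl_tmp; rewrite mulr_natl mulr2n; apply: cvgD; last exact: cvg_cst.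
    apply: powR_cvg => //; first by move=> n; exact: mod_ge0.
    apply/cvgrPdist_lt => k k0; have [N HN] := dilation_cvg fa z1 (ltW s0) s1 k0.
    exists N => // n /= /HN; apply: le_lt_trans; rewrite ler_norml modB_ge andbT lerNl opprB.
    by rewrite [leRHS]modB modB_ge.
  rewrite -[X in _ --> X](@powR0 _ p) ?gt_eqF//; apply: powR_cvg => //.
    by move=> n; exact: mod_ge0.
  apply/cvgrPdist_lt => k k0; have [N HN] := dilation_cvg fa z1 (ltW s0) s1 k0.
  by exists N => // n /= /HN; rewrite sub0r normrN ger0_norm ?mod_ge0.
rewrite /G dintZ ?(ltW P0)//; last 2 first.
- by apply: mdiscM => //; exact: mdisc_cst.
- by move=> z _; rewrite mulr_ge0 ?powR_ge0.
rewrite dintZ//; last by move=> z _; rewrite powR_ge0.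
rewrite -energyE XE -!EFinM lee_fin /c lerBrDr gerDl leNgt divr_gt0//.
Qed.

End Dilation.

(** * Estimates in the right half-plane *)

Section HalfPlane.
Variable R : realType.
Implicit Types (w : R[i]) (e : R).

Lemma Re_gt0_neq0 w : 0 < complex.Re w -> w != 0.
Proof. by move=> w0; apply/eqP => E; move: w0; rewrite E /= ltxx. Qed.

Lemma mod_shift_ge w e : 0 < complex.Re w -> 0 <= e ->
  modulus w <= modulus (e%:C + w).
Proof.
case: w => a b /= a0 e0; rewrite ler_wsqrtr// add0r lerD2r.
by rewrite lerXn2r ?nnegrE ?addr_ge0 ?(ltW a0)// lerDr.
Qed.

Lemma mod_shift_ge_shift w e : 0 < complex.Re w -> 0 <= e ->
  e <= modulus (e%:C + w).
Proof.
move=> w0 e0; apply: le_trans (Re_le _); rewrite raddfD /= ger0_norm ?addr_ge0 ?(ltW w0)//.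
by rewrite lerDl ltW.
Qed.

Lemma mod_1D_ge1 w e : 0 < complex.Re w -> 0 <= e -> 1 <= modulus (1 + e%:C * w).
Proof.
case: w => a b a0 e0; apply: le_trans (Re_le _).
have -> : complex.Re (1 + e%:C * (a +i* b)) = 1 + e * a by rewrite /=; ring.
by rewrite ger0_norm ?addr_ge0 ?mulr_ge0 ?(ltW a0)// lerDl mulr_ge0 ?(ltW a0).
Qed.

Lemma mod_1D_ge w e : 0 < complex.Re w -> 0 < e ->
  e * modulus w <= modulus (1 + e%:C * w).
Proof.
move=> w0 e0; have eC : (e%:C : R[i]) != 0 by rewrite -mod_gt0 mod_real normr_gt0 gt_eqF.
have -> : 1 + e%:C * w = e%:C * ((e^-1)%:C + w).
  by rewrite mulrDr -rmorphM/= divff ?gt_eqF// rmorph1.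
rewrite modM mod_real gtr0_norm// ler_pM2l//.
by apply: mod_shift_ge => //; rewrite invr_ge0 ltW.
Qed.

Variables p gamma : R.
Hypothesis p1 : 1 <= p.
Hypothesis gam : 0 < gamma < 1.
Let p0 : 0 < p. Proof. exact: lt_le_trans p1. Qed.
Let gam0 : 0 < gamma. Proof. by case/andP: gam. Qed.
Let gamp : gamma <= p. Proof. by case/andP: gam => _ /ltW /le_trans; apply. Qed.

Lemma powR_ge1 (x a : R) : 1 <= x -> 0 <= a -> 1 <= x `^ a.
Proof. by move=> x1 a0; have := ler_powR x1 a0; rewrite powRr0. Qed.

Lemma powR_le1 (x a : R) : 0 <= x -> x <= 1 -> 0 <= a -> x `^ a <= 1.
Proof.
move=> x0 x1 a0; have := ge0_ler_powR a0 _ _ x1; rewrite !nnegrE powR1; exact.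
Qed.

(** For [|w| <= 1] the quotient is at most [|w|], and [|w|^p <= |w|^gamma] as [gamma < p]. For
    [|w| > 1] the quotient is at most [1 / e] and [|w|^gamma] is at least 1. *)
Lemma bound_quotient w e : 0 < complex.Re w -> 0 < e -> e <= 1 ->
  (modulus (w / (1 + e%:C * w))) `^ p <= e^-1 `^ p * modulus w `^ gamma.
Proof.
move=> w0 e0 e1; have m0 : 0 < modulus w by rewrite mod_gt0 Re_gt0_neq0.
have d1 := mod_1D_ge1 w0 (ltW e0); have de := mod_1D_ge w0 e0.
have d0 : 0 < modulus (1 + e%:C * w) by exact: lt_le_trans d1.
have ei : 1 <= e^-1 by rewrite invf_ge1.
rewrite modM modV; have [mle|mge] := leP (modulus w) 1.
  apply: (@le_trans _ _ (modulus w `^ p)).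
    by apply: le_powR => //; rewrite ?divr_ge0 ?(ltW m0) ?(ltW d0)// ler_piMr ?(ltW m0)// invf_le1.
  apply: (@le_trans _ _ (modulus w `^ gamma)); first by apply: ger_powR; rewrite ?m0.
  by rewrite ler_peMl ?powR_ge0// powR_ge1 ?(ltW p0).
apply: (@le_trans _ _ (e^-1 `^ p)).
  apply: le_powR => //; first by rewrite divr_ge0 ?(ltW m0) ?(ltW d0).
  by rewrite ler_pdivrMr// mulrC ler_pdivlMr// mulrC.
by rewrite ler_peMr ?powR_ge0// powR_ge1 ?(ltW gam0)// ltW.
Qed.

(** For [|w| <= 1] use [|e + w| >= e]; for [|w| > 1] use [|e + w| >= |w|] together with
    [|w|^gamma <= |w|^p]. *)
Lemma bound_inverse w e : 0 < complex.Re w -> 0 < e -> e <= 1 ->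
  (modulus (e%:C + w)^-1) `^ p * modulus w `^ gamma <= e^-1 `^ p.
Proof.
move=> w0 e0 e1; have m0 : 0 < modulus w by rewrite mod_gt0 Re_gt0_neq0.
have d1 := mod_shift_ge w0 (ltW e0); have de := mod_shift_ge_shift w0 (ltW e0).
have d0 : 0 < modulus (e%:C + w) by exact: lt_le_trans d1.
have ei : 1 <= e^-1 by rewrite invf_ge1.
rewrite modV; have [mle|mge] := leP (modulus w) 1.
  apply: (@le_trans _ _ ((modulus (e%:C + w))^-1 `^ p)).
    by rewrite ler_piMr ?powR_ge0// powR_le1 ?(ltW m0) ?(ltW gam0).
  by apply: le_powR; rewrite ?invr_ge0 ?(ltW d0)// lef_pV2.
apply: (@le_trans _ _ 1); last by rewrite powR_ge1 ?(ltW p0).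
apply: (@le_trans _ _ ((modulus w)^-1 `^ p * modulus w `^ p)).
  apply: ler_pM; rewrite ?powR_ge0//.
    by apply: le_powR; rewrite ?invr_ge0 ?(ltW d0)// lef_pV2.
  by apply: ler_powR => //; exact: ltW.
by rewrite -powRM ?invr_ge0 ?(ltW m0)// mulVf ?gt_eqF// powR1.
Qed.

Lemma mod_regularizer_le1 w e : 0 < complex.Re w -> 0 < e ->
  modulus (w / (1 + e%:C * w) / (e%:C + w)) <= 1.
Proof.
move=> w0 e0.
have d1 := mod_1D_ge1 w0 (ltW e0); have d2 := mod_shift_ge w0 (ltW e0).
have m0 : 0 < modulus w by rewrite mod_gt0 Re_gt0_neq0.
have d0 : 0 < modulus (e%:C + w) by exact: lt_le_trans d2.
rewrite modM modV ler_pdivrMr// mul1r modM modV; apply: le_trans d2.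
by rewrite ler_piMr ?(ltW m0)// invf_le1// (lt_le_trans _ d1).
Qed.

(** The difference equals [e (1 + w^2 + e w) / ((1 + e w) (e + w))]; the regularizer thus tends to 1
    at each point at a linear rate in [e]. *)
Lemma mod_1B_regularizer w e : 0 < complex.Re w -> 0 < e -> e <= 1 ->
  modulus (1 - w / (1 + e%:C * w) / (e%:C + w)) <=
    e * ((1 + modulus w ^+ 2 + modulus w) / modulus w).
Proof.
move=> w0 e0 e1.
have d1 := mod_1D_ge1 w0 (ltW e0); have d2 := mod_shift_ge w0 (ltW e0).
have m0 : 0 < modulus w by rewrite mod_gt0 Re_gt0_neq0.
have d0 : 0 < modulus (e%:C + w) by exact: lt_le_trans d2.
have n1 : 1 + e%:C * w != 0 by rewrite -mod_gt0; exact: lt_le_trans d1.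
have n2 : e%:C + w != 0 by rewrite -mod_gt0.
have -> : 1 - w / (1 + e%:C * w) / (e%:C + w) =
    e%:C * (1 + w ^+ 2 + e%:C * w) / ((1 + e%:C * w) * (e%:C + w)).
  by field; rewrite n1 n2.
rewrite modM modV modM mod_real gtr0_norm// modM -mulrA ler_pM2l//.
apply: ler_pM; rewrite ?mod_ge0// ?invr_ge0 ?mulr_ge0 ?mod_ge0//.
  apply: le_trans (modD _ _) _; rewrite modM mod_real gtr0_norm//; apply: lerD.
    by apply: le_trans (modD _ _) _; rewrite mod1 modX.
  by rewrite ler_piMl ?(ltW m0).
rewrite lef_pV2 ?posrE ?mulr_gt0//; last exact: lt_le_trans d1.
by apply: le_trans d2 _; rewrite ler_peMl ?(ltW d0).
Qed.

End HalfPlane.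

(** * Density of polynomials in the weighted space *)

Section Density.
Variable R : realType.
Variables p gamma : R.
Hypothesis p1 : 1 <= p.
Hypothesis gam : 0 < gamma < 1.
Variable g : R[i] -> R[i].
Hypothesis ga : analytic g.
Hypothesis gRe : forall z, modulus z < 1 -> 0 < complex.Re (g z).
Let p0 : 0 < p. Proof. exact: lt_le_trans p1. Qed.

Definition weight (z : R[i]) : R := modulus (g z) `^ gamma.

Lemma mdisc_weight : mdisc weight.
Proof. exact: (mdisc_powR gamma (mdisc_mod ga)). Qed.

Lemma weight_ge0 z : 0 <= weight z.
Proof. exact: powR_ge0. Qed.

Local Notation E := (energy p weight).
Let mw := mdisc_weight.
Let w0 := weight_ge0.

Hypothesis E1 : (E (fun=> 1%R) < +oo)%E.

Definition approximable f := forall e : R, 0 < e ->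
  exists q : {poly R[i]}, (E (fun z => f z - q.[z])%R < e%:E)%E.

Lemma approximable_closed f : analytic f ->
  (forall e : R, 0 < e -> exists h, [/\ analytic h, approximable h &
     (E (fun z => f z - h z)%R < e%:E)%E]) ->
  approximable f.
Proof.
move=> fa H e e0.
have P0 : 0 < 2 `^ p :> R by rewrite powR_gt0.
have k0 : 0 < e / (2 * 2 `^ p) by rewrite divr_gt0// mulr_gt0.
have [h [ha hq fh]] := H _ k0; have [q hq'] := hq _ k0; exists q.
have -> : (fun z => f z - q.[z]) = (fun z => (f z - h z) + (h z - q.[z])).
  by apply/funext => z; rewrite subrKA.
apply: le_lt_trans (energyD p1 mw w0 (analyticB fa ha) (analyticB ha (analytic_horner (q:=q)))) _.
have -> : e%:E = ((2 `^ p)%:E * ((e / (2 * 2 `^ p))%:E + (e / (2 * 2 `^ p))%:E))%E.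
  by rewrite -EFinD -EFinM; congr EFin; field; rewrite gt_eqF.
rewrite lte_pmul2l; [|by []|by rewrite lte_fin].
exact: (lteD fh hq').
Qed.

Lemma energy_small (e : R) : 0 < e -> exists2 k : R, 0 < k &
  forall f, (forall z, modulus z < 1 -> modulus (f z) <= k) -> (E f < e%:E)%E.
Proof.
move=> e0.
have [x xE] : exists x : R, E (fun=> 1) = x%:E.
  by exists (fine (E (fun=> 1))); rewrite fineK// ge0_fin_numE// energy_ge0.
have x0 : 0 <= x by rewrite -lee_fin -xE energy_ge0.
pose k := Num.min 1 (e / (x + 1)).
have k0 : 0 < k by rewrite lt_min ltr01 divr_gt0// ltr_wpDl.
exists k => // f fk.
have H z : modulus z < 1 -> modulus (f z) <= k * modulus (1 : R[i]).
  by move=> z1; rewrite mod1 mulr1; exact: fk.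
apply: le_lt_trans (energy_le p1 mw w0 (analytic_cst (c := 1)) (ltW k0) H) _.
rewrite xE -EFinM lte_fin.
apply: (@le_lt_trans _ _ (k * x)).
  by rewrite ler_wpM2r// powR_le_self ?(ltW k0)// ge_min lexx.
apply: (@lt_le_trans _ _ (k * (x + 1))); first by rewrite ltr_pM2l// ltrDl.
by rewrite -ler_pdivlMr ?ltr_wpDl// ge_min lexx orbT.
Qed.

Section Regularized.
Variable eps : R.
Hypothesis eps0 : 0 < eps.
Hypothesis eps1 : eps <= 1.

(** Bounded by [1 / eps] because [g] has positive real part; its [p]-th power also compensates the
    growth of the weight. *)
Definition resolvent z := (eps%:C + g z)^-1.

Lemma resolvent_analytic : analytic resolvent.
Proof.
apply: (analyticV (analyticD (analytic_cst (c := eps%:C)) ga)) => z z1.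
rewrite -mod_gt0; apply: lt_le_trans (mod_shift_ge_shift (gRe z1) (ltW eps0)).
exact: eps0.
Qed.

Lemma resolvent_bound z : modulus z < 1 -> modulus (resolvent z) <= eps^-1.
Proof.
move=> z1; rewrite /resolvent modV lef_pV2 ?posrE//.
  exact: (mod_shift_ge_shift (gRe z1) (ltW eps0)).
exact: lt_le_trans eps0 (mod_shift_ge_shift (gRe z1) (ltW eps0)).
Qed.

Let ra := resolvent_analytic.

Lemma approximable_poly_dilated_resolvent (q : {poly R[i]}) (rho : R) : 0 <= rho -> rho < 1 ->
  approximable (fun z => q.[z] * resolvent (rho%:C * z)).
Proof.
move=> rho0 rho1 e e0; have [k k0 Hk] := energy_small e0.
have [M M0 qM] := horner_disc_bounded q.
have [r Hr] := analytic_dilation_poly_approx ra rho0 rho1 (divr_gt0 k0 M0).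
exists (q * r); have -> : (fun z => q.[z] * resolvent (rho%:C * z) - (q * r).[z]) =
    (fun z => q.[z] * (resolvent (rho%:C * z) - r.[z])).
  by apply/funext => z; rewrite hornerM mulrBr.
apply: Hk => z z1; rewrite modM -[k](divfK (lt0r_neq0 M0)) mulrC.
by apply: ler_pM; rewrite ?mod_ge0 ?qM// ltW// Hr.
Qed.

(** Dilates of the resolvent converge to it pointwise and share the bound [1 / eps]; as the weight
    is integrable, dominated convergence replaces uniform convergence. *)
Lemma approximable_poly_resolvent (q : {poly R[i]}) :
  approximable (fun z => q.[z] * resolvent z).
Proof.
have qa := analytic_horner (q := q).
apply: approximable_closed; first exact: (analyticM qa ra).
move=> e e0; have [M M0 qM] := horner_disc_bounded q.
have s01 n : 0 <= (1 - 1 / n.+1%:R : R) /\ (1 - 1 / n.+1%:R : R) < 1.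
  by rewrite subr_ge0 gtrBl divr_gt0// ler_pdivrMr// mul1r ler1n.
pose f n z := q.[z] * (resolvent z - resolvent ((1 - 1 / n.+1%:R)%:C * z)).
have sa n := analytic_scale (s01 n).1 (ltW (s01 n).2) ra.
have fa n : analytic (f n) := analyticM qa (analyticB ra (sa n)).
have C0 : 0 <= M * (eps^-1 + eps^-1) by rewrite mulr_ge0 ?addr_ge0 ?invr_ge0 ?ltW.
have fb n z : modulus z < 1 ->
    modulus (f n z) <= M * (eps^-1 + eps^-1) * modulus (1 : R[i]).
  move=> z1; rewrite mod1 mulr1 /f modM; apply: ler_pM; rewrite ?mod_ge0 ?qM//.
  apply: le_trans (modD _ _) _; rewrite modN; apply: lerD; first exact: resolvent_bound.
  by apply: resolvent_bound; exact: (mod_scale_lt1 (s01 n).1 (ltW (s01 n).2) z1).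
have fcvg z : modulus z < 1 -> forall k : R, 0 < k -> exists N, forall n, (N <= n)%N ->
    modulus (f n z) < k.
  move=> z1 k k0; have [N HN] := dilation_cvg ra z1 ler01 (lexx 1) (divr_gt0 k0 M0).
  exists N => n /HN H; rewrite /f modM -[k](divfK (lt0r_neq0 M0)) mulrC.
  apply: (@le_lt_trans _ _ (modulus (resolvent z - resolvent ((1 - 1 / n.+1%:R)%:C * z)) * M)).
    by rewrite ler_wpM2l ?mod_ge0 ?qM.
  by rewrite ltr_pM2r.
have [n Hn] := energy_dominated p1 mw w0 fa (analytic_cst (c := 1)) C0 E1 fb fcvg e0.
exists (fun z => q.[z] * resolvent ((1 - 1 / n.+1%:R)%:C * z)); split.
- exact: (analyticM qa (sa n)).
- by apply: approximable_poly_dilated_resolvent; have [] := s01 n.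
- rewrite (@eq_energy R p weight _ (f n)); first exact: Hn.
  by move=> z _; rewrite /f mulrBr.
Qed.

(** The dilate of [F] is a uniform limit of polynomials on the disc, and the bounded resolvent keeps
    the error uniformly small. *)
Lemma approximable_dilated_resolvent F (rho : R) : analytic F -> 0 <= rho -> rho < 1 ->
  approximable (fun z => F (rho%:C * z) * resolvent z).
Proof.
move=> Fa rho0 rho1; have sa := analytic_scale rho0 (ltW rho1) Fa.
apply: approximable_closed; first exact: (analyticM sa ra).
move=> e e0; have [k k0 Hk] := energy_small e0.
have [q Hq] := analytic_dilation_poly_approx Fa rho0 rho1 (mulr_gt0 k0 eps0).
exists (fun z => q.[z] * resolvent z); split.
  exact: (analyticM (analytic_horner (q := q)) ra).
  exact: approximable_poly_resolvent.
have -> : (fun z => F (rho%:C * z) * resolvent z - q.[z] * resolvent z) =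
    (fun z => (F (rho%:C * z) - q.[z]) * resolvent z).
  by apply/funext => z; rewrite mulrBl.
apply: Hk => z z1; rewrite modM -[k](mulfK (lt0r_neq0 eps0)).
by apply: ler_pM; rewrite ?mod_ge0 ?resolvent_bound// ltW// Hq.
Qed.

(** By [bound_inverse], multiplication by the resolvent is bounded from the unweighted to the
    weighted space, so it transports the convergence of dilates. *)
Lemma approximable_resolvent F : analytic F -> (energy p (fun=> 1%R) F < +oo)%E ->
  approximable (fun z => F z * resolvent z).
Proof.
move=> Fa Foo; apply: approximable_closed; first exact: (analyticM Fa ra).
move=> e e0; have K0 : 0 < eps^-1 `^ p by rewrite powR_gt0// invr_gt0.
have [rho [rho0 rho1] Hrho] := energy_dilation p1 Fa Foo (divr_gt0 e0 K0).
have sa := analytic_scale rho0 (ltW rho1) Fa.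
exists (fun z => F (rho%:C * z) * resolvent z); split; first exact: (analyticM sa ra).
  exact: approximable_dilated_resolvent.
have -> : (fun z => F z * resolvent z - F (rho%:C * z) * resolvent z) =
    (fun z => (F z - F (rho%:C * z)) * resolvent z).
  by apply/funext => z; rewrite mulrBl.
have ba := analyticB Fa sa.
have m1 : mdisc (fun=> 1 : R) := mdisc_cst 1.
apply: (@le_lt_trans _ _ ((eps^-1 `^ p)%:E * energy p (fun=> 1%R) (fun z => F z - F (rho%:C * z))%R)%E).
  apply: (le_dintZ (mdisc_energy p m1 ba) (ltW K0)) => z z1; rewrite ?mulr_ge0 ?powR_ge0//.
  rewrite mulr1 modM powRM ?mod_ge0// -mulrA mulrC ler_wpM2r ?powR_ge0//.
  exact: (bound_inverse p1 gam (gRe z1) eps0 eps1).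
have -> : e%:E = ((eps^-1 `^ p)%:E * (e / eps^-1 `^ p)%:E)%E.
  by rewrite -EFinM mulrC divfK// gt_eqF.
by rewrite lte_pmul2l ?lte_fin.
Qed.

End Regularized.

Lemma polynomials_dense h : analytic h -> (E h < +oo)%E -> approximable h.
Proof.
move=> ha hoo; apply: approximable_closed => // e e0.
pose eps n : R := n.+1%:R^-1.
have eps0 n : 0 < eps n by rewrite invr_gt0.
have eps1 n : eps n <= 1 by rewrite invf_le1// ler1n.
pose F n z := h z * (g z / (1 + (eps n)%:C * g z)).
have Fa n : analytic (F n).
  have da : analytic (fun z => 1 + (eps n)%:C * g z) :=
    analyticD (analytic_cst (c := 1)) (analyticM (analytic_cst (c := (eps n)%:C)) ga).
  apply: (analyticM ha (analyticM ga (analyticV da _))) => z z1.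
  rewrite -mod_gt0; apply: lt_le_trans (mod_1D_ge1 (gRe z1) (ltW (eps0 n))).
  exact: ltr01.
have FRa n : analytic (fun z => F n z * resolvent (eps n) z) :=
  analyticM (Fa n) (resolvent_analytic (eps0 n)).
pose f n z := h z - F n z * resolvent (eps n) z.
have fa n : analytic (f n) := analyticB ha (FRa n).
have fE n z : f n z = h z * (1 - g z / (1 + (eps n)%:C * g z) / ((eps n)%:C + g z)).
  by rewrite /f /F /resolvent mulrBr mulr1 !mulrA.
have fb n z : modulus z < 1 -> modulus (f n z) <= 2 * modulus (h z).
  move=> z1; rewrite fE modM mulrC ler_wpM2r ?mod_ge0//.
  apply: le_trans (modD _ _) _; rewrite mod1 modN.
  have := mod_regularizer_le1 (gRe z1) (eps0 n).
  by move: (modulus _) => x x1; rewrite -[2]/(1 + 1) lerD2l.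
have fcvg z : modulus z < 1 -> forall k : R, 0 < k -> exists N, forall n, (N <= n)%N ->
    modulus (f n z) < k.
  move=> z1 k k0.
  pose C := modulus (h z) * ((1 + modulus (g z) ^+ 2 + modulus (g z)) / modulus (g z)).
  have C0 : 0 <= C by rewrite mulr_ge0 ?divr_ge0 ?addr_ge0 ?exprn_ge0 ?mod_ge0.
  exists (Num.bound (C / k)) => n nN; rewrite fE modM.
  apply: (@le_lt_trans _ _ (eps n * C)).
    rewrite /C mulrCA ler_wpM2l ?mod_ge0//.
    exact: mod_1B_regularizer (gRe z1) (eps0 n) (eps1 n).
  rewrite mulrC ltr_pdivrMr// mulrC -ltr_pdivrMr//.
  apply: lt_le_trans (archi_boundP (divr_ge0 C0 (ltW k0))) _.
  by rewrite ler_nat (leq_trans nN).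
have two0 : 0 <= 2 :> R by [].
have [n Hn] := energy_dominated p1 mw w0 fa ha two0 hoo fb fcvg e0.
exists (fun z => F n z * resolvent (eps n) z); split; [exact: FRa| |exact: Hn].
apply: (approximable_resolvent (eps0 n) (eps1 n) (Fa n)).
have K0 : 0 < (eps n)^-1 `^ p by rewrite powR_gt0// invr_gt0.
(* By [bound_quotient], [|F n|^p <= eps^-p |h|^p phi]: this puts [F n] into the unweighted space. *)
apply: (@le_lt_trans _ _ (((eps n)^-1 `^ p)%:E * E h)%E); last first.
  by apply: lte_mul_pinfty; rewrite ?lee_fin ?(ltW K0).
apply: (le_dintZ (mdisc_energy p mw ha) (ltW K0)) => z z1; rewrite ?mulr_ge0 ?powR_ge0//.
rewrite mulr1 /F modM powRM ?mod_ge0// mulrCA ler_wpM2l ?powR_ge0//.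
exact: (bound_quotient p1 gam (gRe z1) (eps0 n) (eps1 n)).
Qed.

End Density.

(** * Power series *)

Section PowerSeries.
Variable R : realType.
Implicit Types (a b : nat -> R[i]) (f : R[i] -> R[i]) (z : R[i]).

Definition psum a z n : R[i] := \sum_(k < n) a k * z ^+ k.

Lemma power_seriesE a z n : power_series a z n = psum a z n.
Proof. by rewrite /power_series /series /= big_mkord. Qed.

Definition converges a z (l : R[i]) := forall e : R, 0 < e -> exists N, forall n,
  (N <= n)%N -> modulus (psum a z n - l) < e.

Lemma expansionP a f : expansion a f <->
  forall z, modulus z < 1 -> converges a z (f z).
Proof.
split=> H z z1.
  by move=> e e0; have [N HN] := (cvg_modP _ _).1 (H z z1) e e0;
    exists N => n /HN; rewrite power_seriesE.
apply/cvg_modP => e e0; have [N HN] := H z z1 e e0; exists N => n /HN.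
by rewrite power_seriesE.
Qed.

Lemma converges_unique a z l m : converges a z l -> converges a z m -> l = m.
Proof.
move=> al am; apply/eqP; rewrite -subr_eq0 -mod_eq0; apply/negPn/negP => D0.
have Dp : 0 < modulus (l - m) by rewrite lt_def D0 mod_ge0.
have D2 : 0 < modulus (l - m) / 2 by rewrite divr_gt0.
have [N HN] := al _ D2; have [M HM] := am _ D2.
have := HN _ (leq_maxl N M); have := HM _ (leq_maxr N M).
move: (psum _ _ _) => x h1 h2; rewrite modB in h2.
have : modulus (l - m) < modulus (l - m).
  have E : l - m = (l - x) + (x - m) by ring.
  rewrite {1}E [ltRHS]splitr; apply: le_lt_trans (modD _ _) _; exact: ltrD.
by rewrite ltxx.
Qed.

Lemma psumB a b z n : psum (fun k => a k - b k) z n = psum a z n - psum b z n.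
Proof. by rewrite /psum -sumrB; apply: eq_bigr => k _; rewrite mulrBl. Qed.

Lemma convergesB a b z l m : converges a z l -> converges b z m ->
  converges (fun k => a k - b k) z (l - m).
Proof.
move=> al bm e e0; have e2 : 0 < e / 2 by rewrite divr_gt0.
have [N HN] := al _ e2; have [M HM] := bm _ e2.
exists (maxn N M) => n; rewrite geq_max => /andP[/HN h1 /HM h2].
have -> : psum (fun k => a k - b k) z n - (l - m) = (psum a z n - l) - (psum b z n - m).
  by rewrite psumB; ring.
apply: le_lt_trans (modD _ _) _; rewrite modN [ltRHS]splitr; exact: ltrD.
Qed.

Lemma expansionB a b f h : expansion a f -> expansion b h ->
  expansion (fun k => a k - b k) (fun z => f z - h z).
Proof.
move=> /expansionP af /expansionP bh; apply/expansionP => z z1.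
exact: convergesB (af z z1) (bh z z1).
Qed.

Lemma expansion_at0 a f : expansion a f -> f 0 = a 0%N.
Proof.
move=> /expansionP af; have c0 : modulus (0 : R[i]) < 1 by rewrite mod0.
apply: (converges_unique (af 0 c0)) => e e0; exists 1%N => -[//|n] _.
rewrite /psum big_ord_recl expr0 mulr1 big1 ?addr0 ?subrr ?mod0// => k _.
by rewrite /= exprS mul0r mulr0.
Qed.

Lemma expansion_poly (q : {poly R[i]}) : expansion (fun n => q`_n) (fun z => q.[z]).
Proof.
apply/expansionP => z z1 e e0; exists (size q) => n nq.
rewrite /psum (horner_coef_wide _ nq) subrr mod0//.
Qed.

(** Equivalent to a radius of convergence of at least 1, in a form stable under shifts and under
    multiplication by the index. *)
Definition subexp a := forall r : R, 0 < r -> r < 1 ->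
  exists2 M, 0 < M & forall n, modulus (a n) * r ^+ n <= M.

Lemma converges_bounded a z l : converges a z l ->
  exists2 M : R, 0 < M & forall n, modulus (a n * z ^+ n) <= M.
Proof.
move=> al; have [N HN] := al 1 ltr01.
exists (2 + \sum_(k < N) modulus (a k * z ^+ k)).
  by rewrite ltr_wpDr// sumr_ge0// => k _; exact: mod_ge0.
move=> n; have [nN|Nn] := ltnP n N.
  rewrite -[n]/(nat_of_ord (Ordinal nN)).
  rewrite (bigD1 (Ordinal nN))//= addrCA lerDl addr_ge0//.
  by rewrite sumr_ge0// => k _; exact: mod_ge0.
have h1 := HN n Nn; have h2 := HN n.+1 (leqW Nn).
have E : a n * z ^+ n = (psum a z n.+1 - l) - (psum a z n - l).
  by rewrite /psum big_ord_recr/=; ring.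
rewrite E; apply: le_trans (modD _ _) _; rewrite modN.
have : 0 <= \sum_(k < N) modulus (a k * z ^+ k).
  by rewrite sumr_ge0// => k _; exact: mod_ge0.
by move: h1 h2; lra.
Qed.

Lemma expansion_subexp a f : expansion a f -> subexp a.
Proof.
move=> /expansionP af r r0 r1.
have rm : modulus (r%:C : R[i]) = r by rewrite mod_real ger0_norm// ltW.
have [|M M0 HM] := @converges_bounded a r%:C (f r%:C); first by apply: af; rewrite rm.
by exists M => // n; have := HM n; rewrite modM modX rm.
Qed.

Lemma geometric_le (q : R) n : 0 <= q -> q < 1 -> \sum_(k < n) q ^+ k <= (1 - q)^-1.
Proof.
move=> q0 q1; have d0 : 0 < 1 - q by rewrite subr_gt0.
rewrite -[leRHS]mul1r ler_pdivlMr// mulrC -opprB mulNr -subrX1 opprB.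
by rewrite gerBl exprn_ge0.
Qed.

(** Each of the [n] terms of the geometric sum is at least [x ^+ n]. *)
Lemma natr_mul_expr_le (x : R) n : 0 <= x -> x < 1 -> n%:R * x ^+ n <= (1 - x)^-1.
Proof.
move=> x0 x1; apply: le_trans (geometric_le n x0 x1).
rewrite mulr_natl -[X in _ *+ X]card_ord -sumr_const; apply: ler_sum => k _.
by apply: ler_wiXn2l => //; [exact: ltW|exact: ltnW].
Qed.

(** Passing from [r] to a larger radius [s] leaves a factor [(r / s) ^+ n] that absorbs the
    index. *)
Lemma subexp_natr a : subexp a -> subexp (fun n => n%:R * a n).
Proof.
move=> Ha r r0 r1; pose s := (1 + r) / 2.
have s0 : 0 < s by rewrite /s; lra.
have s1 : s < 1 by rewrite /s; lra.
have rs : r < s by rewrite /s; lra.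
have [M M0 HM] := Ha s s0 s1.
have q0 : 0 <= r / s by rewrite divr_ge0// ltW.
have q1 : r / s < 1 by rewrite ltr_pdivrMr// mul1r.
exists ((1 - r / s)^-1 * M); first by rewrite mulr_gt0// invr_gt0 subr_gt0.
move=> n; have -> : modulus (n%:R * a n) * r ^+ n = (n%:R * (r / s) ^+ n) * (modulus (a n) * s ^+ n).
  have -> : (n%:R : R[i]) = (n%:R : R)%:C by rewrite rmorph_nat.
  rewrite modM mod_real ger0_norm// expr_div_n; field.
  by rewrite expf_neq0 ?gt_eqF.
apply: ler_pM => //; first by rewrite mulr_ge0// exprn_ge0.
  by rewrite mulr_ge0 ?mod_ge0// exprn_ge0// ltW.
exact: natr_mul_expr_le.
Qed.

Lemma subexp_sum a (s : R) : subexp a -> 0 <= s -> s < 1 ->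
  exists2 K, 0 < K & forall n, \sum_(k < n) modulus (a k) * s ^+ k <= K.
Proof.
move=> Ha s0 s1; pose r := (1 + s) / 2.
have r0 : 0 < r by rewrite /r; lra.
have r1 : r < 1 by rewrite /r; lra.
have sr : s < r by rewrite /r; lra.
have [M M0 HM] := Ha r r0 r1.
have q0 : 0 <= s / r by rewrite divr_ge0// ltW.
have q1 : s / r < 1 by rewrite ltr_pdivrMr// mul1r.
exists (M * (1 - s / r)^-1); first by rewrite mulr_gt0// invr_gt0 subr_gt0.
move=> n; apply: (@le_trans _ _ (M * \sum_(k < n) (s / r) ^+ k)); last first.
  by rewrite ler_pM2l// geometric_le.
rewrite mulr_sumr; apply: ler_sum => k _.
have -> : modulus (a k) * s ^+ k = modulus (a k) * r ^+ k * (s / r) ^+ k.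
  by rewrite -mulrA -exprMn [r * _]mulrC divfK// gt_eqF.
by rewrite ler_wpM2r ?exprn_ge0.
Qed.

Lemma subexp_converges a z : subexp a -> modulus z < 1 -> exists l, converges a z l.
Proof.
move=> Ha z1; have [K K0 HK] := subexp_sum Ha (mod_ge0 z) z1.
pose v k := a k * z ^+ k.
have ncv (u : nat -> R) : (forall k, `|u k| <= modulus (v k)) -> cvgn (series u).
  move=> uv; apply: normed_cvg; apply: nondecreasing_is_cvgn.
    by apply: nondecreasing_series => *; exact: normr_ge0.
  exists K => _ [n _ <-]; apply: le_trans (HK n).
  rewrite [leLHS](_ : _ = \sum_(k < n) `|u k|); last first.
    by rewrite /normed_series_of /series /= big_mkord.
  apply: ler_sum => k _; apply: le_trans (uv k) _.
  by rewrite /v modM modX.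
have cR := ncv (fun k => complex.Re (v k)) (fun k => Re_le _).
have cI := ncv (fun k => complex.Im (v k)) (fun k => Im_le _).
exists (limn (series (fun k => complex.Re (v k))) +i* limn (series (fun k => complex.Im (v k)))).
move=> e e0; have e2 : 0 < e / 2 by rewrite divr_gt0.
have /cvgrPdist_lt/(_ _ e2)[N _ HN] := cR; have /cvgrPdist_lt/(_ _ e2)[M _ HM] := cI.
exists (maxn N M) => n; rewrite geq_max => /andP[/HN /= h1 /HM /= h2].
have RE : complex.Re (psum a z n) = series (fun k => complex.Re (v k)) n.
  by rewrite /psum raddf_sum /series /= big_mkord.
have IE : complex.Im (psum a z n) = series (fun k => complex.Im (v k)) n.
  by rewrite /psum raddf_sum /series /= big_mkord.
apply: le_lt_trans (mod_le _) _; rewrite !raddfB /= RE IE [ltRHS]splitr.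
by apply: ltrD; rewrite distrC.
Qed.

(** The second-order remainder [T] satisfies the recursion [(z + h) T + n z^(n-1) h^2], and
    [n^2 + n <= (n + 1)^2]. Multiplying by [s ^+ 2] avoids the exponent [n - 2]. *)
Lemma exprD_taylor z h (s : R) n : 0 <= s -> modulus z <= s -> modulus (z + h) <= s ->
  modulus ((z + h) ^+ n - z ^+ n - n%:R * z ^+ n.-1 * h) * s ^+ 2 <=
    n%:R ^+ 2 * s ^+ n * modulus h ^+ 2.
Proof.
move=> s0 zs zhs; elim: n => [|n IH].
  by rewrite !expr0 subrr !mul0r subr0 mod0 mul0r expr0n/= !mul0r.
set T := _ - _ - _ in IH.
have -> : (z + h) ^+ n.+1 - z ^+ n.+1 - n.+1%:R * z ^+ n.+1.-1 * h =
    (z + h) * T + n%:R * z ^+ n.-1 * h ^+ 2.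
  rewrite /T /= -natr1; case: n {IH T} => [|n] /=; first by ring.
  by rewrite !exprS; ring.
have h0 := mod_ge0 h.
have t1 : modulus ((z + h) * T) * s ^+ 2 <= n%:R ^+ 2 * s ^+ n.+1 * modulus h ^+ 2.
  rewrite modM -mulrA [leRHS](_ : _ = s * (n%:R ^+ 2 * s ^+ n * modulus h ^+ 2)).
    2: by rewrite [s ^+ n.+1]exprS; ring.
  by apply: ler_pM; rewrite ?mod_ge0 ?mulr_ge0 ?mod_ge0 ?exprn_ge0.
have t2 : modulus (n%:R * z ^+ n.-1 * h ^+ 2) * s ^+ 2 <= n%:R * s ^+ n.+1 * modulus h ^+ 2.
  have -> : (n%:R : R[i]) = (n%:R : R)%:C by rewrite rmorph_nat.
  rewrite 2!modM 2!modX mod_real ger0_norm//.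
  case: n {IH T t1} => [|n] /=; first by rewrite !mul0r.
  rewrite mulrAC ler_wpM2r ?exprn_ge0// -mulrA ler_wpM2l// -[n.+2]addn2 exprD.
  by rewrite ler_wpM2r ?exprn_ge0// lerXn2r ?nnegrE ?mod_ge0.
apply: (@le_trans _ _ ((n%:R ^+ 2 * s ^+ n.+1 * modulus h ^+ 2) + n%:R * s ^+ n.+1 * modulus h ^+ 2)).
  apply: le_trans (lerD t1 t2); rewrite -mulrDl ler_wpM2r ?exprn_ge0//; exact: modD.
rewrite -mulrDl ler_wpM2r ?exprn_ge0// -mulrDl ler_wpM2r ?exprn_ge0//.
by rewrite -natr1 sqrrD expr1n mulr1 -addrA lerD2l mulr2n; have : 0 <= n%:R :> R by []; lra.
Qed.

Lemma subexp_shift a : subexp a -> subexp (fun n => a n.+1).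
Proof.
move=> Ha r r0 r1; have [M M0 HM] := Ha r r0 r1.
exists (M / r); first by rewrite divr_gt0.
by move=> n; rewrite ler_pdivlMr// -mulrA -exprSr.
Qed.

(** Partial sums have a quadratic Taylor remainder with a constant [K] independent of their length;
    letting the length grow gives the same bound for the sum. *)
Lemma expansion_analytic a f : subexp a -> expansion a f -> analytic f.
Proof.
move=> Ha /expansionP af; apply: analyticP => z z1.
pose b n := n.+1%:R * a n.+1.
have Hb : subexp b := subexp_shift (subexp_natr Ha).
have [l Hl] := subexp_converges Hb z1; exists l.
pose s := (1 + modulus z) / 2.
have m0 := mod_ge0 z.
have s0 : 0 < s by rewrite /s; lra.
have s1 : s < 1 by rewrite /s; lra.
have zs : modulus z < s by rewrite /s; lra.
have [K K0 HK] := subexp_sum (subexp_natr (subexp_natr Ha)) (ltW s0) s1.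
move=> e e0.
exists (Num.min (s - modulus z) (e * s ^+ 2 / K)).
  by rewrite lt_min subr_gt0 zs divr_gt0// mulr_gt0// exprn_gt0.
move=> h; rewrite lt_min => /andP[h1 h2].
have zhs : modulus (z + h) <= s by apply: le_trans (modD _ _) _; move: h1; lra.
have zh1 : modulus (z + h) < 1 by exact: le_lt_trans s1.
have h0 := mod_ge0 h.
suff main : modulus (f (z + h) - f z - l * h) * s ^+ 2 <= K * modulus h ^+ 2.
  rewrite -(ler_pM2r (exprn_gt0 2 s0)); apply: le_trans main _.
  rewrite [modulus h ^+ 2]expr2 mulrA [leRHS]mulrAC ler_wpM2r//.
  by rewrite mulrC -ler_pdivlMr// ltW.
apply/ler_addgt0Pr => k k0.
(* Replacing [f (z + h)], [f z] and [l] by partial sums costs at most [k' + k' + k' * modulus h]. *)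
pose k' := k / (3 * (1 + modulus h)).
have k'0 : 0 < k' by rewrite divr_gt0// mulr_gt0// ltr_wpDr.
have [N1 H1] := af _ zh1 _ k'0; have [N2 H2] := af _ z1 _ k'0; have [N3 H3] := Hl _ k'0.
pose N := maxn (maxn N1 N2) N3.
have {}H1 : modulus (psum a (z + h) N.+1 - f (z + h)) < k'.
  by apply: H1; rewrite leqW// /N !leq_max leqnn.
have {}H2 : modulus (psum a z N.+1 - f z) < k'.
  by apply: H2; rewrite leqW// /N !leq_max leqnn orbT.
have {}H3 : modulus (psum b z N - l) < k' by apply: H3; rewrite /N leq_max leqnn orbT.
have T : modulus (psum a (z + h) N.+1 - psum a z N.+1 - psum b z N * h) * s ^+ 2 <= K * modulus h ^+ 2.
  have -> : psum a (z + h) N.+1 - psum a z N.+1 - psum b z N * h =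
      \sum_(n < N.+1) a n * ((z + h) ^+ n - z ^+ n - n%:R * z ^+ n.-1 * h).
    have -> : psum b z N = \sum_(n < N.+1) a n * (n%:R * z ^+ n.-1).
      rewrite big_ord_recl mul0r mulr0 add0r; apply: eq_bigr => n _.
      by rewrite /b /bump /= mulrA [_ * a _]mulrC.
    rewrite mulr_suml /psum -!sumrB; apply: eq_bigr => n _.
    by rewrite !mulrBr !mulrA.
  apply: le_trans (ler_wpM2r (sqr_ge0 s) (mod_sum _ (fun n => a n * ((z + h) ^+ n - z ^+ n - n%:R * z ^+ n.-1 * h)))) _.
  rewrite mulr_suml; apply: le_trans (ler_wpM2r (sqr_ge0 _) (HK N.+1)).
  rewrite mulr_suml; apply: ler_sum => n _.
  have -> : (n%:R * (n%:R * a n)) = ((n%:R ^+ 2 : R)%:C * a n).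
    by rewrite rmorphXn/= rmorph_nat expr2 mulrA.
  rewrite !modM mod_real ger0_norm ?sqr_ge0// -[modulus (a n) * _ * _]mulrA.
  rewrite [leRHS](_ : _ = modulus (a n) * (n%:R ^+ 2 * s ^+ n * modulus h ^+ 2)); last by ring.
  rewrite ler_wpM2l ?mod_ge0//; apply: exprD_taylor => //; exact: ltW.
have s2 : s ^+ 2 <= 1 by rewrite exprn_ile1// ltW.
have E : f (z + h) - f z - l * h = (psum a (z + h) N.+1 - psum a z N.+1 - psum b z N * h)
   - ((psum a (z + h) N.+1 - f (z + h)) - (psum a z N.+1 - f z) - (psum b z N - l) * h).
  by ring.
rewrite E; apply: le_trans (ler_wpM2r (sqr_ge0 s) (modD _ _)) _.
rewrite mulrDl; apply: lerD => //; rewrite modN.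
apply: (@le_trans _ _ (k' * (3 * (1 + modulus h)))); last first.
  by rewrite divfK// gt_eqF// mulr_gt0// ltr_wpDr.
set X := modulus _; have : X <= k' + k' + k' * modulus h.
  rewrite /X; apply: le_trans (modD _ _) _; rewrite modN modM; apply: lerD; last first.
    by rewrite ler_wpM2r// ltW.
  by apply: le_trans (modD _ _) _; rewrite modN lerD// ltW.
have X0 : 0 <= X by exact: mod_ge0.
have : X * s ^+ 2 <= X by rewrite ler_piMr.
have : 0 <= k' * modulus h by rewrite mulr_ge0// ltW.
lra.
Qed.

Lemma subexp_sum_function a : subexp a -> exists2 f, analytic f & expansion a f.
Proof.
move=> Ha; pose f z := xget 0 [set l | converges a z l].
have af : expansion a f.
  apply/expansionP => z z1; have [l Hl] := subexp_converges Ha z1.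
  exact: (xgetPex 0 (ex_intro _ l Hl)).
by exists f; [exact: (expansion_analytic Ha af)|exact: af].
Qed.

(* Divide by [z]: the quotient vanishes off the origin, hence by continuity
   also at the origin. *)
Lemma expansion0_coef a : expansion a (fun=> 0) -> forall n, a n = 0.
Proof.
move=> aH n; elim: n a aH => [|n IH] a aH; first by rewrite -(expansion_at0 aH).
have [F Fa FE] := subexp_sum_function (subexp_shift (expansion_subexp aH)).
have F0 z : z != 0 -> modulus z < 1 -> F z = 0.
  move=> z0 z1; have zF : converges a z (z * F z).
    move=> e e0; have [N HN] := (expansionP _ _).1 FE z z1 e e0.
    exists N.+1 => -[//|k] Nk; rewrite /psum big_ord_recl -(expansion_at0 aH) mul0r add0r.
    rewrite (_ : \sum_(i < k) _ = z * psum (fun n => a n.+1) z k); last first.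
      by rewrite mulr_sumr; apply: eq_bigr => i _; rewrite /bump /= exprS mulrCA.
    rewrite -mulrBr modM; apply: le_lt_trans (HN k Nk).
    by rewrite ler_piMl ?mod_ge0// ltW.
  have := converges_unique zF ((expansionP _ _).1 aH z z1).
  by move/eqP; rewrite mulf_eq0 (negbTE z0) => /eqP.
have z1 : modulus (0 : R[i]) < 1 by rewrite mod0.
have F00 : F 0 = 0.
  have [l Hl] := analytic_cdiff Fa z1.
  apply/eqP; rewrite -mod_eq0; apply/negPn/negP => D0.
  have [|d d0 Hd] := cdiff_cont Hl (e := modulus (F 0)); first by rewrite lt_def D0 mod_ge0.
  pose x := Num.min (d / 2) 2^-1; have x0 : 0 < x by rewrite lt_min divr_gt0//= invr_gt0.
  have xm : modulus (x%:C : R[i]) = x by rewrite mod_real gtr0_norm.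
  have xd : x < d by rewrite gt_min; apply/orP; left; rewrite ltr_pdivrMr// ltr_pMr// ltr1n.
  have := Hd x%:C; rewrite xm => /(_ xd); rewrite add0r F0 ?sub0r ?modN ?ltxx//.
    by rewrite -mod_gt0 xm.
  by rewrite xm gt_min invf_lt1 ?ltr1n ?orbT.
apply: (IH (fun n => a n.+1)); apply/expansionP => z zd.
have := (expansionP _ _).1 FE z zd; have [->|z0] := eqVneq z 0; first by rewrite F00.
by rewrite F0.
Qed.

Lemma expansion_unique a b f : expansion a f -> expansion b f -> a = b.
Proof.
move=> af bf; apply/funext => n; apply/eqP; rewrite -subr_eq0; apply/eqP.
apply: (expansion0_coef (a := fun k => a k - b k)); apply/expansionP => z z1.
by have /expansionP/(_ z z1) := expansionB af bf; rewrite subrr.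
Qed.

(** Uniqueness of coefficients determines the choice hidden in [taylor]. *)
Lemma taylor_expansion a f : expansion a f -> taylor f = a.
Proof.
move=> af; apply: (expansion_unique _ af).
exact: (xgetPex (fun=> 0) (ex_intro (fun b => expansion b f) a af)).
Qed.

End PowerSeries.

(** * Construction of a hypercyclic vector *)

Section DiscArea.
Variable R : realType.
Local Notation lam := (@lebesgue_measure R).

Lemma product_lebesgue_box (a b c d : R) : a <= b -> c <= d ->
  (lam \x lam)%E (`]a, b[ `*` `]c, d[) = ((b - a) * (d - c))%:E.
Proof.
move=> ab cd; rewrite product_measure1E; [|exact: measurable_itv|exact: measurable_itv].
have H (x y : R) : x <= y -> lam `]x, y[%classic = (y - x)%:E.
  rewrite lebesgue_measure_itv/= lte_fin le_eqVlt => /predU1P[->|->//].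
  by rewrite ltxx subrr.
by rewrite EFinM -(H a b ab) -(H c d cd).
Qed.

Lemma dint_cst_lty (k : R) : 0 <= k -> (dint (fun=> k) < +oo)%E.
Proof.
move=> k0; rewrite /dint integral_cst; last exact: measurable_disc2.
apply: lte_mul_pinfty; rewrite ?lee_fin//.
apply: (@le_lt_trans _ _ ((lam \x lam)%E (`]-1, 1[ `*` `]-1, 1[))).
  apply: le_measure; rewrite ?inE.
  - exact: measurable_disc2.
  - by apply: measurableX; exact: measurable_itv.
  - move=> [x y] /= xy; rewrite !in_itv /= -!ltr_norml.
    by split; apply: le_lt_trans xy; [exact: (Re_le (x +i* y))|exact: (Im_le (x +i* y))].
rewrite product_lebesgue_box ?ltry//; lra.
Qed.

(** Bounding the integral below on a small square inside the annulus avoids computing the area of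
    the annulus. *)
Lemma dint_annulus_ge (rho : R) : 0 < rho -> rho < 1 -> exists2 c : R, 0 < c &
  forall (F : R[i] -> R) (k : R), (forall z, modulus z < 1 -> 0 <= F z) -> 0 <= k ->
    (forall z, rho < modulus z -> modulus z < (1 + rho) / 2 -> k <= F z) ->
    ((k * c)%:E <= dint F)%E.
Proof.
(* The square has side [d] and lower left corner [rho]; its points have modulus below
   [rho + 2 * d = rho + (1 - rho) / 4]. *)
move=> r0 r1; pose d := (1 - rho) / 8.
have d0 : 0 < d by rewrite /d; lra.
exists (d * d); first exact: mulr_gt0.
move=> F k F0 k0 kF.
pose A : set (R * R) := `]rho, (rho + d)[ `*` `]0, d[.
have mA : measurable A by apply: measurableX; exact: measurable_itv.
have Abd u : A u -> rho < modulus (u.1 +i* u.2) /\ modulus (u.1 +i* u.2) < (1 + rho) / 2.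
  case: u => x y; rewrite /A /setX /= !in_itv /= => -[/andP[x1 x2] /andP[y1 y2]].
  change (rho < modulus (x +i* y) /\ modulus (x +i* y) < (1 + rho) / 2); split.
    apply: lt_le_trans (Re_le (x +i* y)); rewrite /= ger0_norm//; lra.
  apply: le_lt_trans (mod_le (x +i* y)) _ => /=; rewrite !ger0_norm; rewrite /d in x2 y2; lra.
have AD : A `<=` @disc2 R.
  by move=> u /Abd[_ h]; rewrite disc2E; apply: lt_trans h _; lra.
apply: (@le_trans _ _ (\int[lam \x lam]_(u in A) (cst k%:E u))%E).
  rewrite integral_cst// [X in (_ * X)%E](_ : _ = ((rho + d - rho) * (d - 0))%:E); last first.
    by apply: product_lebesgue_box; lra.
  by rewrite -EFinM lee_fin subr0 addrAC subrr add0r.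
apply: ge0_le_integral_subset => // u; first by move=> Du; rewrite lee_fin F0.
by move=> /Abd[h1 h2]; rewrite lee_fin kF.
Qed.

End DiscArea.

(** * Bounds for the weight on smaller discs *)

Section WeightBounds.
Variable R : realType.
Variable gamma : R.
Hypothesis gam : 0 < gamma < 1.
Variable g : R[i] -> R[i].
Hypothesis ga : analytic g.
Hypothesis gRe : forall z, modulus z < 1 -> 0 < complex.Re (g z).
Let gam0 : 0 < gamma. Proof. by case/andP: gam. Qed.

(** On the smaller disc [f] is within 1 of a polynomial in the rescaled variable, and polynomials
    are bounded on the disc. *)
Lemma analytic_bounded (f : R[i] -> R[i]) (rho : R) : analytic f -> 0 < rho -> rho < 1 ->
  exists2 M : R, 0 < M & forall z, modulus z < rho -> modulus (f z) <= M.
Proof.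
move=> fa r0 r1; have [q Hq] := analytic_dilation_poly_approx fa (ltW r0) r1 ltr01.
have [M M0 HM] := horner_disc_bounded q; exists (1 + M); first exact: addr_gt0.
move=> z zr; pose y := (rho^-1)%:C * z.
have y1 : modulus y < 1.
  by rewrite modM mod_real gtr0_norm ?invr_gt0// mulrC ltr_pdivrMr// mul1r.
have -> : z = rho%:C * y.
  by rewrite mulrA -rmorphM /= mulfV ?gt_eqF// mul1r.
rewrite -(subrK q.[y] (f _)); apply: le_trans (modD _ _) _.
by apply: lerD; [exact: (ltW (Hq _ y1))|exact: HM].
Qed.

(** The upper bound comes from [g], the lower one from [1 / g], which is analytic since [g] has no
    zeros. *)
Lemma weight_bounded (rho : R) : 0 < rho -> rho < 1 ->
  exists m M : R, [/\ 0 < m, 0 < M & forall z, modulus z < rho -> m <= weight gamma g z <= M].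
Proof.
move=> r0 r1; have g0 z : modulus z < 1 -> g z != 0 by move=> /gRe/Re_gt0_neq0.
have [M M0 HM] := analytic_bounded ga r0 r1.
have [m m0 Hm] := analytic_bounded (analyticV ga g0) r0 r1.
exists (m^-1 `^ gamma), (M `^ gamma); split; [by rewrite powR_gt0 ?invr_gt0|by rewrite powR_gt0|].
move=> z zr; have z1 : modulus z < 1 by exact: lt_trans r1.
rewrite /weight !ge0_ler_powR ?nnegrE ?(ltW gam0) ?mod_ge0 ?HM ?invr_ge0 ?(ltW m0) ?(ltW M0)//.
have := Hm z zr; rewrite modV => h.
by rewrite -[leRHS]invrK lef_pV2 ?posrE// invr_gt0 mod_gt0 g0.
Qed.

End WeightBounds.

Section WeightProducts.
Variable R : realType.
Variable w : nat -> R[i].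
Hypothesis w_neq0 : forall n, (1 <= n)%N -> w n != 0.

Definition wprod n : R[i] := \prod_(1 <= k < n.+1) w k.

Lemma wprod0 : wprod 0 = 1.
Proof. by rewrite /wprod big_nil. Qed.

Lemma wprodS n : wprod n.+1 = wprod n * w n.+1.
Proof. by rewrite /wprod big_nat_recr. Qed.

Lemma wprod_neq0 n : wprod n != 0.
Proof.
elim: n => [|n IH]; first by rewrite wprod0 oner_neq0.
by rewrite wprodS mulf_neq0 ?w_neq0.
Qed.

End WeightProducts.

(** * A countable dense family of polynomials *)

Section RationalPolynomials.
Variable R : realType.

Definition rat_complex (r : rat * rat) : R[i] := ratr r.1 +i* ratr r.2.

Definition rat_poly (s : seq (rat * rat)) : {poly R[i]} := Poly (map rat_complex s).

(** Decoding the 2-adic valuation of [k] instead of [k] makes each polynomial recur at arbitrarily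
    late stages, where the error [2^-1 ^+ k] is small. *)
Definition poly_enum k : {poly R[i]} :=
  if unpickle (logn 2 k) is Some s then rat_poly s else 0.

(* Every value of the 2-adic valuation is taken infinitely often. *)
Lemma poly_enum_infinite s k0 : exists2 k, (k0 <= k)%N & poly_enum k = rat_poly s.
Proof.
exists (2 ^ pickle s * k0.*2.+1)%N.
  apply: (@leq_trans k0.*2.+1); first by rewrite -addnn leqW// leq_addr.
  by rewrite leq_pmull// expn_gt0.
rewrite /poly_enum lognM ?expn_gt0// pfactorK// logn_coprime ?addn0 ?pickleK//.
by rewrite coprime2n /= odd_double.
Qed.

Lemma rat_complex_dense (c : R[i]) (x : R) : 0 < x -> exists r, modulus (c - rat_complex r) <= x.
Proof.
move=> x0.
have H (y : R) : exists q : rat, `|y - ratr q| <= x / 2.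
  have [|q] := @rat_in_itvoo R (y - x / 2) (y + x / 2); first by lra.
  rewrite in_itv /= => /andP[q1 q2]; exists q; rewrite ler_norml; move: q1 q2.
  by move: (ratr q) => s q1 q2; apply/andP; split; lra.
have [q1 h1] := H (complex.Re c); have [q2 h2] := H (complex.Im c).
exists (q1, q2); apply: le_trans (mod_le _) _; rewrite !raddfB [leRHS]splitr.
exact: lerD.
Qed.

Lemma rat_poly_dense (q : {poly R[i]}) (x : R) : 0 < x -> exists s, forall z,
  modulus z < 1 -> modulus (q.[z] - (rat_poly s).[z]) <= x.
Proof.
move=> x0; have y0 : 0 < x / (size q).+1%:R by rewrite divr_gt0.
have [r Hr] := choice (fun c => rat_complex_dense c y0).
pose s := [seq r q`_i | i <- iota 0 (size q)]; exists s => z z1.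
have ss : size s = size q by rewrite size_map size_iota.
have sq : (size (rat_poly s) <= size q)%N.
  by apply: leq_trans (size_Poly _) _; rewrite size_map ss.
rewrite (horner_coef_wide _ sq) horner_coef -sumrB.
apply: le_trans (mod_sum _ (fun i => q`_i * z ^+ i - (rat_poly s)`_i * z ^+ i)) _.
apply: (@le_trans _ _ (\sum_(i < size q) x / (size q).+1%:R)).
  apply: ler_sum => i _; rewrite -mulrBl modM modX.
  have -> : (rat_poly s)`_i = rat_complex (r q`_i).
    rewrite coef_Poly (nth_map (0, 0)) ?ss//; congr rat_complex.
    by rewrite (nth_map 0%N) ?size_iota// nth_iota.
  by apply: le_trans (Hr q`_i); rewrite ler_piMr ?mod_ge0// exprn_ile1 ?mod_ge0// ltW.
by rewrite sumr_const card_ord -[leLHS]mulr_natr mulrAC ler_pdivrMr// ler_pM2l// ler_nat.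
Qed.

End RationalPolynomials.

(** * The shift on monomials and polynomials, and the hypercyclic vector *)

Section Dynamics.
Variable R : realType.
Variables p gamma : R.
Hypothesis p1 : 1 <= p.
Hypothesis gam : 0 < gamma < 1.
Variable g : R[i] -> R[i].
Hypothesis ga : analytic g.
Hypothesis gRe : forall z, modulus z < 1 -> 0 < complex.Re (g z).
Variable w : nat -> R[i].
Hypothesis w_neq0 : forall n, (1 <= n)%N -> w n != 0.
Let p0 : 0 < p. Proof. exact: lt_le_trans p1. Qed.
Local Notation phi := (weight gamma g).
Local Notation E := (energy p phi).
Local Notation W := (wprod w).
Let mphi : mdisc phi := mdisc_weight gamma ga.
Let phi0 := weight_ge0 gamma g.
Variable K : R.
Hypothesis K1 : 1 <= K.
Hypothesis HB : forall f, analytic f -> (E f < +oo)%E ->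
  [/\ expansion (shift_seq w (taylor f)) (backward_shift w f),
      analytic (backward_shift w f) & (E (backward_shift w f) <= K%:E * E f)%E].
Let K0 : 0 < K. Proof. exact: lt_le_trans K1. Qed.

(** At each step [taylor] returns the expansion already known, so the weights telescope into
    quotients of partial products. *)
Lemma iter_backward_shift n f a : analytic f -> (E f < +oo)%E -> expansion a f ->
  [/\ expansion (fun i => W (i + n) / W i * a (i + n)%N) (iter n (backward_shift w) f),
      analytic (iter n (backward_shift w) f) &
      (E (iter n (backward_shift w) f) <= (K ^+ n)%:E * E f)%E].
Proof.
move=> fa foo af; elim: n => [|n [IHe IHa IHE]] /=.
  split; [|exact: fa|by rewrite expr0 mul1e].
  suff -> : (fun i => W (i + 0) / W i * a (i + 0)%N) = a by [].
  by apply/funext => i; rewrite addn0 divff ?wprod_neq0// mul1r.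
have noo : (E (iter n (backward_shift w) f) < +oo)%E.
  by apply: le_lt_trans IHE _; apply: lte_mul_pinfty; rewrite ?lee_fin ?exprn_ge0 ?(ltW K0).
have [] := HB IHa noo; rewrite (taylor_expansion IHe) => He Ha HE; split; [|exact: Ha|].
  suff <- : shift_seq w (fun i => W (i + n) / W i * a (i + n)%N) =
    (fun i => W (i + n.+1) / W i * a (i + n.+1)%N) by [].
  apply/funext => i; rewrite /shift_seq addnS addSn -addSn wprodS mulrA; congr (_ * _).
  by field; rewrite w_neq0// wprod_neq0.
apply: le_trans HE _; rewrite exprS EFinM -muleA.
by rewrite lee_pmul2l ?lte_fin.
Qed.

Hypothesis E1 : (E (fun=> 1%R) < +oo)%E.

Definition mono_energy m : R := fine (E (fun z => z ^+ m)).
Local Notation e := mono_energy.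

Lemma analyticX m : @analytic R (fun z => z ^+ m).
Proof.
have := analytic_horner (q := ('X^m : {poly R[i]})).
by congr (analytic _); apply/funext => z; rewrite hornerXn.
Qed.

Lemma mono_energyE m : E (fun z => z ^+ m) = (e m)%:E.
Proof.
rewrite fineK// ge0_fin_numE; last exact: energy_ge0.
have oneoo : ((1 `^ p)%:E * E (fun=> 1%R) < +oo)%E by rewrite powR1 mul1e.
apply: le_lt_trans oneoo.
apply: (energy_le p1 mphi phi0 (analytic_cst (c := 1)) ler01) => z z1.
by rewrite mod1 mul1r modX exprn_ile1 ?mod_ge0// ltW.
Qed.

Lemma mono_energyZ c m : E (fun z => c * z ^+ m) = (modulus c `^ p * e m)%:E.
Proof.
rewrite EFinM -mono_energyE /energy -dintZ ?powR_ge0//.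
- by apply: eq_dint => z _; rewrite modM powRM ?mod_ge0// mulrA.
- exact: (mdisc_energy p mphi (analyticX (m := m))).
- by move=> z _; rewrite mulr_ge0 ?powR_ge0.
Qed.

(** On the annulus between [rho] and [(1 + rho) / 2] the monomial is at least [rho ^+ m] and the
    weight is bounded below. *)
Lemma mono_energy_ge (rho : R) : 0 < rho -> rho < 1 -> exists2 c, 0 < c &
  forall m, (rho ^+ m) `^ p * c <= e m.
Proof.
move=> r0 r1; have [c c0 Hc] := @dint_annulus_ge R rho r0 r1.
have [||m [M [m0 M0 HM]]] := @weight_bounded R gamma gam g ga gRe ((1 + rho) / 2); [lra|lra|].
exists (m * c); first exact: mulr_gt0.
move=> n; rewrite mulrA -lee_fin -mono_energyE; apply: Hc.
- by move=> z _; rewrite mulr_ge0 ?powR_ge0.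
- by rewrite mulr_ge0 ?powR_ge0 ?(ltW m0).
move=> z z1 z2; apply: ler_pM; rewrite ?powR_ge0 ?(ltW m0)//; last first.
  by have /andP[] := HM z z2.
by apply: le_powR; rewrite ?exprn_ge0 ?(ltW r0)// modX lerXn2r ?nnegrE ?mod_ge0 ?(ltW r0) ?(ltW z1).
Qed.

Lemma mono_energy_gt0 m : 0 < e m.
Proof.
have h2 : 0 < 2^-1 :> R by rewrite invr_gt0.
have h2' : 2^-1 < 1 :> R by rewrite invf_lt1// ltr1n.
have [c c0 /(_ m)] := mono_energy_ge h2 h2'.
by apply: lt_le_trans; rewrite mulr_gt0// powR_gt0// exprn_gt0.
Qed.

(* The energies of the monomials decay more slowly than every geometric sequence. *)
Lemma energy_coef_subexp a : (forall m, modulus (a m) `^ p * e m <= 1) -> subexp a.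
Proof.
move=> Ha r r0 r1; have [c c0 Hc] := mono_energy_ge r0 r1.
exists (c^-1 `^ p^-1); first by rewrite powR_gt0// invr_gt0.
move=> m; have rm0 : 0 <= r ^+ m by rewrite exprn_ge0// ltW.
have x0 : 0 <= modulus (a m) * r ^+ m by rewrite mulr_ge0 ?mod_ge0.
rewrite -[leLHS]powRr1// -(@divff _ p) ?gt_eqF// powRrM.
apply: ge0_ler_powR; rewrite ?nnegrE ?invr_ge0 ?powR_ge0 ?(ltW p0) ?(ltW c0)//.
rewrite powRM ?mod_ge0// -[leRHS]mul1r ler_pdivlMr// -mulrA.
apply: le_trans (Ha m); apply: ler_wpM2l; first exact: powR_ge0.
exact: Hc.
Qed.

Lemma energy_sum n (v : nat -> R[i] -> R[i]) : (forall j, analytic (v j)) ->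
  (E (fun z => \sum_(j < n) v j z)%R <= \sum_(j < n) ((2 `^ p) ^+ j.+1)%:E * E (v j))%E.
Proof.
elim: n v => [|n IH] v va.
  rewrite big_ord0 (_ : (fun z => _) = fun z => 0 * z ^+ 0); last first.
    by apply/funext => z; rewrite big_ord0 mul0r.
  by rewrite mono_energyZ mod0 powR0 ?gt_eqF// mul0r.
pose r z := \sum_(j < n) v j.+1 z.
have ra : analytic r.
  rewrite /r; elim: n {IH r} => [|n IH].
    rewrite (_ : (fun z => _) = fun=> 0); first exact: (analytic_cst (c := 0)).
    by apply/funext => z; rewrite big_ord0.
  rewrite (_ : (fun z => _) = fun z => \sum_(j < n) v j.+1 z + v n.+1 z).
    exact: (analyticD IH (va n.+1)).
  by apply/funext => z; rewrite big_ord_recr.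
rewrite (_ : (fun z => _) = fun z => v 0%N z + r z); last first.
  by apply/funext => z; rewrite big_ord_recl.
apply: le_trans (energyD p1 mphi phi0 (va 0%N) ra) _.
rewrite big_ord_recl expr1 muleDr//; last first.
  by apply: ge0_adde_def; rewrite inE energy_ge0.
rewrite leeD2l//.
apply: (@le_trans _ _ ((2 `^ p)%:E * (\sum_(j < n) ((2 `^ p) ^+ j.+1)%:E * E (v j.+1)))%E).
  by rewrite lee_pmul2l ?lte_fin ?powR_gt0//; exact: (IH (fun j => v j.+1) (fun j => va j.+1)).
rewrite ge0_sume_distrr; last by move=> j _; rewrite mule_ge0 ?energy_ge0 ?lee_fin ?exprn_ge0 ?powR_ge0.
by apply: lee_sum => j _; rewrite muleA -EFinM -exprS.
Qed.

(* [lift n q] is mapped to [q] by the [n]-th iterate of the shift. *)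
Definition lift n (q : {poly R[i]}) : {poly R[i]} :=
  \poly_(i < size q) (q`_i * W i / W (i + n)) * 'X^n.

Lemma coef_lift n q m : (lift n q)`_m =
  if (m < n)%N then 0 else q`_(m - n) * W (m - n) / W m.
Proof.
rewrite coefMXn coef_poly; case: ltnP => // nm; case: ltnP => h; first by rewrite subnK.
by rewrite nth_default// !mul0r.
Qed.

Lemma horner_lift n q z :
  (lift n q).[z] = \sum_(i < size q) (q`_i * W i / W (i + n)) * z ^+ (i + n).
Proof.
rewrite hornerM hornerXn horner_poly mulr_suml; apply: eq_bigr => i _.
by rewrite -mulrA exprD.
Qed.

Definition ratio m : R := e m / modulus (W m) `^ p.
Local Notation u := ratio.

Lemma mod_wprod_gt0 m : 0 < modulus (W m).
Proof. by rewrite mod_gt0 wprod_neq0. Qed.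

Lemma ratio_gt0 m : 0 < u m.
Proof. by rewrite divr_gt0 ?mono_energy_gt0// powR_gt0// mod_wprod_gt0. Qed.

Lemma ratioE x m : modulus (x / W m) `^ p * e m = modulus x `^ p * u m.
Proof.
rewrite modM modV powRM ?invr_ge0 ?mod_ge0// -mulrA; congr (_ * _).
by rewrite -powR_inv1 ?mod_ge0// -powRrM mulN1r powRN mulrC.
Qed.

Lemma expansion_ext a b f h : @expansion R a f -> a =1 b -> f =1 h -> expansion b h.
Proof. by move=> af /funext <- /funext <-. Qed.

Lemma expansion_horner (q : {poly R[i]}) : expansion (fun n => q`_n) (fun z => q.[z]).
Proof. exact: expansion_poly. Qed.

Lemma expansion_eq a f h (z : R[i]) : expansion a f -> expansion a h -> modulus z < 1 -> f z = h z.
Proof.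
move=> /expansionP af /expansionP ah z1; exact: (converges_unique (af z z1) (ah z z1)).
Qed.

(** The energy bound for the shift at [z^(m+1)], whose image is [w_(m+1) z^m]. *)
Lemma ratio_prev m : u m <= K * u m.+1.
Proof.
have Xexp : expansion (fun n => 'X^(m.+1)`_n) (fun z : R[i] => z ^+ m.+1).
  refine (@expansion_ext _ _ _ _ (@expansion_horner 'X^(m.+1)) _ _) => // z.
  by rewrite hornerXn.
have Xoo : (E (fun z => z ^+ m.+1)%R < +oo)%E by rewrite mono_energyE ltry.
have [He _ HE] := HB (analyticX (m := m.+1)) Xoo.
have E2 : expansion (shift_seq w (taylor (fun z => z ^+ m.+1))) (fun z => w m.+1 * z ^+ m).
  rewrite (taylor_expansion Xexp).
  refine (@expansion_ext _ _ _ _ (@expansion_horner (w m.+1 *: 'X^m)) _ _) => [n|z].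
    rewrite /shift_seq coefZ !coefXn eqSS; case: eqP => [->//|_]; by rewrite !mulr0.
  by rewrite hornerZ hornerXn.
move: HE; rewrite (eq_energy p phi (fun z z1 => expansion_eq He E2 z1)).
rewrite mono_energyZ mono_energyE -EFinM lee_fin => HE.
have w0 : 0 < modulus (w m.+1) by rewrite mod_gt0 w_neq0.
rewrite /u wprodS modM powRM ?mod_ge0// ler_pdivrMr ?powR_gt0 ?mod_wprod_gt0//.
rewrite [leRHS](_ : _ = K * e m.+1 / modulus (w m.+1) `^ p); last first.
  have h1 : modulus (W m) `^ p != 0 by rewrite gt_eqF ?powR_gt0 ?mod_wprod_gt0.
  have h2 : modulus (w m.+1) `^ p != 0 by rewrite gt_eqF ?powR_gt0.
  move: h1 h2; set x := _ `^ p; set y := _ `^ p => h1 h2; field; by rewrite h1 h2.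
by rewrite ler_pdivlMr ?powR_gt0// mulrC.
Qed.

Hypothesis ratio_small : forall d : R, 0 < d -> exists n, u n < d.

(** Descending from an index [N] where the ratio is tiny costs a factor [K] per step, so the ratio
    is still small on the [d + 1] indices ending at [N]. *)
Lemma ratio_window d n0 (x : R) : 0 < x -> exists2 n, (n0 <= n)%N &
  forall i, (i <= d)%N -> u (i + n) <= x.
Proof.
move=> x0; have [m m0 Hm] : exists2 m : R, 0 < m & forall i, (i < n0 + d)%N -> m <= u i.
  elim: (n0 + d)%N => [|k [m m0 IH]]; first by exists 1.
  exists (Num.min m (u k)); first by rewrite lt_min m0 ratio_gt0.
  move=> i; rewrite ltnS leq_eqVlt => /predU1P[->|/IH h]; first by rewrite ge_min lexx orbT.
  by rewrite ge_min h.
(* The ratios of the first [n0 + d] indices are at least [m]; a value below [m] thus forces [N]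
   beyond them. *)
have y0 : 0 < Num.min m (x / K ^+ d) by rewrite lt_min m0 divr_gt0// exprn_gt0.
have [N] := ratio_small y0; rewrite lt_min => /andP[N1 N2].
have NN : (n0 + d <= N)%N.
  by rewrite leqNgt; apply/negP => /Hm; rewrite leNgt N1.
exists (N - d)%N => [|i id]; first by rewrite -(addnK d n0) leq_sub2r.
have back j : (j <= N)%N -> u (N - j) <= K ^+ j * u N.
  elim: j => [_|j IH jN]; first by rewrite subn0 mul1r.
  apply: le_trans (ratio_prev _) _; rewrite -subSn// subSS exprS -mulrA ler_pM2l//.
  by apply: IH; exact: ltnW.
have dN : (d <= N)%N by rewrite (leq_trans _ NN)// leq_addl.
have -> : (i + (N - d) = N - (d - i))%N by rewrite subnBA// addnC addnBAC.
apply: le_trans (back _ _) _; first by rewrite (leq_trans (leq_subr _ _)).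
apply: (@le_trans _ _ (K ^+ d * u N)).
  by apply: ler_wpM2r; [exact: (ltW (ratio_gt0 _))|apply: ler_weXn2l => //; exact: leq_subr].
by rewrite mulrC -ler_pdivlMr ?exprn_gt0// ltW.
Qed.

(** The term of degree [i + n] of the lift has energy [|q_i W_i|^p u_(i+n)], so one window covers
    all its degrees. The coefficient bound is what later makes the sum of all lifts a convergent
    power series. *)
Lemma lift_small q n0 (x : R) : 0 < x -> exists n, [/\ (n0 <= n)%N,
  forall m, modulus (lift n q)`_m `^ p * e m <= 1 &
  (E (fun z => (lift n q).[z]) <= x%:E)%E].
Proof.
(* [c i] includes the factor charged by [energy_sum]. The summand 1 in [C] keeps it positive for
   [q = 0], and the minimum with 1 serves the coefficient bound. *)
move=> x0; pose c i := (2 `^ p) ^+ i.+1 * modulus (q`_i * W i) `^ p.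
have c0 i : 0 <= c i by rewrite mulr_ge0 ?exprn_ge0 ?powR_ge0.
pose C := 1 + \sum_(i < size q) c i.
have C1 : 1 <= C by rewrite lerDl sumr_ge0.
have C0 : 0 < C by exact: lt_le_trans C1.
have y0 : 0 < Num.min x 1 / C by rewrite divr_gt0// lt_min x0 ltr01.
have [n n0n Hn] := ratio_window (size q) n0 y0; exists n; split => [//|m|].
  rewrite coef_lift; case: ltnP => nm; first by rewrite mod0 powR0 ?gt_eqF// mul0r.
  have [mq|mq] := ltnP (m - n) (size q); last first.
    by rewrite nth_default// !mul0r mod0 powR0 ?gt_eqF// mul0r.
  have cC : c (m - n)%N <= C.
    by rewrite /C (bigD1 (Ordinal mq))//= addrCA lerDl addr_ge0// sumr_ge0.
  rewrite ratioE; apply: (@le_trans _ _ (C * (Num.min x 1 / C))); last first.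
    by rewrite mulrC divfK ?gt_eqF// ge_min lexx orbT.
  apply: ler_pM; rewrite ?powR_ge0 ?(ltW (ratio_gt0 _))//.
    apply: le_trans cC; rewrite /c ler_peMl ?powR_ge0// exprn_ege1//.
    by apply: powR_ge1 => //; [rewrite ler1n|exact: ltW].
  by have := Hn (m - n)%N (ltnW mq); rewrite subnK.
pose v i z := (q`_i * W i / W (i + n)) * z ^+ (i + n).
have va i : analytic (v i).
  exact: (analyticM (analytic_cst (c := q`_i * W i / W (i + n))) (analyticX (m := i + n))).
rewrite (_ : (fun z => _) = fun z => \sum_(i < size q) v i z); last first.
  by apply/funext => z; rewrite horner_lift.
apply: le_trans (energy_sum _ va) _.
rewrite (_ : (\sum_(j < size q) _)%E = (\sum_(j < size q) c j * u (j + n))%:E); last first.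
  rewrite -sumEFin; apply: eq_bigr => i _.
  by rewrite mono_energyZ ratioE -EFinM mulrA.
rewrite lee_fin; apply: (@le_trans _ _ (\sum_(j < size q) c j * (Num.min x 1 / C))).
  by apply: ler_sum => i _; apply: ler_wpM2l => //; apply: Hn; exact: ltnW.
rewrite -mulr_suml; apply: (@le_trans _ _ (C * (Num.min x 1 / C))).
  by rewrite ler_pM2r// /C lerDr.
by rewrite mulrC divfK ?gt_eqF// ge_min lexx.
Qed.

Lemma geometric_half n k : \sum_(i < n) (2^-1 : R) ^+ (k.+1 + i) <= 2^-1 ^+ k.
Proof.
have h2 : 0 <= 2^-1 :> R by rewrite invr_ge0.
rewrite (_ : \sum_(i < n) _ = 2^-1 ^+ k * (2^-1 * \sum_(i < n) 2^-1 ^+ i)); last first.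
  by rewrite mulrA -exprSr mulr_sumr; apply: eq_bigr => i _; rewrite exprD.
rewrite ler_piMr ?exprn_ge0//; have /(_ n) H := @geometric_le R 2^-1.
rewrite -ler_pdivlMl ?invr_gt0// invrK mulr1; apply: le_trans (H h2 _) _; first by rewrite invf_lt1// ltr1n.
by rewrite (_ : 1 - 2^-1 = 2^-1 :> R) ?invrK//; lra.
Qed.

Lemma energy_poly (q : {poly R[i]}) : (E (fun z => q.[z]) < +oo)%E.
Proof.
have [M M0 HM] := horner_disc_bounded q.
apply: (@le_lt_trans _ _ ((M `^ p)%:E * E (fun=> 1%R))%E); last first.
  by apply: lte_mul_pinfty; rewrite ?lee_fin ?powR_ge0.
apply: (energy_le p1 mphi phi0 (analytic_cst (c := 1)) (ltW M0)) => z z1.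
by rewrite mod1 mulr1 HM.
Qed.

(** * The lacunary series and its shifts *)

Section Universal.
Variable P : nat -> {poly R[i]}.
Variables (V : nat -> {poly R[i]}) (d : nat -> nat).
Hypothesis V0 : V 0%N = 0.
Hypothesis VS : forall k, V k.+1 = V k + lift (d k) (P k).
Hypothesis dS : forall k, (d k <= d k.+1)%N.
Hypothesis dk : forall k, (k <= d k)%N.
Hypothesis dV : forall k, (size (V k) <= d k)%N.
Hypothesis lift_coef : forall k m, modulus (lift (d k) (P k))`_m `^ p * e m <= 1.
Hypothesis lift_energy : forall k,
  (E (fun z => (lift (d k.+1) (P k.+1)).[z]) <=
     (((2 `^ p)^-1 * 2^-1) ^+ k.+1 / K ^+ d k)%:E)%E.

(** The coefficients of the infinite sum: that of degree [m] is final in [V m.+1], because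
    [m < d m.+1] and later lifts start at degree [d m.+1] or higher. *)
Definition blocks m : R[i] := (V m.+1)`_m.
Local Notation a := blocks.

Lemma d_homo k l : (d k <= d (k + l))%N.
Proof. by elim: l => [|l IH]; rewrite ?addn0// addnS (leq_trans IH). Qed.

Lemma coefV_stable k l m : (m < d k)%N -> (V (k + l))`_m = (V k)`_m.
Proof.
move=> mk; elim: l => [|l IH]; first by rewrite addn0.
by rewrite addnS VS coefD IH coef_lift (leq_trans mk (d_homo k l)) addr0.
Qed.

Lemma blocksE k m : (m < d k)%N -> a m = (V k)`_m.
Proof.
move=> mk; rewrite /a; have [km|km] := leqP k m.+1.
  by rewrite -(subnKC km) coefV_stable.
by rewrite -(subnKC (ltnW km)) coefV_stable.
Qed.

Lemma coefV_energy k m : modulus (V k)`_m `^ p * e m <= 1.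
Proof.
elim: k => [|k IH]; first by rewrite V0 coef0 mod0 powR0 ?gt_eqF// mul0r.
rewrite VS coefD; have [mk|mk] := ltnP m (d k); first by rewrite coef_lift mk addr0.
by rewrite [(V k)`_m]nth_default ?add0r// (leq_trans (dV k)).
Qed.

Lemma blocks_subexp : subexp a.
Proof. by apply: energy_coef_subexp => m; exact: coefV_energy. Qed.

Lemma psum_blocks z k : psum a z (d k) = (V k).[z].
Proof.
rewrite (horner_coef_wide _ (dV k)) /psum; apply: eq_bigr => i _.
by rewrite (blocksE (ltn_ord i)).
Qed.

Lemma horner_tail k l z :
  (V (k + l)).[z] - (V k).[z] = \sum_(j < l) (lift (d (k + j)) (P (k + j))).[z].
Proof.
elim: l => [|l IH]; first by rewrite addn0 subrr big_ord0.
by rewrite big_ord_recr -IH addnS VS hornerD addrAC.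
Qed.

(** The factors [(2]^ p) ^+ j.+1[are absorbed by the inverse powers of]2 [^ p] in [lift_energy], and
    the increasing shifts allow [K ^+ d k] as common divisor; a geometric sum remains. *)
Lemma energy_tail k l :
  (E (fun z => (V (k.+1 + l)).[z] - (V k.+1).[z])%R <= (2^-1 ^+ k / K ^+ d k)%:E)%E.
Proof.
rewrite (_ : (fun z => _) = fun z => \sum_(j < l) (lift (d (k.+1 + j)) (P (k.+1 + j))).[z]); last first.
  by apply/funext => z; rewrite horner_tail.
pose v j z := (lift (d (k.+1 + j)) (P (k.+1 + j))).[z].
have va j : analytic (v j) := analytic_horner (q := lift (d (k.+1 + j)) (P (k.+1 + j))).
apply: le_trans (energy_sum _ va) _.
have D0 : 0 < 2 `^ p :> R by rewrite powR_gt0.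
have D1 : 1 <= 2 `^ p :> R by apply: powR_ge1; [rewrite ler1n|exact: ltW].
apply: (@le_trans _ _ (\sum_(j < l) (2^-1 ^+ (k.+1 + j) / K ^+ d k))%:E); last first.
  by rewrite lee_fin -mulr_suml ler_wpM2r ?invr_ge0 ?exprn_ge0 ?(ltW K0)// geometric_half.
rewrite -sumEFin; apply: lee_sum => j _.
apply: (@le_trans _ _ (((2 `^ p) ^+ j.+1)%:E * (((2 `^ p)^-1 * 2^-1) ^+ (k + j).+1 / K ^+ d (k + j))%:E)%E).
  by rewrite lee_pmul2l ?lte_fin ?exprn_gt0//; exact: lift_energy.
rewrite -EFinM lee_fin exprMn mulrA mulrA; apply: ler_pM.
- by rewrite !mulr_ge0 ?exprn_ge0 ?invr_ge0 ?(ltW D0).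
- by rewrite invr_ge0 exprn_ge0// ltW.
- rewrite ler_piMl ?exprn_ge0 ?invr_ge0// exprVn ler_pdivrMr ?exprn_gt0// mul1r.
  by apply: ler_weXn2l => //; rewrite ltnS leq_addl.
- by rewrite lef_pV2 ?posrE ?exprn_gt0//; apply: ler_weXn2l => //; exact: d_homo.
Qed.

(** After [d k] shifts the blocks before [k] have vanished, block [k] has become [P k], and the
    tail, of energy at most [2^-1 ^+ k / K ^+ d k], has grown by at most [K ^+ d k]. *)
Lemma universal_blocks : exists f, [/\ analytic f, (E f < +oo)%E &
  forall k, (E (fun z => iter (d k) (backward_shift w) f z - (P k).[z])%R <= (2^-1 ^+ k)%:E)%E].
Proof.
have [f fa fe] := subexp_sum_function blocks_subexp.
pose h k z := f z - (V k.+1).[z].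
have ha k : analytic (h k) := analyticB fa (analytic_horner (q := V k.+1)).
have hE k : (E (h k) <= (2^-1 ^+ k / K ^+ d k)%:E)%E.
  pose q l z := (V (k.+1 + l)).[z] - (V k.+1).[z].
  have qa l : analytic (q l) :=
    analyticB (analytic_horner (q := V (k.+1 + l))) (analytic_horner (q := V k.+1)).
  (* Fatou along the partial sums [V (k.+1 + l)] passes the bound of [energy_tail] to the infinite
     tail. *)
  apply: (@dint_fatou R (fun l z => modulus (q l z) `^ p * phi z)).
  - by move=> l; exact: (mdisc_energy p mphi (qa l)).
  - by move=> l z _; rewrite mulr_ge0 ?powR_ge0.
  - move=> z z1; apply: cvgMl; apply: powR_cvg => // [n|]; first exact: mod_ge0.
    apply/cvgrPdist_lt => x x0.
    have [N HN] := (expansionP _ _).1 fe z z1 x x0.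
    exists N => // l /= Nl; rewrite distrC.
    have := HN (d (k.+1 + l)) (leq_trans Nl (leq_trans (leq_addl _ _) (dk _))).
    rewrite psum_blocks; apply: le_lt_trans.
    have -> : (V (k.+1 + l)).[z] - f z = q l z - h k z by rewrite /q /h; ring.
    by rewrite ler_norml modB_ge andbT lerNl opprB [leRHS]modB modB_ge.
  - by move=> l; exact: energy_tail.
have foo : (E f < +oo)%E.
  have -> : f = fun z => h 0%N z + (V 1%N).[z] by apply/funext => z; rewrite /h subrK.
  apply: le_lt_trans (energyD p1 mphi phi0 (ha 0%N) (analytic_horner (q := V 1%N))) _.
  apply: lte_mul_pinfty; rewrite ?lee_fin ?powR_ge0//.
  by apply: lte_add_pinfty; [exact: le_lt_trans (hE 0%N) (ltry _)|exact: energy_poly].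
exists f; split; [exact: fa|exact: foo|move=> k].
have he : expansion (fun m => a m - (V k.+1)`_m) (h k) := expansionB fe (expansion_poly (q := V k.+1)).
have hoo : (E (h k) < +oo)%E := le_lt_trans (hE k) (ltry _).
have [e1 _ _] := iter_backward_shift (d k) fa foo fe.
have [e2 _ E2] := iter_backward_shift (d k) (ha k) hoo he.
have e3 := expansionB e1 (expansion_poly (q := P k)).
(* [V k] has size at most [d k] and contributes nothing at degrees [i + d k]; the lift there gives
   back the coefficients of [P k]. *)
have E3 : (fun i => W (i + d k) / W i * a (i + d k)%N - (P k)`_i) =
    (fun i => W (i + d k) / W i * (a (i + d k)%N - (V k.+1)`_(i + d k))).
  apply/funext => i; rewrite mulrBr; congr (_ - _).
  rewrite VS coefD [(V k)`_ _]nth_default ?add0r; last by rewrite (leq_trans (dV k))// leq_addl.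
  rewrite coef_lift ltnNge leq_addl /= addnK.
  by field; rewrite !wprod_neq0.
rewrite E3 in e3.
rewrite (eq_energy p phi (fun z z1 => expansion_eq e3 e2 z1)).
apply: le_trans E2 _; apply: (@le_trans _ _ ((K ^+ d k)%:E * (2^-1 ^+ k / K ^+ d k)%:E)%E).
  by rewrite lee_pmul2l ?lte_fin ?exprn_gt0.
by rewrite -EFinM lee_fin mulrC divfK// gt_eqF// exprn_gt0.
Qed.

End Universal.

Lemma universal_vector (P : nat -> {poly R[i]}) : exists f, [/\ analytic f, (E f < +oo)%E &
  forall k, exists n,
    (E (fun z => iter n (backward_shift w) f z - (P k).[z])%R <= (2^-1 ^+ k)%:E)%E].
Proof.
(* Positivity of the bound is moved under the existential, so that a choice function exists on all
   triples. *)
have H (x : {poly R[i]} * nat * R) : exists n, 0 < x.2 -> [/\ (x.1.2 <= n)%N,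
    forall m, modulus (lift n x.1.1)`_m `^ p * e m <= 1 &
    (E (fun z => (lift n x.1.1).[z]) <= x.2%:E)%E].
  case: x => -[q n0] x /=; have [x0|x0] := boolP (0 < x).
    by have [n Hn] := lift_small q n0 x0; exists n.
  by exists 0%N.
have [s Hs] := choice H.
pose c k m : R := ((2 `^ p)^-1 * 2^-1) ^+ k / K ^+ m.
(* The state holds the sum of the blocks so far and the last shift used. The new shift exceeds the
   size of that sum, the old shift and the stage, and its lift is small relative to the old
   shift. *)
pose fix st k : {poly R[i]} * nat := if k is k'.+1 then
    let n := s (P k', maxn (size (st k').1) (maxn (st k').2 k'), c k' (st k').2) in
    ((st k').1 + lift n (P k'), n) else (0, 0%N).
(* The shift of block [k] is fixed at the transition to stage [k.+1], hence the successor. *)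
pose d k := (st k.+1).2.
have c0 k m : 0 < c k m.
  by rewrite divr_gt0 ?exprn_gt0// mulr_gt0 ?invr_gt0 ?powR_gt0.
have spec k := Hs (P k, maxn (size (st k).1) (maxn (st k).2 k), c k (st k).2) (c0 _ _).
have [|||||||f [fa foo Hf]] := @universal_blocks P (fun k => (st k).1) d.
- by [].
- by [].
- by move=> k; have [h _ _] := spec k.+1; apply: leq_trans h; rewrite /= !leq_max leqnn orbT.
- by move=> k; have [h _ _] := spec k; apply: leq_trans h; rewrite /= !leq_max leqnn !orbT.
- by move=> k; have [h _ _] := spec k; apply: leq_trans h; rewrite /= !leq_max leqnn.
- by move=> k; have [_ h _] := spec k.
- by move=> k; have [_ _ h] := spec k.+1.
by exists f; split=> // k; exists (d k).
Qed.

Lemma iter_shift_analytic n f : analytic f -> (E f < +oo)%E ->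
  analytic (iter n (backward_shift w) f) /\ (E (iter n (backward_shift w) f) < +oo)%E.
Proof.
move=> fa foo; elim: n => [|n [IHa IHE]]; first by split; [exact: fa|exact: foo].
have [_ Ha HE] := HB IHa IHE; split; first exact: Ha.
apply: le_lt_trans HE _; apply: lte_mul_pinfty; rewrite ?lee_fin//.
exact: le_trans K1.
Qed.

Lemma energyBC f h : E (fun z => f z - h z) = E (fun z => h z - f z).
Proof. by apply: eq_dint => z _; rewrite modB. Qed.

Lemma energy_triangle f h k (x y : R) : analytic f -> analytic h -> analytic k ->
  (E (fun z => f z - h z)%R < x%:E)%E -> (E (fun z => h z - k z)%R < y%:E)%E ->
  (E (fun z => f z - k z)%R < (2 `^ p * (x + y))%:E)%E.
Proof.
move=> fa ha ka fh hk.
have -> : (fun z => f z - k z) = fun z => (f z - h z) + (h z - k z).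
  by apply/funext => z; ring.
apply: le_lt_trans (energyD p1 mphi phi0 (analyticB fa ha) (analyticB ha ka)) _.
by rewrite EFinM lte_pmul2l ?lte_fin ?powR_gt0// EFinD lteD.
Qed.

Lemma exists_hypercyclic : exists f, [/\ analytic f, (E f < +oo)%E &
  forall h, analytic h -> (E h < +oo)%E -> forall x : R, 0 < x ->
    exists n, (E (fun z => iter n (backward_shift w) f z - h z)%R < x%:E)%E].
Proof.
have [f [fa foo Hf]] := universal_vector (poly_enum R).
exists f; split; [exact: fa|exact: foo|move=> h ha hoo x x0].
have D0 : 0 < 2 `^ p :> R by rewrite powR_gt0.
(* The path from the orbit through a rational polynomial and [q] to [h] uses the quasi-triangle
   inequality twice, with total [2^p (y + 2^p (y + y)) <= 2^p (2^p 3 y) = x]. *)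
pose y := x / (2 `^ p * (2 `^ p * 3)).
have y0 : 0 < y by rewrite divr_gt0 ?mulr_gt0.
have D1 : 1 <= 2 `^ p :> R by apply: powR_ge1; [rewrite ler1n|exact: ltW].
have [q Hq] := polynomials_dense p1 gam ga gRe E1 ha hoo y0.
have [c c0 Hc] := energy_small p1 ga E1 y0.
have [s Hs] := rat_poly_dense q c0.
have qa := analytic_horner (q := q); have sa := analytic_horner (q := rat_poly R s).
have h1 := Hc _ Hs.
have h2 := energy_triangle ha qa sa Hq h1.
have h20 : 0 <= 2^-1 :> R by rewrite invr_ge0.
have h21 : 2^-1 < 1 :> R by rewrite invf_lt1// ltr1n.
have [N HN] := pow_small h20 h21 y0.
have [k kN Hk] := poly_enum_infinite R s N.
have [n Hn] := Hf k; exists n; rewrite Hk in Hn.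
have [ia _] := iter_shift_analytic n fa foo.
have h3 : (E (fun z => iter n (backward_shift w) f z - (rat_poly R s).[z])%R < y%:E)%E.
  by apply: le_lt_trans Hn _; rewrite lte_fin; apply: le_lt_trans HN; apply: ler_wiXn2l => //; exact: ltW.
rewrite energyBC in h2.
apply: lt_le_trans (energy_triangle ia sa ha h3 h2) _.
rewrite lee_fin; apply: (@le_trans _ _ (2 `^ p * (2 `^ p * 3 * y))); last first.
  by rewrite mulrA mulrC /y divfK// gt_eqF// !mulr_gt0.
rewrite ler_pM2l//; have : y <= 2 `^ p * y by rewrite ler_peMl// ltW.
by move: (2 `^ p) => D; lra.
Qed.

End Dynamics.

(** * The criterion *)

Section BergmanNorm.
Variable R : realType.
Variables (p : R) (phi : R[i] -> R).
Hypothesis p1 : 1 <= p.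
Hypothesis phi0 : forall z, 0 <= phi z.
Let p0 : 0 < p. Proof. exact: lt_le_trans p1. Qed.
Local Notation E := (energy p phi).

Lemma energy_EFin f : (E f < +oo)%E -> exists2 y : R, 0 <= y & E f = y%:E.
Proof.
have := energy_ge0 p phi0 f; case: (E f) => [y|//|//] y0 _.
by exists y.
Qed.

Lemma bergmanE f : bergman p phi f <-> analytic f /\ (E f < +oo)%E.
Proof.
rewrite /bergman /disc_integral /=; change (analytic f /\ ((pi^-1)%:E * E f < +oo)%E <-> analytic f /\ (E f < +oo)%E).
have c0 : 0 < pi^-1 :> R by rewrite invr_gt0 pi_gt0.
split=> -[fa foo]; (split; first exact: fa).
  have := energy_ge0 p phi0 f; move: foo; case: (E f) => [y _ _|h _|h//]; first exact: ltry.
  by move: h; rewrite gt0_muley ?lte_fin.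
by apply: lte_mul_pinfty; rewrite ?lee_fin ?(ltW c0).
Qed.

Lemma bergman_normE f (y : R) : E f = y%:E ->
  bergman_norm p phi f = ((pi^-1 * y) `^ p^-1)%:E.
Proof.
move=> Ey; rewrite /bergman_norm.
by change (((pi^-1)%:E * E f) `^ p^-1 = ((pi^-1 * y) `^ p^-1)%:E)%E; rewrite Ey -EFinM poweR_EFin.
Qed.

Lemma energy_lt_norm f (x : R) : 0 < x -> (E f < (pi * x `^ p)%:E)%E ->
  (bergman_norm p phi f < x%:E)%E.
Proof.
move=> x0 Ex; have [y y0 Ey] := energy_EFin (lt_trans Ex (ltry _)).
rewrite (bergman_normE Ey) lte_fin; move: Ex; rewrite Ey lte_fin => yx.
have pi0 := pi_gt0 R.
have h : pi^-1 * y < x `^ p by rewrite mulrC ltr_pdivrMr// mulrC.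
have := gt0_ltr_powR _ _ _ h; rewrite !nnegrE => /(_ p^-1).
rewrite invr_gt0 mulr_ge0 ?invr_ge0 ?(ltW pi0)// powR_ge0 => /(_ p0 isT isT).
by rewrite -powRrM mulfV ?gt_eqF// powRr1// ltW.
Qed.

Lemma norm_lt_energy f (x : R) : 0 < x -> (bergman_norm p phi f < x%:E)%E ->
  (E f < (pi * x `^ p)%:E)%E.
Proof.
move=> x0 h; have pi0 := pi_gt0 R.
have foo : (E f < +oo)%E.
  rewrite ltey; apply/eqP => Ef; move: h; rewrite /bergman_norm.
  change (((pi^-1)%:E * E f) `^ p^-1 < x%:E -> False)%E.
  by rewrite Ef gt0_muley ?lte_fin ?invr_gt0// poweRyr// invr_eq0 gt_eqF.
move: h; have [y y0 Ey] := energy_EFin foo.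
rewrite (bergman_normE Ey) Ey !lte_fin => h.
have yy : 0 <= pi^-1 * y by rewrite mulr_ge0 ?invr_ge0 ?(ltW pi0).
have := gt0_ltr_powR p0 _ _ h; rewrite !nnegrE powR_ge0 (ltW x0) => /(_ isT isT).
by rewrite -powRrM mulVf ?gt_eqF// powRr1// mulrC ltr_pdivrMr// mulrC.
Qed.

Lemma bounded_shift_energy w : bounded_backward_shift p phi w -> exists2 K : R, 1 <= K &
  forall f, analytic f -> (E f < +oo)%E ->
  [/\ expansion (shift_seq w (taylor f)) (backward_shift w f),
      analytic (backward_shift w f) & (E (backward_shift w f) <= K%:E * E f)%E].
Proof.
(* The norm bound is raised to the power [p]; the absolute value covers a negative [K], and the
   added 1 ensures [1 <= K]. *)
move=> [HB [K HK]]; exists (`|K| `^ p + 1); first by rewrite lerDr powR_ge0.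
move=> f fa foo; have fb := (bergmanE f).2 (conj fa foo).
have [e1 Bb] := HB f fb; have [Ba Boo] := (bergmanE _).1 Bb.
split; [exact: e1|exact: Ba|].
have [y y0 Ey] := energy_EFin foo; have [x x0 Ex] := energy_EFin Boo.
have := HK f fb; rewrite (bergman_normE Ey) (bergman_normE Ex) Ey Ex -!EFinM !lee_fin => h.
have pi0 := pi_gt0 R; have pv0 : 0 <= pi^-1 :> R by rewrite invr_ge0 ltW.
have {}h : (pi^-1 * x) `^ p^-1 <= `|K| * (pi^-1 * y) `^ p^-1.
  by apply: le_trans h _; rewrite ler_wpM2r ?powR_ge0// ler_norm.
have := @le_powR _ _ p1 _ _ (powR_ge0 _ _) h.
rewrite [X in _ <= X]powRM ?powR_ge0// -!powRrM mulVf ?gt_eqF// !powRr1 ?mulr_ge0//.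
rewrite mulrCA ler_pM2l ?invr_gt0// => H; apply: le_trans H _.
by rewrite mulrDl mul1r lerDl.
Qed.

End BergmanNorm.

Lemma ereal_sup_pinfty (R : realType) (A : set nat) (u : nat -> R) :
  ereal_sup [set (u n)%:E | n in A] = +oo%E -> forall M, exists2 n, A n & M < u n.
Proof.
move=> H M; apply: contrapT => N.
suff : (ereal_sup [set (u n)%:E | n in A] <= M%:E)%E by rewrite H.
apply: ge_ereal_sup => _ [n An <-]; rewrite lee_fin leNgt; apply/negP => Mu.
by apply: N; exists n.
Qed.

Lemma ereal_sup_eq_pinfty (R : realType) (A : set nat) (u : nat -> R) :
  (forall M, exists2 n, A n & M < u n) -> ereal_sup [set (u n)%:E | n in A] = +oo%E.
Proof.
move=> H; have ub n : A n -> ((u n)%:E <= ereal_sup [set (u n)%:E | n in A])%E.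
  by move=> An; apply: ereal_sup_ubound; exists n.
case: (ereal_sup _) ub => [s ub|//|ub].
- by have [n /ub] := H s; rewrite lee_fin leNgt => /negbTE ->.
- by have [n /ub] := H 0.
Qed.

(** * Moments, evaluation at the origin, and the two implications *)

Section Criterion.
Variable R : realType.
Local Notation lam := (@lebesgue_measure R).
Variables p gamma : R.
Hypothesis p1 : 1 <= p.
Hypothesis gam : 0 < gamma < 1.
Variable g : R[i] -> R[i].
Hypothesis ga : analytic g.
Hypothesis gRe : forall z, modulus z < 1 -> 0 < complex.Re (g z).
Let p0 : 0 < p. Proof. exact: lt_le_trans p1. Qed.
Local Notation phi := (weight gamma g).
Local Notation E := (energy p phi).
Let mphi : mdisc phi := mdisc_weight gamma ga.
Let phi0 := weight_ge0 gamma g.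

Lemma continuous_seg_cont (f : R -> R) a b : continuous f -> seg_cont a b f.
Proof.
move=> fc x _ e e0; have /cvgrPdist_lt/(_ e e0)[d d0 H] := fc x.
exists d => // y _ yx; rewrite distrC; apply: H => /=; by rewrite distrC.
Qed.

Lemma Rint_EFin (f : R -> R) a b : seg_cont a b f ->
  (\int[lam]_(t in `[a, b]) (f t)%:E = (Rint a b f)%:E)%E.
Proof.
move=> fc; rewrite /Rint /Rintegral fineK//.
exact: (integrable_fin_num _ (seg_cont_integrable fc)).
Qed.

Lemma weight_powR_circle (r a : R) : 0 <= r -> r < 1 ->
  continuous (fun t => modulus (g (polar r t)) `^ a).
Proof.
move=> r0 r1; apply: (@circle_continuous R (fun z => modulus (g z) `^ a)) => // z zr.
have z1 : modulus z < 1 by rewrite zr.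
apply: (@rcont_comp R (fun z => modulus (g z)) (fun x => x `^ a)).
  exact: analytic_mod_rcont.
by apply: powR_continuous_at; rewrite mod_gt0 Re_gt0_neq0// gRe.
Qed.

Definition moment n : R := \int[lebesgue_measure]_(r in `]0, 1[)
  \int[lebesgue_measure]_(t in `[0, 2 * pi])
    (r `^ (p * n%:R + 1) * modulus (g (polar r t)) `^ gamma).

(** Polar coordinates: [r ^ (p n)] comes from the monomial and one more [r] from the Jacobian. An
    infinite energy yields 0 on both sides. *)
Lemma moment_energy n : moment n = fine (E (fun z => z ^+ n)).
Proof.
rewrite /moment /Rintegral /energy; congr fine.
rewrite /dint (@disc_polar R (fun z => modulus (z ^+ n) `^ p * phi z)).
- apply: eq_integral => r; rewrite inE /= in_itv /= => /andP[r0 r1].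
  have wc := weight_powR_circle (a := gamma) (ltW r0) r1.
  have sc := continuous_seg_cont (a := 0) (b := 2 * pi) wc.
  change ((Rint 0 (2 * pi) (fun t => r `^ (p * n%:R + 1) * modulus (g (polar r t)) `^ gamma))%:E =
    (r%:E * \int[lam]_(t in `[0%R, (2 * pi)%R]) (modulus (polar r t ^+ n) `^ p * phi (polar r t))%:E)%E).
  have -> : (fun t => (modulus (polar r t ^+ n) `^ p * phi (polar r t))%:E) =
     (fun t => (r `^ (p * n%:R) * modulus (g (polar r t)) `^ gamma)%:E).
    apply/funext => t; rewrite modX mod_polar ?(ltW r0)// -powR_mulrn ?(ltW r0)//.
    by rewrite -powRrM [n%:R * p]mulrC.
  rewrite Rint_EFin ?RintZ//; last exact: seg_contZ.
  have rr : r `^ (p * n%:R + 1) = r * r `^ (p * n%:R).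
    rewrite powRD; last by apply/implyP => _; rewrite gt_eqF.
    by rewrite powRr1 ?(ltW r0)// mulrC.
  by rewrite rr -EFinM mulrA.
- exact: (mdisc_energy p mphi (analyticX (m := n))).
- by move=> z; rewrite mulr_ge0 ?powR_ge0.
move=> r r0 r1.
have -> : (fun t => modulus (polar r t ^+ n) `^ p * phi (polar r t)) =
    (fun t => (r ^+ n) `^ p * modulus (g (polar r t)) `^ gamma).
  by apply/funext => t; rewrite modX mod_polar ?(ltW r0).
by move=> t; apply: cvgMr; exact: (weight_powR_circle (a := gamma) (ltW r0) r1).
Qed.

(** For [|z| < 1/2] the weight is bounded; elsewhere 1 is at most [2^n |z|^n], so the finite moment
    of order [n] dominates. *)
Lemma energy1_lty n : (E (fun z => z ^+ n)%R < +oo)%E -> (E (fun=> 1%R) < +oo)%E.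
Proof.
move=> Eoo; have h20 : 0 < 2^-1 :> R by rewrite invr_gt0.
have h21 : 2^-1 < 1 :> R by rewrite invf_lt1// ltr1n.
have [m [M [m0 M0 HM]]] := weight_bounded gam ga gRe h20 h21.
pose C : R := (2 ^+ n) `^ p; have C0 : 0 <= C by exact: powR_ge0.
have mE := mdisc_energy p mphi (analyticX (m := n)).
have E0 z : modulus z < 1 -> 0 <= modulus (z ^+ n) `^ p * phi z.
  by move=> _; rewrite mulr_ge0 ?powR_ge0.
apply: (@le_lt_trans _ _ (dint (fun z => C * (modulus (z ^+ n) `^ p * phi z) + M))).
  apply: le_dint => z z1; first by rewrite mulr_ge0 ?powR_ge0.
  rewrite mod1 powR1 mul1r; have [zh|zh] := ltP (modulus z) 2^-1.
    have /andP[_ h] := HM z zh; apply: le_trans h _.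
    by rewrite lerDr mulr_ge0// E0.
  apply: (@le_trans _ _ (C * (modulus (z ^+ n) `^ p * phi z))); last by rewrite lerDl ltW.
  rewrite mulrA ler_peMl// /C -powRM ?exprn_ge0 ?mod_ge0// modX -exprMn.
  apply: powR_ge1; last exact: ltW.
  by apply: exprn_ege1; rewrite mulrC -ler_pdivrMr// mul1r.
rewrite dintD//.
- apply: lte_add_pinfty; last exact: dint_cst_lty (ltW M0).
  by rewrite dintZ//; apply: lte_mul_pinfty; rewrite ?lee_fin.
- exact: (mdiscM (mdisc_cst C) mE).
- exact: mdisc_cst.
- by move=> z z1; rewrite mulr_ge0// E0.
- by move=> z _; exact: ltW.
Qed.

Lemma rcont_powR (F : R[i] -> R) z : (forall z, 0 <= F z) -> rcont F z ->
  rcont (fun z => F z `^ p) z.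
Proof.
move=> F0 Fz; have := F0 z; rewrite le_eqVlt => /predU1P[Fz0|Fz0]; last first.
  exact: (rcont_comp Fz (powR_continuous_at (a := p) Fz0)).
move=> e e0; have e1 : 0 < Num.min e 1 by rewrite lt_min e0 ltr01.
have [d d0 Hd] := Fz _ e1; exists d => // h hd.
have := Hd h hd; rewrite -Fz0 !subr0 powR0 ?gt_eqF// subr0 ger0_norm// ger0_norm ?powR_ge0//.
rewrite lt_min => /andP[h1 h2]; apply: le_lt_trans h1.
by apply: powR_le_self => //; exact: ltW.
Qed.

Lemma mod_powR_circle f (r : R) : analytic f -> 0 <= r -> r < 1 ->
  continuous (fun t => modulus (f (polar r t)) `^ p).
Proof.
move=> fa r0 r1; apply: (@circle_continuous R (fun z => modulus (f z) `^ p)) => // z zr.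
apply: (@rcont_powR (fun z => modulus (f z))); first by move=> x; exact: mod_ge0.
by apply: analytic_mod_rcont; rewrite ?zr.
Qed.

(** From [|f| <= 1 + |f|^p] and [mod_center_le], the mean integral of [|f|^p] is at least
    [4 pi - 2 pi]; the threshold 4 is chosen so that this is positive. *)
Lemma circle_mean_ge f (r m : R) : analytic f -> 0 < r -> r < 1 -> 0 < m ->
  (forall z, modulus z = r -> m <= phi z) -> 4 <= modulus (f 0) ->
  m * pi <= Rint 0 (2 * pi) (fun t => modulus (f (polar r t)) `^ p * phi (polar r t)).
Proof.
move=> fa r0 r1 m0 Hm f4; have pi0 := pi_gt0 R.
have c1 := mod_powR_circle fa (ltW r0) r1.
have s1 : seg_cont 0 (2 * pi) (fun t => modulus (f (polar r t)) `^ p) := continuous_seg_cont c1.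
have s2 : seg_cont 0 (2 * pi) (fun t => modulus (f (polar r t)) `^ p * phi (polar r t)).
  apply: continuous_seg_cont => t; apply: cvgM; first exact: c1.
  exact: (weight_powR_circle (a := gamma) (ltW r0) r1).
have s0 : seg_cont 0 (2 * pi) (fun t => modulus (f (polar r t))).
  exact: (ccont_mod (analytic_circle_ccont (a := 0) (b := 2 * pi) fa r0 r1)).
have i1 : Rint 0 (2 * pi) (fun t => modulus (f (polar r t))) <=
    Rint 0 (2 * pi) (fun t => 1 + modulus (f (polar r t)) `^ p).
  apply: le_Rint => //; first exact: (seg_contD (@seg_cont_cst R 0 (2 * pi) 1) s1).
  move=> t _; have := mod_ge0 (f (polar r t)); move: (modulus _) => x x0.
  have [x1|x1] := leP x 1; first by rewrite ler_wpDr ?powR_ge0.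
  by rewrite ler_wpDl//; apply: le1r_powR => //; exact: ltW.
have i2 : m * Rint 0 (2 * pi) (fun t => modulus (f (polar r t)) `^ p) <=
    Rint 0 (2 * pi) (fun t => modulus (f (polar r t)) `^ p * phi (polar r t)).
  rewrite -RintZ//; apply: le_Rint => //; first exact: seg_contZ.
  by move=> t _; rewrite mulrC ler_wpM2l ?powR_ge0// Hm// mod_polar// ltW.
apply: le_trans i2; rewrite ler_pM2l//.
have := mod_center_le fa r0 r1; move: i1.
rewrite (RintD (@seg_cont_cst R 0 (2 * pi) 1) s1) Rint_cst ?mulr_ge0 ?(ltW pi0)//.
have : 4 * pi <= modulus (f 0) * pi by rewrite ler_pM2r.
lra.
Qed.

(** Continuity of evaluation at 0 in threshold form, with the same constant 4; it follows by
    integrating [circle_mean_ge] over radii between 1/4 and 1/2. *)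
Lemma evaluation_bounded : exists2 y : R, 0 < y & forall f, analytic f ->
  (E f < y%:E)%E -> modulus (f 0) < 4.
Proof.
have [||m [M [m0 M0 HM]]] := @weight_bounded R gamma gam g ga gRe 2^-1.
- by rewrite invr_gt0.
- by rewrite invf_lt1// ltr1n.
have pi0 := pi_gt0 R.
(* One factor 1/4 bounds the Jacobian [r] from below, the other is the length of the interval of
   radii. *)
exists (4^-1 * (m * pi) * 4^-1); first by rewrite !mulr_gt0.
move=> f fa; rewrite !ltNge; apply: contra => f4.
rewrite /energy /dint (@disc_polar R (fun z => modulus (f z) `^ p * phi z)).
- apply: (@le_trans _ _ (\int[lam]_(r in `](4^-1)%R, (2^-1)%R[) (cst (4^-1 * (m * pi))%:E r))%E).
    rewrite integral_cst//.
    have L : lam `]4^-1, 2^-1[%classic = (4^-1)%:E.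
      rewrite lebesgue_measure_itv/= lte_fin ltf_pV2 ?posrE// ltr_nat/= -EFinD; congr EFin; lra.
    by rewrite [X in (_ * X)%E](_ : _ = (4^-1)%:E) -?EFinM.
  apply: ge0_le_integral_subset.
  + by move=> r /=; rewrite !in_itv /= => /andP[r1 r2]; apply/andP; split; lra.
  + by move=> r _; rewrite lee_fin !mulr_ge0// ltW.
  + move=> r /=; rewrite in_itv /= => /andP[r1 r2]; apply: mule_ge0; first by rewrite lee_fin ltW.
    by apply: integral_ge0 => t _; rewrite lee_fin mulr_ge0 ?powR_ge0.
  move=> r /=; rewrite in_itv /= => /andP[r1 r2].
  have r0 : 0 < r by lra. have r1' : r < 1 by lra.
  have c1 := mod_powR_circle fa (ltW r0) r1'.
  rewrite Rint_EFin; last first.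
    apply: continuous_seg_cont => t; apply: cvgM; first exact: c1.
    exact: (weight_powR_circle (a := gamma) (ltW r0) r1').
  rewrite -EFinM lee_fin; apply: ler_pM; rewrite ?mulr_ge0 ?(ltW m0) ?(ltW pi0) ?(ltW r1)//.
  apply: circle_mean_ge => // z zr; have zh : modulus z < 2^-1 by rewrite zr.
  by have /andP[] := HM z zh.
- exact: (mdisc_energy p mphi fa).
- by move=> z; rewrite mulr_ge0 ?powR_ge0.
move=> r r0 r1 t; apply: cvgM; first exact: (mod_powR_circle fa (ltW r0) r1).
exact: (weight_powR_circle (a := gamma) (ltW r0) r1).
Qed.

(** Positivity lets this factor be divided out of the supremum in (ii); it holds because [g] is
    bounded on a slightly larger disc. *)
Lemma weight_powRV_Rint_gt0 (r a : R) : 0 < r -> r < 1 -> 0 <= a ->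
  0 < Rint 0 (2 * pi) (fun t => (modulus (g (polar r t)) `^ a)^-1).
Proof.
move=> r0 r1 a0; have pi0 := pi_gt0 R.
have [||M M0 HM] := analytic_bounded (rho := (1 + r) / 2) ga; [lra|lra|].
have Ma : 0 < M `^ a by rewrite powR_gt0.
apply: (@lt_le_trans _ _ (Rint 0 (2 * pi) (fun=> (M `^ a)^-1))).
  by rewrite Rint_cst ?mulr_gt0 ?invr_gt0 ?subr0 ?mulr_gt0// mulr_ge0// ltW.
have gp t : 0 < modulus (g (polar r t)).
  by rewrite mod_gt0 Re_gt0_neq0// gRe// mod_polar// ltW.
apply: le_Rint.
- exact: seg_cont_cst.
- apply: continuous_seg_cont => t; apply: cvgV; first by rewrite gt_eqF// powR_gt0.
  exact: (weight_powR_circle (a := a) (ltW r0) r1).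
move=> t _; rewrite lef_pV2 ?posrE ?powR_gt0//.
apply: ge0_ler_powR; rewrite ?nnegrE ?mod_ge0 ?(ltW M0)//.
by apply: HM; rewrite mod_polar ?(ltW r0)//; lra.
Qed.

Variable w : nat -> R[i].
Hypothesis w_neq0 : forall n, (1 <= n)%N -> w n != 0.

Lemma hypercyclic_of_moments : bounded_backward_shift p phi w ->
  (forall M : R, exists n, M < modulus (wprod w n) * moment n `^ (- p^-1)) ->
  hypercyclic p phi (backward_shift w).
Proof.
move=> HB Hsup; have [K K1 HK] := bounded_shift_energy p1 phi0 HB.
have pv0 : - p^-1 != 0 by rewrite oppr_eq0 invr_eq0 gt_eqF.
have E1 : (E (fun=> 1%R) < +oo)%E.
  have [n] := Hsup 0; rewrite moment_energy => h.
  apply: (energy1_lty (n := n)).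
  have := energy_ge0 p phi0 (fun z => z ^+ n).
  move: h; case: (E _) => [y _ _|/=|//]; first exact: ltry.
  by rewrite powR0// mulr0 => h; rewrite ltxx in h.
have small (d : R) : 0 < d -> exists n, ratio p gamma g w n < d.
  (* Raised to the power [p], the inequality says that [|W_n|^p] divided by the energy of [z^n]
     exceeds [1 / d]. *)
  move=> d0; have [n h] := Hsup (d^-1 `^ p^-1); exists n.
  have e0 := mono_energy_gt0 p1 gam ga gRe E1 n.
  have W0 : 0 < modulus (wprod w n) by rewrite mod_gt0 wprod_neq0.
  have := gt0_ltr_powR p0 _ _ h; rewrite !nnegrE powR_ge0 mulr_ge0 ?powR_ge0 ?(ltW W0)//.
  move=> /(_ isT isT); rewrite powRM ?powR_ge0 ?(ltW W0)// -!powRrM mulVf ?gt_eqF//.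
  rewrite mulNr mulVf ?gt_eqF// powRr1 ?invr_ge0 ?(ltW d0)//.
  rewrite moment_energy powR_inv1 ?(ltW e0)// => h2.
  rewrite /ratio ltr_pdivrMr ?powR_gt0// mulrC -ltr_pdivrMr// mulrC.
  by rewrite -ltr_pdivlMr.
have [f [fa foo Hf]] := exists_hypercyclic p1 gam ga gRe w_neq0 K1 HK E1 small.
exists f; first by apply/(bergmanE p phi0).
move=> h /(bergmanE p phi0)[ha hoo] x x0.
have y0 : 0 < pi * x `^ p :> R by rewrite mulr_gt0 ?pi_gt0 ?powR_gt0.
have [n Hn] := Hf h ha hoo _ y0; exists n.
exact: (energy_lt_norm p1 phi0 x0 Hn).
Qed.

Lemma orbit_at0_bounded f (r C : R) : bounded_backward_shift p phi w -> bergman p phi f ->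
  0 < r -> r < 1 -> (forall n, (1 <= n)%N -> modulus (wprod w n) <= C * r ^+ n) ->
  exists D, forall n, modulus (iter n (backward_shift w) f 0) <= D.
Proof.
move=> HB fb r0 r1 HC; have [K K1 HK] := bounded_shift_energy p1 phi0 HB.
have [fa foo] := (bergmanE p phi0 f).1 fb.
have [e1 Ba BE] := HK f fa foo.
have Boo : (E (backward_shift w f) < +oo)%E.
  by apply: le_lt_trans BE _; apply: lte_mul_pinfty; rewrite ?lee_fin// (le_trans _ K1).
have [M M0 HM] := expansion_subexp e1 r0 r1.
set b := shift_seq _ _ in e1 HM.
have C0 : 0 <= C.
  have := HC 1%N isT; rewrite expr1 => h.
  by rewrite -(pmulr_lge0 _ r0) (le_trans _ h)// mod_ge0.
have CM : 0 <= C * M by rewrite mulr_ge0// ltW.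
(* The three summands cover the iterates 0, 1 and those from 2 on; the bound on [wprod w n] is
   available only for [n >= 1]. *)
exists (modulus (f 0) + modulus (b 0%N) + C * M) => -[|n].
  by rewrite -addrA lerDl addr_ge0 ?mod_ge0.
(* The iterate is regarded as an iterate on [backward_shift w f], whose expansion is provided by the
   boundedness of the shift. *)
rewrite iterSr.
have [/expansion_at0 -> _ _] := iter_backward_shift w_neq0 K1 HK n Ba Boo e1.
rewrite add0n wprod0 divr1; case: n => [|n].
  rewrite wprod0 mul1r addrAC lerDr addr_ge0 ?mod_ge0//.
rewrite modM ler_wpDl ?addr_ge0 ?mod_ge0//.
apply: (@le_trans _ _ ((C * r ^+ n.+1) * modulus (b n.+1))).
  by rewrite ler_wpM2r ?mod_ge0// HC.
by rewrite -mulrA ler_wpM2l// mulrC.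
Qed.

(** [bound_inverse] with [e = 1] bounds the integrand by 1, whatever the growth of the weight. *)
Lemma energy_resolvent_lty : (E (resolvent g 1) < +oo)%E.
Proof.
have one0 : 0 <= 1 :> R by [].
have one1 : 0 < 1 :> R by [].
apply: le_lt_trans (dint_cst_lty one0).
apply: le_dint => z z1; first by rewrite mulr_ge0 ?powR_ge0.
have := bound_inverse p1 gam (gRe z1) one1 (lexx 1).
by rewrite invr1 powR1.
Qed.

Lemma hypercyclic_unbounded (r C : R) : g 0 = 1 -> bounded_backward_shift p phi w ->
  hypercyclic p phi (backward_shift w) -> 0 < r -> r < 1 ->
  exists2 n, (1 <= n)%N & C * r ^+ n < modulus (wprod w n).
Proof.
move=> g01 HB [f fb Hf] r0 r1; apply: contrapT => HC.
have [|D HD] := orbit_at0_bounded (C := C) HB fb r0 r1.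
  by move=> n n1; rewrite leNgt; apply/negP => h; apply: HC; exists n.
have D0 : 0 <= D by apply: le_trans (HD 0%N); exact: mod_ge0.
have [y y0 Hy] := evaluation_bounded.
(* As [g 0 = 1], the target has value [c / 2 = D + 4] at 0, at distance at least 4 from all values
   of the orbit there. *)
pose c : R := 2 * (D + 4); have c0 : 0 <= c by rewrite mulr_ge0// addr_ge0.
pose h z := c%:C * resolvent g 1 z.
have one1 : 0 < 1 :> R by [].
have ra := resolvent_analytic ga gRe one1.
have ha : analytic h := analyticM (analytic_cst (c := c%:C)) ra.
have hb : bergman p phi h.
  apply/(bergmanE p phi0); split; first exact: ha.
  apply: (@le_lt_trans _ _ ((c `^ p)%:E * E (resolvent g 1))%E); last first.
    by apply: lte_mul_pinfty; rewrite ?lee_fin ?powR_ge0 ?energy_resolvent_lty.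
  apply: (energy_le p1 mphi phi0 ra c0) => z _.
  by rewrite /h modM mod_real ger0_norm.
have pi0 := pi_gt0 R.
(* The norm radius that corresponds to the energy threshold [y]. *)
have x0 : 0 < (y / pi) `^ p^-1 by apply: powR_gt0; rewrite divr_gt0.
have [n Hn] := Hf h hb _ x0.
have {}Hn := norm_lt_energy p1 phi0 x0 Hn.
have [fa foo] := (bergmanE p phi0 f).1 fb.
have [K K1 HK] := bounded_shift_energy p1 phi0 HB.
have [ia _] := iter_shift_analytic K1 HK n fa foo.
have := Hy _ (analyticB ia ha); rewrite -powRrM mulVf ?gt_eqF// powRr1 in Hn; last first.
  by apply: divr_ge0; exact: ltW.
rewrite mulrC divfK ?gt_eqF// in Hn.
move=> /(_ Hn) h4; have := HD n.
have : modulus (h 0) = D + 4.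
  rewrite /h /resolvent g01 modM modV mod_real ger0_norm//.
  have -> : (1%:C + 1 : R[i]) = 2%:C by rewrite -[1 in X in _ + X]/(1%:C) -rmorphD.
  by rewrite mod_real ger0_norm// /c mulrAC divff ?mul1r.
have := modDB (iter n (backward_shift w) f 0) (h 0).
move: h4; rewrite modB; have := modB_ge (h 0) (iter n (backward_shift w) f 0).
lra.
Qed.

End Criterion.

Theorem proposition4p17 (R : realType) (p gamma : R) (g : R[i] -> R[i])
    (w : nat -> R[i]) :
  1 <= p ->
  0 < gamma < 1 ->
  univalent_on_disc g ->
  (forall z, unit_disc z -> 0 < complex.Re (g z)) ->
  g 0 = 1 ->
  (forall n, (1 <= n)%N -> w n != 0) ->
  let phi := fun z => modulus (g z) `^ gamma in
  bounded_backward_shift p phi w ->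
  (ereal_sup [set (modulus (\prod_(1 <= k < n.+1) w k) *
       (\int[lebesgue_measure]_(r in `]0, 1[)
          \int[lebesgue_measure]_(t in `[0, 2 * pi])
             (r `^ (p * n%:R + 1) * modulus (g (polar r t)) `^ gamma))
       `^ (- p^-1))%:E | n in [set n | (1 <= n)%N]] = +oo%E ->
   hypercyclic p phi (backward_shift w)) /\
  (hypercyclic p phi (backward_shift w) ->
   forall r : R, 0 < r < 1 ->
   ereal_sup [set (modulus (\prod_(1 <= k < n.+1) w k) *
       (r ^+ n * (1 - r) `^ (2 / p))^-1 *
       \int[lebesgue_measure]_(t in `[0, 2 * pi])
          (modulus (g (polar r t)) `^ (gamma / p))^-1)%:E
       | n in [set n | (1 <= n)%N]] = +oo%E).
Proof.
move=> p1 gam [ga _] gRe g01 w_neq0 phi HB; split.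
  move=> /ereal_sup_pinfty Hsup.
  apply: (hypercyclic_of_moments p1 gam ga gRe w_neq0 HB) => M.
  by have [n _ Hn] := Hsup M; exists n.
move=> Hhyp r /andP[r0 r1].
have p0 : 0 < p by exact: lt_le_trans p1.
have a0 : 0 <= gamma / p by case/andP: gam => [h _]; rewrite divr_ge0// ltW.
have := weight_powRV_Rint_gt0 ga gRe r0 r1 a0; rewrite /Rint.
set J := (\int[lebesgue_measure]_(t in _) _)%R => J0.
have q0 : 0 < (1 - r) `^ (2 / p) by rewrite powR_gt0// subr_gt0.
apply: ereal_sup_eq_pinfty => M.
(* With [r] fixed, the integral [J] and the power of [1 - r] are positive constants and move into
   the constant of the lemma. *)
have [n n1 Hn] := hypercyclic_unbounded p1 gam ga gRe w_neq0
  (M / J * (1 - r) `^ (2 / p)) g01 HB Hhyp r0 r1.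
exists n => //; rewrite -ltr_pdivrMr// ltr_pdivlMr ?mulr_gt0 ?exprn_gt0//.
by rewrite [r ^+ n * _]mulrC mulrA.
Qed.
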